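(* Suppose $(S,T)$ is a closed triangulated surface with set of edges $E$, and let $\lambda\le -1$. (a) The space $\Phi_\lambda(P_{\mathbb E^2}(S,T))$ is a proper (i.e. closed as a subset) smooth codimension-1 submanifold of $\mathbb R^E$. (b) The space $\Psi_\lambda(P_{\mathbb H^2}(S,T))$ is an open set in $\mathbb R^E$ bounded by $-\Phi_\lambda(P_{\mathbb E^2}(S,T))$ and the linear inequalities $$\sum_{i=1}^k z(e_{n_i})>0,$$ where $z\in\mathbb R^E$ and $\{e_{n_1},\dots,e_{n_k}\}$ is any edge cycle.
   Context: A closed triangulated surface $(S,T)$ is a connected closed surface obtained from a finite disjoint union of triangles by identifying all edges in pairs by homeomorphisms; $T$ is the resulting cell structure (cells need not be embedded), with edge set $E$ and set of triangles $T^{(2)}$. Each triangle is counted as having three edges and three corners (with multiplicity); each edge is faced by exactly two corners. For $K^2=\mathbb E^2$ or $\mathbb H^2$, $P_{K^2}(S,T)\subset\mathbb R_{>0}^E$ is the set of $K^2$ polyhedral metrics: functions $l:E\to\mathbb R_{>0}$ such that for each triangle with edges $e_i,e_j,e_k$ the numbers $l(e_i),l(e_j),l(e_k)$ are the edge lengths of a (non-degenerate) triangle in $K^2$. Such an $l$ determines the inner angles at all corners. $\Phi_\lambda(l)=\phi_\lambda\in\mathbb R^E$ with $\phi_\lambda(e)=\int_{\pi/2}^{a}\sin^\lambda(t)\,dt+\int_{\pi/2}^{a'}\sin^\lambda(t)\,dt$, where $a,a'$ are the inner angles facing $e$. $\Psi_\lambda(l)=\psi_\lambda\in\mathbb R^E$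 with $\psi_\lambda(e)=\int_0^{(b+c-a)/2}\cos^\lambda(t)\,dt+\int_0^{(b'+c'-a')/2}\cos^\lambda(t)\,dt$, where $b,c$ (resp. $b',c'$) are the other two angles in the triangle containing $a$ (resp. $a'$). For $X\subset\mathbb R^E$, $-X=\{x:-x\in X\}$. An edge cycle is an edge loop in the 1-skeleton of the dual cell decomposition, without backtracking: edges $e_{n_1},\dots,e_{n_k}$ and triangles $\sigma_1,\dots,\sigma_k$ (indices mod $k$) such that $e_{n_i}$ and $e_{n_{i+1}}$ are two different sides of $\sigma_i$, and $\sigma_{i-1},\sigma_i$ lie on the two sides of $e_{n_i}$. An open set $U$ being ''bounded by'' a given set $H$ and a given collection of strict linear inequalities means: every point of $U$ satisfies all the inequalities, and every boundary point of $U$ in $\mathbb R^E$ either belongs to $H$ or lies on a hyperplane where one of the inequalities is an equality. *)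

(* Defs.v *)
From HB Require Import structures.
From mathcomp Require Import all_boot all_order all_algebra.
From mathcomp Require Import all_classical all_reals all_analysis.

Set Implicit Arguments.
Unset Strict Implicit.
Unset Printing Implicit Defensive.

Import Order.TTheory GRing.Theory Num.Theory numFieldNormedType.Exports.

Local Open Scope classical_set_scope.
Local Open Scope ring_scope.

(* The vertices and the sides of a triangle are both indexed by 'I_3, vertex i
   being opposite to side i; thus side i joins the vertices ordS i and
   ord_pred i, and the corner (t, i) is the one that faces the side (t, i).
   An edge is a fibre of ts_edge, i.e. a pair of identified sides, which may
   belong to the same triangle.  Up to isotopy there are two homeomorphisms
   between two sides, and ts_flip tells which one is used: true if it exchanges
   the directions "from ordS i to ord_pred i" of the two sides, false if it
   preserves them.  Metrics and angles do not depend on ts_flip.  Triangles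
   being glued along sides only, the surface is connected iff any two triangles
   are related by a chain of triangles in which neighbours share an edge. *)
Record triangulated_surface := TriangulatedSurface {
  ts_tri : finType ;
  ts_nedge : nat ;
  ts_edge : ts_tri * 'I_3 -> 'I_ts_nedge ;
  ts_flip : 'I_ts_nedge -> bool ;
  ts_edge_two_sides :
    forall e, #|[set s : ts_tri * 'I_3 | ts_edge s == e]%SET| = 2%N ;
  ts_nonempty : (0 < #|ts_tri|)%N ;
  ts_connected : forall t t' : ts_tri,
    connect [rel u v | [exists i, exists j, ts_edge (u, i) == ts_edge (v, j)]]
            t t' }.

(* ec_in i and ec_out i are the sides of the triangle ec_tri i through which
   the cycle enters and leaves it; ordS is the cyclic successor.  A cycle may
   pass several times through an edge or a triangle. *)
Record edge_cycle (S : triangulated_surface) := EdgeCycle {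
  ec_len : nat ;
  ec_tri : 'I_ec_len.+1 -> ts_tri S ;
  ec_in : 'I_ec_len.+1 -> 'I_3 ;
  ec_out : 'I_ec_len.+1 -> 'I_3 ;
  ec_no_backtrack : forall i, ec_in i != ec_out i ;
  ec_same_edge : forall i,
    ts_edge (ec_tri i, ec_out i) = ts_edge (ec_tri (ordS i), ec_in (ordS i)) ;
  ec_two_sides : forall i,
    (ec_tri i, ec_out i) != (ec_tri (ordS i), ec_in (ordS i)) }.

Definition cycle_sum (R : realType) (S : triangulated_surface)
    (c : edge_cycle S) (z : 'rV[R]_(ts_nedge S)) : R :=
  \sum_(i < (ec_len c).+1) z 0 (ts_edge (ec_tri i, ec_in i)).

(* geo_angle p q r is the angle at p of the triangle p q r. *)
Record geometry (R : realType) := Geometry {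
  geo_point : Type ;
  geo_dist : geo_point -> geo_point -> R ;
  geo_angle : geo_point -> geo_point -> geo_point -> R ;
  geo_collinear : geo_point -> geo_point -> geo_point -> Prop }.

Definition vector_angle (R : realType) (V : Type) (B : V -> V -> R)
    (u v : V) : R :=
  acos (B u v / (Num.sqrt (B u u) * Num.sqrt (B v v))).

Definition euclid_dot (R : realType) (u v : 'rV[R]_2) : R :=
  \sum_i u 0 i * v 0 i.

Definition euclidean_plane (R : realType) : geometry R := {|
  geo_point := 'rV[R]_2 ;
  geo_dist := fun p q => Num.sqrt (euclid_dot (q - p) (q - p)) ;
  geo_angle := fun p q r => vector_angle (@euclid_dot R) (q - p) (r - p) ;
  geo_collinear := fun p q r => \det (col_mx (q - p) (r - p)) = 0 |}.

(* The hyperboloid model: the geodesics are the sections by the planes through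
   the origin, and the Lorentz form is positive definite on tangent planes. *)
Definition lorentz (R : realType) (u v : 'rV[R]_3) : R :=
  - (u 0 0 * v 0 0) + u 0 1 * v 0 1 + u 0 2%:R * v 0 2%:R.

Record hyperboloid (R : realType) := Hyperboloid {
  hyp_val :> 'rV[R]_3 ;
  hyp_eq : lorentz hyp_val hyp_val = -1 ;
  hyp_gt0 : 0 < hyp_val 0 0 }.

Definition arcosh (R : realType) (x : R) : R := ln (x + Num.sqrt (x ^+ 2 - 1)).

(* A vector tangent at p to the geodesic from p to q. *)
Definition hyp_tangent (R : realType) (p q : 'rV[R]_3) : 'rV[R]_3 :=
  q + lorentz p q *: p.

Definition hyperbolic_plane (R : realType) : geometry R := {|
  geo_point := hyperboloid R ;
  geo_dist := fun p q => arcosh (- lorentz p q) ;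
  geo_angle := fun p q r =>
    vector_angle (@lorentz R) (hyp_tangent p q) (hyp_tangent p r) ;
  geo_collinear := fun p q r => \det (col_mx p (col_mx q r)) = 0 |}.

Section Metrics.
Variables (R : realType) (K : geometry R) (S : triangulated_surface).
Implicit Types (l : 'rV[R]_(ts_nedge S)) (t : ts_tri S).

Definition realizes l t (p : 'I_3 -> geo_point K) : Prop :=
  ~ geo_collinear (p 0) (p 1) (p 2%:R) /\
  forall i, geo_dist (p (ordS i)) (p (ord_pred i)) = l 0 (ts_edge (t, i)).

Definition polyhedral_metric : set 'rV[R]_(ts_nedge S) :=
  [set l : 'rV[R]_(ts_nedge S) |
    (forall e, 0 < l 0 e) /\ forall t, exists p, realizes l t p].

(* Triangles realizing the same side lengths are congruent, so that xget chooses
   in a singleton whenever l is a polyhedral metric. *)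
Definition inner_angle l (c : ts_tri S * 'I_3) : R :=
  xget 0 [set a | exists2 p, realizes l c.1 p &
    a = geo_angle (p c.2) (p (ordS c.2)) (p (ord_pred c.2))].

End Metrics.

Arguments polyhedral_metric {R} K S.
Arguments inner_angle {R} K {S} l c.

(* The integral from a to b, also for b < a: one of the two terms vanishes. *)
Definition oriented_integral (R : realType) (a b : R) (f : R -> R) : R :=
  (\int[@lebesgue_measure R]_(t in `[a, b]) f t) -
  (\int[@lebesgue_measure R]_(t in `[b, a]) f t).

Section Curvatures.
Variables (R : realType) (K : geometry R) (S : triangulated_surface) (lam : R).
Implicit Types l : 'rV[R]_(ts_nedge S).

Definition Phi l : 'rV[R]_(ts_nedge S) :=
  \row_e \sum_(c | ts_edge c == e)
    oriented_integral (pi / 2) (inner_angle K l c) (fun t => sin t `^ lam).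

Definition Psi l : 'rV[R]_(ts_nedge S) :=
  \row_e \sum_(c | ts_edge c == e)
    oriented_integral 0
      ((inner_angle K l (c.1, ordS c.2) + inner_angle K l (c.1, ord_pred c.2)
        - inner_angle K l c) / 2)
      (fun t => cos t `^ lam).

End Curvatures.

Arguments Phi {R} K {S} lam l.
Arguments Psi {R} K {S} lam l.

Fixpoint Ck (R : realType) (m n k : nat) (U : set 'rV[R]_m)
    (f : 'rV[R]_m -> 'rV[R]_n) : Prop :=
  if k is k'.+1 then
    (forall x, U x -> differentiable f x) /\
    (forall v, Ck k' U (fun x => 'D_v f x))
  else forall x, U x -> {for x, continuous f}.

Definition smooth_on (R : realType) (m n : nat) (U : set 'rV[R]_m)
    (f : 'rV[R]_m -> 'rV[R]_n) : Prop := forall k, Ck k U f.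

(* f restricts to a diffeomorphism from U onto V, with inverse g. *)
Definition diffeomorphism (R : realType) (n : nat) (U V : set 'rV[R]_n)
    (f g : 'rV[R]_n -> 'rV[R]_n) : Prop :=
  [/\ smooth_on U f, smooth_on V g,
      forall x, U x -> V (f x) /\ g (f x) = x &
      forall y, V y -> U (g y) /\ f (g y) = y].

(* Embedded submanifolds of codimension 1, by slice charts. *)
Definition smooth_hypersurface (R : realType) (n : nat)
    (M : set 'rV[R]_n) : Prop :=
  forall p, M p -> exists (U V : set 'rV[R]_n) (f g : 'rV[R]_n -> 'rV[R]_n)
      (j : 'I_n),
    [/\ open U, U p, open V, diffeomorphism U V f g &
        f @` (M `&` U) = V `&` [set y | y 0 j = 0]].

(* U is bounded by H and by the strict inequalities 0 < h z, for h in L. *)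
Definition bounded_by (R : realType) (n : nat) (U H : set 'rV[R]_n)
    (L : set ('rV[R]_n -> R)) : Prop :=
  (forall z, U z -> forall h, L h -> 0 < h z) /\
  (forall z, (closure U `\` interior U) z ->
     H z \/ exists2 h, L h & h z = 0).

(* Main.v *)
(* In a Euclidean or hyperbolic triangle, suitable positive multiples of the entries of a
   tangent vector turn its pairing with the derivative of Phi or Psi into a sum over the
   triangles of semidefinite quadratic forms.  For Psi these forms are definite, so Psi is a
   local diffeomorphism and its image is open.  For Phi the kernel consists of the rescalings
   of the metric.  The Euclidean metrics form a convex set in the coordinates l ^ (- lam)
   (reverse Minkowski inequality), and along a segment in these coordinates the pairing of Phi
   with the direction is monotone, so Phi determines the metric up to scaling.

   At a point of the closure of an image, pass to an ultrafilter of metrics along which all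
   angles converge.  Since lam <= -1 the integrals diverge at the ends of the range of the
   angles; as an obtuse angle faces the strictly longest side, the finitely many edges cannot
   support a divergence, so the limit radii (b + c - a) / 2 lie strictly between - pi / 2 and
   pi / 2.  In the Euclidean case all limit angles are therefore positive and the normalized
   metrics converge: the image of Phi is closed, and by rigidity it is near each of its points
   a single sheet, the slice of a local diffeomorphism.  In the hyperbolic case a zero limit
   angle forces the edges of infinite length to contain an edge cycle, around which the terms
   cancel in pairs.  If all limit angles are positive the edge lengths converge by the dual
   cosine law, either all to positive limits, which gives a point of the image of Psi, or all
   to zero, and then the rescaled metrics converge to a Euclidean metric whose Phi is - z. *)

(* The weights make the pairing work. Within a triangle the sines of the Euclidean angles are
   proportional to the sides, and the cosines of the hyperbolic radii to the tanh of the half sides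
   ([radii_tanh_half]). Call this function of the side h. The weight h ^ (- (lam + 1)) depends on
   the edge alone, so it is the same for the two triangles at an edge, and within each triangle it
   leaves one factor common to the three corners. For Phi, the weight times v is the differential of
   l ^ (- lam) divided by - lam; this is why rigidity is proved in these coordinates, where p = -
   lam >= 1 gives the reverse Minkowski inequality.

   In a Euclidean triangle (b + c - a) / 2 = pi / 2 - a, so Psi = - Phi on Euclidean metrics. Hence
   one analysis of limit radii serves both images, and - Phi appears where hyperbolic triangles
   become flat.

   Scaling makes the differential of Phi degenerate. The vector l ^ (- lam) is normal to its range
   and has positive entries, so (1, ..., 1) is a transversal direction, the same for all metrics. *)
Require Import Defs.
From HB Require Import structures.
From mathcomp Require Import all_boot all_order all_algebra.
From mathcomp Require Import all_classical all_reals all_analysis.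
From mathcomp Require Import ring lra.
Import Order.TTheory GRing.Theory Num.Theory numFieldNormedType.Exports.
Local Open Scope classical_set_scope.
Local Open Scope ring_scope.

Set Implicit Arguments.
Unset Strict Implicit.

(** * Smooth functions of several variables *)

Section Calculus.
Variable R : realType.

Section Diff.
Variables V W : normedModType R.
Implicit Types (f g : V -> W) (x : V).

(** The epsilon form of the little-o condition, through which differentials are identified below by
    plain inequalities. *)
Lemma diff_epsP f x (L : {linear V -> W}) : continuous L ->
  (forall e, 0 < e -> \forall y \near x, `|f y - f x - L (y - x)| <= e * `|y - x|) ->
  differentiable f x /\ 'd f x = L :> (V -> W).
Proof.
move=> cL H.
have E : f \o shift x = cst (f x) + L +o_ (0:V) id.
  apply/eqaddoP => e e0.
  have := H e e0; rewrite (near_shift 0) /= => {}H.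
  near=> h.
  have : `|f (h + x) - f x - L (h + x - x)| <= e * `|h + x - x|.
    by near: h; rewrite subr0 in H.
  by rewrite addrK opprD addrA.
have D := @diff_unique _ _ _ f L x cL E.
by split=> //; apply/diff_locallyP; rewrite D.
Unshelve. all: by end_near. Qed.

Lemma diff_eps f x : differentiable f x ->
  forall e, 0 < e ->
    \forall y \near x, `|f y - f x - 'd f x (y - x)| <= e * `|y - x|.
Proof.
move=> /diff_locally /eqaddoP H e e0; rewrite (near_shift 0) subr0.
near=> h => /=.
have : `|f (h + x) - (f x + 'd f x h)| <= e * `|h| by near: h; exact: H.
by rewrite addrK opprD addrA.
Unshelve. all: by end_near. Qed.

Lemma near_eq_differentiable f g x : (\near x, f x = g x) ->
  differentiable f x -> differentiable g x.
Proof.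
move=> fg df.
suff [] : differentiable g x /\ 'd g x = 'd f x :> (V -> W) by [].
apply: diff_epsP => [|e e0]; first exact: diff_continuous.
have := diff_eps df e0; near_simpl => H; near=> y.
rewrite -(nbhs_singleton fg).
have <- : f y = g y by near: y.
by near: y.
Unshelve. all: by end_near. Qed.

End Diff.

Section Scalar.
Variable n : nat.
Implicit Types (U : set 'rV[R]_n) (f g : 'rV[R]_n -> R).

(** Scalar counterpart of [Ck], with the same recursion: products and inverses are available for
    scalar functions, and [Ck_rV] transfers the result to row vectors. *)
Fixpoint Cs k U f : Prop :=
  if k is k'.+1 then
    (forall x, U x -> differentiable f x) /\
    (forall v, Cs k' U (fun x => 'D_v f x))
  else forall x, U x -> {for x, continuous f}.

Lemma Cs_continuous k U f x : Cs k U f -> U x -> {for x, continuous f}.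
Proof.
case: k => [|k] /= H Ux; first exact: H.
by apply: differentiable_continuous; apply: H.1.
Qed.

Lemma CsW k U f : Cs k.+1 U f -> Cs k U f.
Proof.
elim: k f => [|k IH] f [H1 H2] /=.
  by move=> x Ux; apply: differentiable_continuous; apply: H1.
by split=> // v; apply: IH.
Qed.

Lemma Cs_sub k U V f : V `<=` U -> Cs k U f -> Cs k V f.
Proof.
move=> VU; elim: k f => [|k IH] f /=; first by move=> H x /VU; exact: H.
by move=> [H1 H2]; split=> [x /VU|v]; [exact: H1|exact: IH].
Qed.

Lemma open_near U (P : set 'rV[R]_n) x : open U -> U x -> (forall y, U y -> P y) ->
  \forall y \near x, P y.
Proof. by move=> oU Ux H; apply: filterS H _; apply: open_nbhs_nbhs. Qed.

(** Openness is essential: a derivative at a point depends on the values nearby. The lemma allows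
    total functions to be replaced by formulas valid on [U] only. *)
Lemma Cs_eq k U f g : open U -> (forall x, U x -> f x = g x) ->
  Cs k U f -> Cs k U g.
Proof.
move=> oU; elim: k f g => [|k IH] f g fg /=.
  move=> H x Ux; rewrite /prop_for /continuous_at -(fg _ Ux).
  apply: cvg_trans (H x Ux);
  apply: (@near_eq_cvg _ _ (nbhs x)); exact: (open_near oU Ux fg).
move=> [H1 H2]; split=> [x Ux|v].
  apply: near_eq_differentiable (H1 x Ux).
  exact: (open_near oU Ux).
apply: IH (H2 v) => x Ux; apply: near_eq_derive.
exact: (open_near oU Ux fg).
Qed.

Lemma Cs_cst k U c : Cs k U (fun=> c).
Proof.
elim: k c => [|k IH] c /=; first by move=> x _; exact: cst_continuous.
split=> [x _|v]; first exact: differentiable_cst.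
have -> : (fun x => 'D_v (fun=> c) x) = (fun x : 'rV[R]_n => 0 : R).
  by apply/funext => x; exact: derive_cst.
exact: IH.
Qed.

Lemma derive_coord i (v x : 'rV[R]_n) : 'D_v (fun x : 'rV[R]_n => x 0 i) x = v 0 i.
Proof.
have di := differentiable_coord (x : 'M[R]_(1, n)) (0:'I_1) i.
rewrite deriveE //.
pose L : {linear 'rV[R]_n -> R} := HB.pack (fun x : 'rV[R]_n => x 0 i)
  (GRing.isLinear.Build _ _ _ _ (fun x : 'rV[R]_n => x 0 i) (fun k a b => etrans (mxE _ _ _ _) (congr1 (fun t => t + b 0 i) (mxE _ _ _ _)))).
by rewrite (@diff_lin _ _ _ L)//; exact: coord_continuous.
Qed.

Lemma Cs_coord k U i : Cs k U (fun x => x 0 i).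
Proof.
case: k => [|k] /=; first by move=> x _; exact: coord_continuous.
split=> [x _|v]; first exact: differentiable_coord.
have -> : (fun x : 'rV[R]_n => 'D_v (fun x : 'rV[R]_n => x 0 i) x) = (fun=> v 0 i).
  by apply/funext => x; exact: derive_coord.
exact: Cs_cst.
Qed.

Lemma CsD k U f g : open U -> Cs k U f -> Cs k U g -> Cs k U (fun x => f x + g x).
Proof.
move=> oU; elim: k f g => [|k IH] f g /=.
  by move=> Hf Hg x Ux; apply: continuousD; [exact: Hf|exact: Hg].
move=> [f1 f2] [g1 g2]; split=> [x Ux|v].
  by apply: differentiableD; auto.
apply: (Cs_eq oU) (IH _ _ (f2 v) (g2 v)) => x Ux.
by rewrite -deriveD //; apply: diff_derivable; auto.
Qed.

Lemma CsM k U f g : open U -> Cs k U f -> Cs k U g -> Cs k U (fun x => f x * g x).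
Proof.
move=> oU; elim: k f g => [|k IH] f g /=.
  by move=> Hf Hg x Ux; apply: continuousM; [exact: Hf|exact: Hg].
move=> [f1 f2] [g1 g2]; split=> [x Ux|v].
  by apply: differentiableM; auto.
have f0 : Cs k U f by apply: CsW.
have g0 : Cs k U g by apply: CsW.
apply: (Cs_eq oU) (CsD oU (IH _ _ f0 (g2 v)) (IH _ _ g0 (f2 v))) => x Ux.
by rewrite -[RHS]/('D_v (f * g) x) deriveM //; apply: diff_derivable; auto.
Qed.

Lemma CsN k U f : open U -> Cs k U f -> Cs k U (fun x => - f x).
Proof.
move=> oU Hf; apply: (Cs_eq oU) (CsM oU (Cs_cst k U (-1)) Hf) => x _.
by rewrite mulN1r.
Qed.

Lemma CsB k U f g : open U -> Cs k U f -> Cs k U g -> Cs k U (fun x => f x - g x).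
Proof. by move=> oU Hf Hg; apply: (CsD oU Hf); apply: CsN. Qed.

Lemma Cs_sum k U (I : Type) (s : seq I) (P : pred I) (F : I -> 'rV[R]_n -> R) :
  open U -> (forall i, P i -> Cs k U (F i)) ->
  Cs k U (fun x => \sum_(i <- s | P i) F i x).
Proof.
move=> oU HF; elim: s => [|i s IH].
  by apply: (Cs_eq oU) (Cs_cst k U 0) => x _; rewrite big_nil.
case Pi: (P i).
  by apply: (Cs_eq oU) (CsD oU (HF i Pi) IH) => x _; rewrite big_cons Pi.
by apply: (Cs_eq oU) IH => x _; rewrite big_cons Pi.
Qed.

Lemma Cs_prod k U (I : Type) (s : seq I) (P : pred I) (F : I -> 'rV[R]_n -> R) :
  open U -> (forall i, P i -> Cs k U (F i)) ->
  Cs k U (fun x => \prod_(i <- s | P i) F i x).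
Proof.
move=> oU HF; elim: s => [|i s IH].
  by apply: (Cs_eq oU) (Cs_cst k U 1) => x _; rewrite big_nil.
case Pi: (P i).
  by apply: (Cs_eq oU) (CsM oU (HF i Pi) IH) => x _; rewrite big_cons Pi.
by apply: (Cs_eq oU) IH => x _; rewrite big_cons Pi.
Qed.

Lemma derive_comp1 (h : R -> R) (dh : R) f (x v : 'rV[R]_n) :
  differentiable f x -> is_derive (f x) 1 h dh ->
  differentiable (h \o f) x /\ 'D_v (h \o f) x = dh * 'D_v f x.
Proof.
move=> df dh'.
have dfh : differentiable h (f x) by apply/derivable1_diffP; apply: ex_derive.
split; first exact: differentiable_comp.
rewrite deriveE; last exact: differentiable_comp.
rewrite diff_comp // deriveE //= deriv1E; last by apply: ex_derive.
by rewrite /= derive1E derive_val mulrC.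
Qed.

(** Only the composite of the derivative with [f] has to be C^k. For powers, exp, cos and sin the
    derivative is again a function of the same family, which gives an induction on k. *)
Lemma Cs_comp1 k U (h dh : R -> R) f : open U ->
  (forall x, U x -> is_derive (f x) 1 h (dh (f x))) ->
  Cs k U (fun x => dh (f x)) -> Cs k.+1 U f -> Cs k.+1 U (fun x => h (f x)).
Proof.
move=> oU H Hdh Hf; have [f1 f2] := Hf; split=> [x Ux|v].
  by have [] := @derive_comp1 h _ f x 0 (f1 x Ux) (H x Ux).
apply: (Cs_eq oU) (CsM oU Hdh (f2 v)) => x Ux.
by have [_ ->] := @derive_comp1 h _ f x v (f1 x Ux) (H x Ux).
Qed.

Lemma Cs_comp0 U (h dh : R -> R) f :
  (forall x, U x -> is_derive (f x) 1 h (dh (f x))) ->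
  Cs 0 U f -> Cs 0 U (fun x => h (f x)).
Proof.
move=> H Hf x Ux; apply: continuous_comp; first exact: Hf.
apply: differentiable_continuous; apply/derivable1_diffP.
by have ? := H x Ux; apply: ex_derive.
Qed.

Lemma Cs_powR k U f a : open U -> (forall x, U x -> 0 < f x) ->
  Cs k U f -> Cs k U (fun x => f x `^ a).
Proof.
move=> oU f0; elim: k a => [|k IH] a Hf.
  apply: (@Cs_comp0 U (fun t => t `^ a) (fun t => a * t `^ (a - 1))) => //.
  by move=> x Ux; apply: is_derive1_powR; apply: f0.
apply: (@Cs_comp1 k U (fun t => t `^ a) (fun t => a * t `^ (a - 1))) => //.
  by move=> x Ux; apply: is_derive1_powR; apply: f0.
by apply: CsM => //; [exact: Cs_cst|exact: IH (CsW Hf)].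
Qed.

Lemma Cs_cos_sin k U f : open U -> Cs k U f ->
  Cs k U (fun x => cos (f x)) /\ Cs k U (fun x => sin (f x)).
Proof.
move=> oU; elim: k => [|k IH] Hf.
  by split; [apply: (@Cs_comp0 U cos (fun t => - sin t))|
             apply: (@Cs_comp0 U sin cos)].
have [IHc IHs] := IH (CsW Hf).
by split; [apply: (@Cs_comp1 k U cos (fun t => - sin t)) => //; exact: CsN|
           apply: (@Cs_comp1 k U sin cos)].
Qed.

Lemma Cs_expR k U f : open U -> Cs k U f -> Cs k U (fun x => expR (f x)).
Proof.
move=> oU; elim: k => [|k IH] Hf; first by apply: (@Cs_comp0 U expR expR).
by apply: (@Cs_comp1 k U expR expR) => //; apply: IH (CsW Hf).
Qed.

Lemma Cs_inv k U f : open U -> (forall x, U x -> f x != 0) ->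
  Cs k U f -> Cs k U (fun x => (f x)^-1).
Proof.
move=> oU f0; elim: k => [|k IH] Hf.
  by move=> x Ux; apply: continuousV; [exact: f0|exact: Hf].
have [f1 f2] := Hf; split=> [x Ux|v].
  by apply: differentiableV; [exact: f1|exact: f0].
have Hk := IH (CsW Hf).
apply: (Cs_eq oU) (CsN oU (CsM oU (CsM oU Hk Hk) (f2 v))) => x Ux.
rewrite (deriveV (f0 x Ux)); last exact/diff_derivable/f1.
by rewrite -exprVn expr2 scaleNr.
Qed.

Lemma Cs_acos k U f : open U -> (forall x, U x -> -1 < f x < 1) ->
  Cs k U f -> Cs k U (fun x => acos (f x)).
Proof.
move=> oU f1 Hf.
have D x : U x -> is_derive (f x) 1 (@acos R) (- (Num.sqrt (1 - f x ^+ 2))^-1).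
  by move=> Ux; apply: is_derive1_acos; apply: f1.
case: k Hf => [|k] Hf.
  exact: (@Cs_comp0 U acos (fun t => - (Num.sqrt (1 - t ^+ 2))^-1)).
apply: (@Cs_comp1 k U acos (fun t => - (Num.sqrt (1 - t ^+ 2))^-1)) => //.
have p0 x : U x -> 0 < 1 - f x * f x.
  by move=> /f1; set t := f x => /andP[]; nra.
apply: CsN => //.
(* The inverse square root is the power -1/2 of a positive function. *)
apply: (Cs_eq oU) (@Cs_powR k U (fun x => 1 - f x * f x) (- 2^-1) oU p0 _).
  by move=> x Ux; rewrite powRN powR12_sqrt ?expr2// ltW// p0.
by apply: (CsB oU (Cs_cst _ _ _)); apply: CsM => //; exact: CsW.
Qed.

End Scalar.
End Calculus.

(** * Vector-valued maps *)

Section Vector.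
Variable R : realType.

Lemma coord_le_norm n (v : 'rV[R]_n) i : `|v 0 i| <= `|v|.
Proof. by rewrite [leRHS]/Num.Def.normr /= mx_normrE; apply: (le_bigmax _ _ (0, i)). Qed.

Lemma norm_le_coord n (v : 'rV[R]_n) c : 0 <= c ->
  (forall i, `|v 0 i| <= c) -> `|v| <= c.
Proof.
move=> c0 H; rewrite [leLHS]/Num.Def.normr /= mx_normrE; apply: bigmax_le => // -[i j] _ /=.
by rewrite (ord1 i).
Qed.

Lemma mulmx_norm_bound n m (B : 'M[R]_(n, m)) :
  exists2 K, 0 < K & forall v : 'rV[R]_n, `|v *m B| <= K * `|v|.
Proof.
have s0 : 0 <= \sum_i \sum_j `|B i j|.
  by apply: sumr_ge0 => i _; apply: sumr_ge0.
exists (1 + \sum_i \sum_j `|B i j|) => [|v]; first by rewrite ltr_wpDr.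
apply: norm_le_coord => [|j]; first by rewrite mulr_ge0 ?addr_ge0.
rewrite mxE (le_trans (ler_norm_sum _ _ _)) //.
rewrite mulrDl mul1r ler_wpDl // mulr_suml ler_sum // => i _.
rewrite normrM mulrC ler_pM ?coord_le_norm //.
by rewrite (bigD1 j) //= lerDl sumr_ge0.
Qed.

Lemma near_dist_le (V : normedModType R) (x : V) e : 0 < e ->
  \forall y \near x, `|x - y| <= e.
Proof. by move=> e0; apply: cvgr_dist_le. Qed.

Lemma near_forall (V : normedModType R) (I : finType) (P : I -> V -> Prop) (x : V) :
  (forall i, \forall y \near x, P i y) -> \forall y \near x, forall i, P i y.
Proof. exact: filter_forall. Qed.

Lemma nearS2 (V : normedModType R) (P Q S : V -> Prop) (x : V) :
  (\forall y \near x, P y) -> (\forall y \near x, Q y) ->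
  (forall y, P y -> Q y -> S y) -> \forall y \near x, S y.
Proof. by move=> HP HQ H; apply: filterS2 HP HQ. Qed.

Lemma continuous_eps (V W : normedModType R) (f : V -> W) x :
  (forall e, 0 < e -> \forall y \near x, `|f x - f y| <= e) ->
  {for x, continuous f}.
Proof. by move=> H; apply/cvgrPdist_le. Qed.

Lemma continuous_near (V W : normedModType R) (f : V -> W) x e :
  {for x, continuous f} -> 0 < e -> \forall y \near x, `|f x - f y| <= e.
Proof. by move=> H; move: e; apply/cvgrPdist_le. Qed.

Lemma mulmxr_continuous n m (B : 'M[R]_(n, m)) :
  continuous (fun v : 'rV[R]_n => v *m B).
Proof.
have [K K0 HK] := mulmx_norm_bound B.
move=> v; apply: continuous_eps => e e0; have := near_dist_le v (divr_gt0 e0 K0).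
apply: filterS => w Hw; rewrite -mulmxBl (le_trans (HK _)) //.
by rewrite mulrC -ler_pdivlMr.
Qed.

Lemma differentiable_rV (V : normedModType R) n (f : V -> 'rV[R]_n) x :
  (forall i, differentiable (fun y => f y 0 i) x) -> differentiable f x.
Proof.
move=> df.
pose Lf v : 'rV[R]_n := \row_i 'd (fun y => f y 0 i) x v.
have linL : linear Lf.
  by move=> k a b; apply/rowP => i; rewrite !mxE linearP.
pose L : {linear V -> 'rV[R]_n} := HB.pack Lf (GRing.isLinear.Build _ _ _ _ Lf linL).
suff [] : differentiable f x /\ 'd f x = L :> (V -> 'rV[R]_n) by [].
apply: diff_epsP => [v|e e0].
  apply: continuous_eps => e e0.
  have : \forall w \near v, forall i, `|'d (fun y => f y 0 i) x v - 'd (fun y => f y 0 i) x w| <= e.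
    apply: near_forall => i; apply: continuous_near e0.
    exact: diff_continuous (df i) v.
  apply: filterS => w H; apply: norm_le_coord => [|i]; first exact: ltW.
  by rewrite !mxE; exact: H.
have : \forall y \near x, forall i,
    `|f y 0 i - f x 0 i - 'd (fun y => f y 0 i) x (y - x)| <= e * `|y - x|.
  by apply: near_forall => i; apply: diff_eps.
apply: filterS => y H; apply: norm_le_coord => [|i]; first by rewrite mulr_ge0 // ltW.
by rewrite !mxE; exact: H.
Qed.

Lemma differentiable_coordf (V : normedModType R) n (f : V -> 'rV[R]_n) x i :
  differentiable f x -> differentiable (fun y => f y 0 i) x.
Proof.
move=> df; apply: (@differentiable_comp _ _ _ _ f (fun v : 'rV[R]_n => v 0 i)) => //.
exact: differentiable_coord.
Qed.

Lemma derive_coordf n m (f : 'rV[R]_m -> 'rV[R]_n) x v i :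
  differentiable f x -> 'D_v (fun y => f y 0 i) x = ('D_v f x) 0 i.
Proof. by move=> df; rewrite derive_mx ?mxE //; exact: diff_derivable. Qed.

Lemma Ck_rV k m n (U : set 'rV[R]_m) (f : 'rV[R]_m -> 'rV[R]_n) : open U ->
  (forall i, Cs k U (fun x => f x 0 i)) -> Ck k U f.
Proof.
move=> oU; elim: k f => [|k IH] f /= H.
  move=> x Ux; apply: continuous_eps => e e0.
  have : \forall w \near x, forall i, `|f x 0 i - f w 0 i| <= e.
    by apply: near_forall => i; exact: (continuous_near (H i x Ux) e0).
  apply: filterS => w Hw; apply: norm_le_coord => [|i]; first exact: ltW.
  by rewrite !mxE; exact: Hw.
have df x : U x -> differentiable f x.
  by move=> Ux; apply: differentiable_rV => i; exact: (H i).1.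
split=> // v; apply: IH => i; apply: (Cs_eq oU) ((H i).2 v) => x Ux.
by rewrite derive_coordf //; exact: df.
Qed.

Lemma derive_delta n (f : 'rV[R]_n -> R) x v : differentiable f x ->
  'D_v f x = \sum_j v 0 j * 'D_(delta_mx 0 j) f x.
Proof.
move=> df; rewrite deriveE // {1}(row_sum_delta v) linear_sum /=.
by apply: eq_bigr => j _; rewrite linearZ /= deriveE.
Qed.

(** By the chain rule the derivative along v is the sum over j of the derivative of the coordinate
    g_j times the j-th partial derivative of [h] at g x; the induction hypothesis applies to these
    partial derivatives. *)
Lemma Cs_comp k m n (U : set 'rV[R]_m) (W : set 'rV[R]_n) h (g : 'rV[R]_m -> 'rV[R]_n) :
  open U -> (forall x, U x -> W (g x)) ->
  (forall i, Cs k U (fun x => g x 0 i)) -> Cs k W h -> Cs k U (fun x => h (g x)).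
Proof.
move=> oU UW; elim: k h => [|k IH] h Hg Hh.
  move=> x Ux; apply: (@continuous_comp _ _ _ g h); last exact: Hh (UW x Ux).
  by move: x Ux; exact: (Ck_rV oU Hg).
have [h1 h2] := Hh.
have dg x : U x -> differentiable g x.
  by move=> Ux; apply: differentiable_rV => i; exact: (Hg i).1.
split=> [x Ux|v].
  by apply: (@differentiable_comp _ _ _ _ g h); [exact: dg|apply/h1/UW].
apply: (@Cs_eq _ _ k U
  (fun x => \sum_j 'D_v (fun y => g y 0 j) x * 'D_(delta_mx 0 j) h (g x)) _ oU).
  move=> x Ux; rewrite [RHS]deriveE; last first.
    by apply: (@differentiable_comp _ _ _ _ g h); [exact: dg|apply/h1/UW].
  rewrite (@diff_comp _ _ _ _ g h); [|exact: dg|exact/h1/UW].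
  rewrite /= -deriveE; last exact/h1/UW.
  rewrite derive_delta; last exact/h1/UW.
  apply: eq_bigr => j _; congr (_ * _).
  by rewrite derive_coordf ?deriveE //; exact: dg.
apply: (@Cs_sum _ _ k U _ _ _ (fun j x => 'D_v (fun y => g y 0 j) x * 'D_(delta_mx 0 j) h (g x)) oU) => j _.
apply: CsM => //; first exact: (Hg j).2.
by apply: (IH ('D_(delta_mx 0 j) h)) => [i|]; [exact: CsW (Hg i)|exact: h2].
Qed.

Lemma Cs_det k m n (U : set 'rV[R]_m) (M : 'rV[R]_m -> 'M[R]_n) : open U ->
  (forall i j, Cs k U (fun x => M x i j)) -> Cs k U (fun x => \det (M x)).
Proof.
move=> oU H; apply: Cs_sum => // s _; apply: CsM => //; first exact: Cs_cst.
by apply: Cs_prod.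
Qed.

(** Cramer's rule: the entries are cofactors divided by the determinant. *)
Lemma Cs_invmx k m n (U : set 'rV[R]_m) (M : 'rV[R]_m -> 'M[R]_n) i j : open U ->
  (forall x, U x -> M x \in unitmx) ->
  (forall i j, Cs k U (fun x => M x i j)) -> Cs k U (fun x => invmx (M x) i j).
Proof.
move=> oU Hu H.
apply: (@Cs_eq _ _ k U (fun x => (\det (M x))^-1 * cofactor (M x) j i) _ oU).
  by move=> x Ux; rewrite /invmx Hu // !mxE.
apply: CsM => //.
  apply: Cs_inv => //; last exact: Cs_det.
  by move=> x /Hu; rewrite unitmxE unitfE.
apply: CsM => //; first exact: Cs_cst.
apply: Cs_det => // a b; apply: (Cs_eq oU) (H (lift j a) (lift i b)) => x _.
by rewrite !mxE.
Qed.

Lemma derive_segment m (f : 'rV[R]_m -> R) (x d : 'rV[R]_m) (t : R) :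
  differentiable f (x + t *: d) ->
  is_derive t 1 (fun s : R => f (x + s *: d)) ('D_d f (x + t *: d)).
Proof.
move=> df.
have da : is_diff t (fun s : R => x + s *: d) (fun s => s *: d).
  have := @is_diffD _ _ _ (cst x) (fun s : R => s *: d) _ _ t (is_diff_cst _ _) (is_diff_scalel _ _).
  by move=> H; apply: is_diff_eq; apply/funext => s /=; rewrite add0r.
have dc : differentiable (f \o (fun s : R => x + s *: d)) t.
  by apply: differentiable_comp; [exact: ex_diff|exact: df].
apply: DeriveDef; first exact: diff_derivable.
rewrite deriveE // diff_comp; [|exact: ex_diff|exact: df].
by rewrite /= diff_val scale1r deriveE.
Qed.

(** The mean value theorem along the segment, which stays in the ball by convexity. The norm is the
    maximum norm, so the sum of the absolute partial derivatives bounds the derivative. *)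
Lemma lipschitz_of_partials m (f : 'rV[R]_m -> R) (x0 : 'rV[R]_m) (r c : R) :
  (forall x, ball x0 r x -> differentiable f x) ->
  (forall x, ball x0 r x -> \sum_j `|'D_(delta_mx 0 j) f x| <= c) ->
  forall x y, ball x0 r x -> ball x0 r y -> `|f y - f x| <= c * `|y - x|.
Proof.
move=> df Hc x y Bx By.
have Bt (t : R) : t \in `[0, 1] -> ball x0 r (x + t *: (y - x)).
  rewrite in_itv /= => /andP[t0 t1].
  move: Bx By; rewrite -!ball_normE /ball_ /= => Bx By.
  have -> : x0 - (x + t *: (y - x)) = (1 - t) *: (x0 - x) + t *: (x0 - y).
    by apply/matrixP => i j; rewrite !mxE; ring.
  rewrite (le_lt_trans (ler_normD _ _)) // !normrZ (ger0_norm t0).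
  rewrite ger0_norm ?subr_ge0 //.
  have M : Num.max `|x0 - x| `|x0 - y| < r by rewrite gt_max Bx By.
  apply: le_lt_trans M; set M := Num.max _ _.
  have a1 : `|x0 - x| <= M by rewrite le_max lexx.
  have a2 : `|x0 - y| <= M by rewrite le_max lexx orbT.
  have t1' : 0 <= 1 - t by rewrite subr_ge0.
  have := ler_wpM2l t1' a1; have := ler_wpM2l t0 a2; lra.
have D (t : R) : t \in `[0, 1] -> is_derive t 1 (fun s : R => f (x + s *: (y - x)))
    ('D_(y - x) f (x + t *: (y - x))).
  by move=> tI; apply: derive_segment; apply/df/Bt.
pose p (s : R) : R := f (x + s *: (y - x)).
pose dp (t : R) : R := 'D_(y - x) f (x + t *: (y - x)).
have Doo (t : R) : t \in `]0, 1[ -> is_derive t 1 p (dp t).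
  by move=> tI; apply: D; apply: subset_itv_oo_cc.
have pc : {within `[0, 1], continuous p}.
  apply: derivable_within_continuous => t tI.
  by have ? := D t tI; apply: ex_derive.
have [t tI] := MVT (@ltr01 R) Doo pc; rewrite /p /dp.
rewrite scale1r scale0r addr0 [x + _]addrC subrK subr0 mulr1 => ->.
have BX := Bt t (subset_itv_oo_cc tI).
rewrite derive_delta; last exact: df.
rewrite (le_trans (ler_norm_sum _ _ _)) //.
rewrite (le_trans _ (ler_wpM2r (normr_ge0 _) (Hc _ BX))) // mulr_suml ler_sum // => j _.
by rewrite normrM mulrC ler_wpM2l ?coord_le_norm.
Qed.

End Vector.

(** * The inverse function theorem *)

(* banach_fixed_point needs this join of structures, which the library does not declare. *)
HB.instance Definition _ (R : realType) m n := Complete.on 'M[R]_(m, n).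

Section InverseFunction.
Variables (R : realType) (n : nat).
Implicit Types (x y v : 'rV[R]_n) (f : 'rV[R]_n -> 'rV[R]_n) (W : set 'rV[R]_n).

Lemma rowB_coord (u v : 'rV[R]_n) i : (u - v) 0 i = u 0 i - v 0 i.
Proof. by rewrite !mxE. Qed.

Lemma sub_mulmx_inv (a b : 'rV[R]_n) (J : 'M[R]_n) : J \in unitmx ->
  a - b *m invmx J = - ((b - a *m J) *m invmx J).
Proof. by move=> uJ; rewrite mulmxBl mulmxK // opprB. Qed.

Lemma unitmx_of_inj (J : 'M[R]_n) : (forall v, v *m J = 0 -> v = 0) -> J \in unitmx.
Proof.
move=> H; rewrite -row_free_unit -kermx_eq0; apply/rowV0P => v /sub_kermxP.
exact: H.
Qed.

(** The solution is the fixed point of x |-> z - e x, which contracts the closed ball by 1/2. Its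
    distance to the centre is less than rho / 2 + rho / 2, whence the strict bound. *)
Lemma contraction_solve (e : 'rV[R]_n -> 'rV[R]_n) x0 z (rho : R) : 0 < rho ->
  (forall x y, `|x - x0| <= rho -> `|y - x0| <= rho ->
    `|e y - e x| <= 2^-1 * `|y - x|) ->
  `|z - x0 - e x0| < rho / 2 ->
  exists2 x, `|x - x0| < rho & x + e x = z.
Proof.
move=> rho0 elip zs.
pose B := [set x : 'rV[R]_n | `|x - x0| <= rho].
pose T x := z - e x.
have TB x : B x -> `|T x - x0| <= `|z - x0 - e x0| + 2^-1 * `|x - x0|.
  move=> Bx; have -> : T x - x0 = (z - x0 - e x0) - (e x - e x0).
    by rewrite /T; apply/rowP => i; rewrite !mxE; ring.
  rewrite (le_trans (ler_normB _ _)) // lerD2l elip //.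
  by rewrite subrr normr0 ltW.
have fT : set_fun B B T.
  by move=> x Bx; have := TB x Bx; move: Bx; rewrite /B /=; lra.
pose Tf : {fun B >-> B} := HB.pack T (isFun.Build _ _ B B T fT).
have cT : is_contraction Tf.
  exists (2^-1)%:nng; split => /=; first by rewrite invf_lt1 // ltr1n.
  move=> [x y] [/= Bx By]; rewrite /T.
  have -> : z - e x - (z - e y) = e y - e x.
    by apply/rowP => i; rewrite !mxE; ring.
  by rewrite (distrC x) elip.
have clB : closed B.
  have -> : B = closed_ball_ Num.Def.normr x0 rho.
    by apply/seteqP; split => x; rewrite /B /closed_ball_ /= distrC.
  exact: closed_closed_ball_.
have [|x Bx xT] := banach_fixed_point cT clB.
  by exists x0; rewrite /B /= subrr normr0 ltW.
have {}xT : T x = x by rewrite [RHS]xT.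
exists x; last by rewrite -{1}xT /T subrK.
by have := TB x Bx; rewrite xT; move: zs; lra.
Qed.

Theorem inverse_function f W x0 : open W -> W x0 ->
  (forall k i, Cs k W (fun x => f x 0 i)) ->
  (forall v, 'D_v f x0 = 0 -> v = 0) ->
  exists (U V : set 'rV[R]_n) (g : 'rV[R]_n -> 'rV[R]_n),
    [/\ open U, U x0, U `<=` W, open V & diffeomorphism U V f g].
Proof.
move=> oW Wx0 sf inj0.
have df x : W x -> differentiable f x.
  by move=> Wx; apply: differentiable_rV => i; exact: (sf 1%N i).1.
pose J x := jacobian f x.
have DJ x v : W x -> 'D_v f x = v *m J x by move=> Wx; rewrite deriveEjacobian //; exact: df.
have uJ0 : J x0 \in unitmx.
  by apply: unitmx_of_inj => v; rewrite -DJ //; exact: inj0.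
pose B := invmx (J x0).
(* After multiplication by the inverse Jacobian at [x0], f becomes the identity plus [e]. The
   derivative of [e] vanishes at [x0], so [e] is 1/2-Lipschitz near it. *)
pose e x := f x *m B - x.
have se k i : Cs k W (fun x => e x 0 i).
  apply: (@Cs_eq _ _ k W (fun x => \sum_j f x 0 j * B j i - x 0 i) _ oW).
    by move=> x _; rewrite !mxE.
  apply: CsB => //; last exact: Cs_coord.
  apply: Cs_sum => // j _; apply: CsM => //; exact: Cs_cst.
have de x : W x -> differentiable e x.
  by move=> Wx; apply: differentiable_rV => i; exact: (se 1%N i).1.
have De x v : W x -> 'D_v e x = v *m J x *m B - v.
  move=> Wx; apply/rowP => i; rewrite -derive_coordf; last exact: de.
  have dfj j : differentiable (fun x => f x 0 j) x by exact: (sf 1%N j).1.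
  have -> : (fun y => e y 0 i) = (fun y => \sum_j f y 0 j * B j i - y 0 i).
    by apply/funext => y; rewrite !mxE.
  have dsum : is_derive x v (\sum_j (fun y : 'rV[R]_n => f y 0 j * B j i))
      (\sum_j 'D_v (fun x => f x 0 j) x * B j i).
    apply: is_derive_sum => j.
    have H : is_derive x v (fun x => f x 0 j) ('D_v (fun x => f x 0 j) x).
      by apply/derivableP/diff_derivable.
    have := @is_deriveM _ _ (fun x => f x 0 j) (cst (B j i)) x v _ _ H _.
    move=> H2; apply: is_derive_eq.
    by rewrite scaler0 add0r /= mulrC.
  have dx : is_derive x v (fun y : 'rV[R]_n => y 0 i) (v 0 i).
    apply: DeriveDef; last exact: derive_coord.
    exact/diff_derivable/differentiable_coord.
  have -> : (fun y => \sum_j f y 0 j * B j i - y 0 i) =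
     (\sum_j (fun y : 'rV[R]_n => f y 0 j * B j i)) - (fun y : 'rV[R]_n => y 0 i).
    by apply/funext => y; rewrite /= [RHS]/(_ - _) /= fct_sumE.
  rewrite derive_val !mxE; congr (_ - _); apply: eq_bigr => j _.
  by rewrite derive_coordf ?DJ //; exact: df.
(* A bound for each partial derivative such that n of them add up to at most 1/2; n + 1 keeps the
   denominator nonzero when n = 0. *)
pose dl : R := (2 * n.+1%:R)^-1.
have dl0 : 0 < dl by rewrite invr_gt0 mulr_gt0.
have dls : \sum_(j < n) dl <= 2^-1.
  rewrite sumr_const card_ord -[dl *+ n]mulr_natr /dl invfM -mulrA ler_piMr ?invr_ge0 //.
  by rewrite ler_pdivrMl // mulr1 ler_nat.
have [r r0 [rW rd]] : exists2 r : R, 0 < r & ball x0 r `<=` W /\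
   forall x, ball x0 r x -> forall i j, `|'D_(delta_mx 0 j) (fun y => e y 0 i) x| <= dl.
  have H : \forall x \near x0, W x /\ forall ij : 'I_n * 'I_n,
     `|'D_(delta_mx 0 ij.2) (fun y => e y 0 ij.1) x| <= dl.
    have HW : \forall x \near x0, W x by apply: open_nbhs_nbhs.
    suff H : \forall x \near x0, forall ij : 'I_n * 'I_n,
      `|'D_(delta_mx 0 ij.2) (fun y => e y 0 ij.1) x| <= dl by apply: (nearS2 HW H).
    apply: near_forall => -[i j] /=.
    have C := (se 1%N i).2 (delta_mx 0 j) x0 Wx0.
    have := continuous_near C dl0; apply: filterS => x; rewrite [X in `|X - _|](_ : _ = 0).
      by rewrite sub0r normrN.
    rewrite derive_coordf ?De //; last exact: de.
    by rewrite mulmxK // subrr mxE.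
  have /nbhs_ballP[r r0 Hr] := H; exists r => //; split=> [x /Hr[]//|x /Hr[_ Hx] i j].
  exact: (Hx (i, j)).
have elip x y : ball x0 r x -> ball x0 r y -> `|e y - e x| <= 2^-1 * `|y - x|.
  move=> Bx By; apply: norm_le_coord => [|i]; first by rewrite mulr_ge0 ?invr_ge0.
  rewrite rowB_coord.
  apply: (@lipschitz_of_partials _ _ (fun y => e y 0 i) x0 r 2^-1) => // z Bz.
    exact: (se 1%N i).1 z (rW _ Bz).
  by rewrite (le_trans _ dls) // ler_sum // => j _; exact: rd.
(* A vector v killed by the Jacobian at x has derivative - v under [e], so its norm is at most half
   of itself. *)
have uJ x : ball x0 r x -> J x \in unitmx.
  move=> Bx; apply: unitmx_of_inj => v vJ.
  have Wx := rW _ Bx.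
  have ev : 'D_v e x = - v by rewrite De // vJ mul0mx sub0r.
  have : `|v| <= 2^-1 * `|v|.
    rewrite -[leLHS]normrN -ev; apply: norm_le_coord => [|i]; first by rewrite mulr_ge0 ?invr_ge0.
    rewrite -derive_coordf; last exact: de.
    rewrite derive_delta; last exact: (se 1%N i).1.
    rewrite (le_trans (ler_norm_sum _ _ _)) //.
    apply: (@le_trans _ _ (\sum_(j < n) `|v| * dl)).
      by apply: ler_sum => j _; rewrite normrM ler_pM ?coord_le_norm ?rd.
    by rewrite -mulr_sumr mulrC ler_wpM2r.
  have := normr_ge0 v => v0 vv; apply/eqP; rewrite -normr_eq0; apply/eqP; lra.
pose rho := r / 2.
have rho0 : 0 < rho by rewrite divr_gt0.
have Bb x : `|x - x0| <= rho -> ball x0 r x.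
  by rewrite -ball_normE /ball_ /= distrC /rho => H; rewrite (le_lt_trans H) // ltr_pdivrMr // ltr_pMr // ltr1n.
have fE x : f x *m B = x + e x by rewrite /e addrC subrK.
have lowlip x y : `|x - x0| <= rho -> `|y - x0| <= rho ->
    `|y - x| <= 2 * `|f y *m B - f x *m B|.
  move=> /Bb Bx /Bb By; have := elip x y Bx By.
  have -> : f y *m B - f x *m B = (y - x) + (e y - e x).
    by rewrite !fE; apply/rowP => i; rewrite !mxE; ring.
  have := lerB_normD (y - x) (e y - e x); lra.
have uB : B \in unitmx by rewrite unitmx_inv.
(* The bound rho / 2 is the hypothesis of [contraction_solve], since [f x0 *m B] is x0 + e x0. *)
pose V := [set y : 'rV[R]_n | `|y *m B - f x0 *m B| < rho / 2].
pose U := [set x : 'rV[R]_n | `|x - x0| < rho /\ V (f x)].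
have oball (c : R) (x1 : 'rV[R]_n) : open [set x : 'rV[R]_n | `|x - x1| < c].
  have [c0|c0] := ltP 0 c.
    have -> : [set x : 'rV[R]_n | `|x - x1| < c] = ball x1 c.
      by apply/seteqP; split => x; rewrite -ball_normE /ball_ /= distrC.
    exact: ball_open.
  rewrite (_ : mkset _ = set0); first exact: open0.
  by apply/seteqP; split => // x /=; rewrite ltNge (le_trans c0).
have oV : open V.
  have -> : V = (fun y => y *m B) @^-1` [set z | `|z - f x0 *m B| < rho / 2] by [].
  by apply: open_comp => // y _; exact: mulmxr_continuous.
have UW : U `<=` W by move=> x [/ltW/Bb/rW].
have oU : open U.
  rewrite openE => x [xr Vfx]; apply: filterI.
    exact: open_nbhs_nbhs (conj (oball rho x0) xr).
  have Wx : W x by apply/rW/Bb/ltW.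
  exact: (differentiable_continuous (df x Wx)) (open_nbhs_nbhs (conj oV Vfx)).
have Ux0 : U x0 by split; rewrite /V /= subrr normr0 ?divr_gt0.
have surj y : V y -> exists x, U x /\ f x = y.
  move=> Vy; have zs : `|y *m B - x0 - e x0| < rho / 2 by move: Vy; rewrite /V /= fE opprD addrA.
  have lip a b : `|a - x0| <= rho -> `|b - x0| <= rho -> `|e b - e a| <= 2^-1 * `|b - a|.
    by move=> /Bb Ba /Bb Bb'; exact: elip.
  have [x xr xe] := contraction_solve rho0 lip zs.
  have fxy : f x = y by rewrite -[f x](mulmxK uB) fE xe mulmxK.
  by exists x; rewrite /U /= fxy.
have [g gP] : exists g : 'rV[R]_n -> 'rV[R]_n, forall y, V y -> U (g y) /\ f (g y) = y.
  exists (fun y => xget x0 [set x | U x /\ f x = y]) => y /surj[x Hx].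
  exact: (@xgetPex _ x0 [set x | U x /\ f x = y] (ex_intro _ x Hx)).
have Ub x : U x -> `|x - x0| <= rho by case=> /ltW.
have gf x : U x -> g (f x) = x.
  move=> Ux; have [Ug fg] := gP (f x) Ux.2.
  have := lowlip x (g (f x)) (Ub _ Ux) (Ub _ Ug).
  by rewrite fg subrr normr0 mulr0 normr_le0 subr_eq0 => /eqP.
have [K K0 HK] := mulmx_norm_bound B.
have glip y y' : V y -> V y' -> `|g y' - g y| <= 2 * K * `|y' - y|.
  move=> Vy Vy'; have [U1 f1] := gP y Vy; have [U2 f2] := gP y' Vy'.
  have := lowlip _ _ (Ub _ U1) (Ub _ U2); rewrite f1 f2 => /le_trans; apply.
  by rewrite -mulmxBl -mulrA ler_wpM2l // HK.
have gc y : V y -> {for y, continuous g}.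
  move=> Vy; apply: continuous_eps => eps eps0.
  have nV : \forall z \near y, V z by exact: open_nbhs_nbhs.
  have K2 : 0 < 2 * K by rewrite mulr_gt0.
  apply: (nearS2 nV (near_dist_le y (divr_gt0 eps0 K2))) => z Vz.
  by rewrite ler_pdivlMr // mulrC; apply: le_trans; rewrite glip.
have dg y : V y -> differentiable g y /\ 'd g y = mulmxr (invmx (J (g y))) :> ('rV[R]_n -> 'rV[R]_n).
  move=> Vy; have [Ug fg] := gP y Vy.
  apply: diff_epsP => [|eps eps0]; first exact: mulmxr_continuous.
  have [K' K'0 HK'] := mulmx_norm_bound (invmx (J (g y))).
  pose e' := eps / (K' * (2 * K)).
  have e'0 : 0 < e' by rewrite divr_gt0 ?mulr_gt0.
  have dfg := diff_eps (df _ (UW _ Ug)) e'0.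
  have nV : \forall z \near y, V z by exact: open_nbhs_nbhs.
  have H := gc y Vy _ dfg.
  apply: (nearS2 nV H) => z Vz /=.
  have [Uz fz] := gP z Vz; rewrite fg fz => Hz.
  rewrite (sub_mulmx_inv _ _ (uJ _ (Bb _ (Ub _ Ug)))).
  rewrite normrN (le_trans (HK' _)) //.
  have -> : (g z - g y) *m J (g y) = 'd f (g y) (g z - g y).
    by rewrite -DJ ?deriveE //; [exact/df/UW|exact: UW].
  rewrite -ler_pdivlMl // (le_trans Hz) //.
  rewrite (le_trans (ler_wpM2l (ltW e'0) (glip _ _ Vy Vz))) // /e'.
  rewrite le_eqVlt; apply/orP; left; apply/eqP; field.
  by rewrite !gt_eqF.
(* Bootstrap: the derivative of [g] is the inverse Jacobian of f composed with [g], so it is C^k as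
   soon as [g] is. *)
have sg k i : Cs k V (fun y => g y 0 i).
  elim: k i => [|k IH] i.
    move=> y Vy; apply: (@continuous_comp _ _ _ g (fun v : 'rV[R]_n => v 0 i)); first exact: gc.
    exact: coord_continuous.
  split=> [y Vy|v]; first by apply: differentiable_coordf; exact: (dg y Vy).1.
  apply: (@Cs_eq _ _ k V (fun y => \sum_j v 0 j * invmx (J (g y)) j i) _ oV).
    move=> y Vy; have [d1 d2] := dg y Vy.
    by rewrite derive_coordf // deriveE // d2 /= mxE.
  apply: Cs_sum => // j _; apply: CsM => //; first exact: Cs_cst.
  apply: (@Cs_invmx R k n n V (J \o g) j i oV).
    by move=> y Vy; have [Ug _] := gP y Vy; exact: uJ (Bb _ (Ub _ Ug)).
  move=> a b.
  apply: (@Cs_eq R n k V (fun y => 'D_(delta_mx 0 a) (fun x => f x 0 b) (g y)) _ oV).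
    move=> y Vy; have [Ug _] := gP y Vy; have Wg := UW _ Ug.
    rewrite (derive_coordf _ _ (df _ Wg)).
    by rewrite (DJ _ _ Wg) -rowE mxE.
  apply: (@Cs_comp R k n n V W ('D_(delta_mx 0 a) (fun x => f x 0 b)) g oV _ IH).
    by move=> y /gP[/UW].
  exact: (sf k.+1 b).2.
exists U, V, g; split => //; split.
- by move=> k; apply: Ck_rV => // i; apply: Cs_sub UW _.
- by move=> k; apply: Ck_rV.
- by move=> x Ux; split; [case: Ux|exact: gf].
- exact: gP.
Qed.

End InverseFunction.

(** * The angle integral *)

Section AngleIntegral.
Variable R : realType.
Implicit Types (a b c d x lam : R) (f P : R -> R).

Lemma within_of_for f a b : (forall x, a <= x <= b -> {for x, continuous f}) ->
  {within `[a, b], continuous f}.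
Proof.
move=> H; apply: continuous_in_subspaceT => x.
by rewrite inE /= in_itv /=; exact: H.
Qed.

Lemma continuous_of_is_derive f x df : is_derive x 1 f df -> {for x, continuous f}.
Proof.
by move=> H; apply: differentiable_continuous; apply/derivable1_diffP; apply: ex_derive.
Qed.

(** The primitive is given on an open interval around [a, b], so the one-sided limits at the ends
    reduce to continuity. *)
Lemma Rintegral_primitive f P c d a b :
  (forall x, c < x < d -> is_derive x 1 P (f x)) ->
  (forall x, c < x < d -> {for x, continuous f}) -> c < a -> b < d -> a < b ->
  \int[@lebesgue_measure R]_(t in `[a, b]) f t = P b - P a.
Proof.
move=> dP cf ca bd ab.
have sub x : a <= x <= b -> c < x < d by move=> /andP[]; lra.
have H : (\int[@lebesgue_measure R]_(x in `[a, b]) (f x)%:E = (P b)%:E - (P a)%:E)%E.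
  apply: continuous_FTC2 => //.
  - by apply: within_of_for => x /sub; exact: cf.
  - have cP x : a <= x <= b -> {for x, continuous P}.
      by move=> /sub /dP; exact: continuous_of_is_derive.
    split.
    + move=> x; rewrite in_itv /= => /andP[ax xb].
      by have H := dP x (sub x _); apply: ex_derive; apply: H; rewrite !ltW.
    + by apply: cvg_at_right_filter; apply: cP; rewrite lexx ltW.
    + by apply: cvg_at_left_filter; apply: cP; rewrite lexx ltW.
  - move=> x; rewrite in_itv /= => /andP[ax xb].
    have := dP x (sub x _); rewrite !ltW // => /(_ isT) [_ <-].
    by rewrite derive1E.
by rewrite /Rintegral H.
Qed.

Lemma oriented_integralE f P c d a b :
  (forall x, c < x < d -> is_derive x 1 P (f x)) ->
  (forall x, c < x < d -> {for x, continuous f}) -> c < a < d -> c < b < d ->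
  oriented_integral a b f = P b - P a.
Proof.
move=> dP cf /andP[ca ad] /andP[cb bd]; rewrite /oriented_integral.
have [ab|ba|->] := ltgtP a b.
- rewrite (Rintegral_primitive dP cf ca bd ab) [X in _ - X](_ : _ = 0) ?subr0 //.
  by rewrite set_itv_ge ?Rintegral_set0 // bnd_simp -ltNge.
- rewrite (Rintegral_primitive dP cf cb ad ba) [X in X - _](_ : _ = 0) ?sub0r ?opprB //.
  by rewrite set_itv_ge ?Rintegral_set0 // bnd_simp -ltNge.
- by rewrite !subrr.
Qed.

Lemma pi_half : (pi : R) / 2 < pi /\ 0 < (pi : R) / 2.
Proof. by have := @pi_gt0 R; lra. Qed.

Lemma continuous_sin_powR lam x : 0 < x < pi -> {for x, continuous (fun t : R => sin t `^ lam)}.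
Proof.
move=> x0; have s0 := sin_gt0_pi x0.
apply: (@continuous_comp _ _ _ sin (fun t => t `^ lam)); first exact: continuous_sin.
by have H := is_derive1_powR lam s0; apply: continuous_of_is_derive H.
Qed.

(** The contribution of one corner to [Phi]; [cos_integralE] expresses the contributions to [Psi] by
    it as well. *)
Definition angle_integral lam a : R :=
  oriented_integral (pi / 2) a (fun t => sin t `^ lam).

Lemma is_derive_angle_integral lam a : 0 < a < pi ->
  is_derive a 1 (angle_integral lam) (sin a `^ lam).
Proof.
move=> /andP[a0 api]; have [p1 p2] := pi_half.
pose f t : R := sin t `^ lam.
(* The point [a] may lie on either side of pi / 2. Both are to the right of the base point e2 = e /
   2, from which an ordinary integral [F] is taken; the oriented integral is a difference of two
   values of [F]. *)
pose e : R := Num.min a (pi / 2) / 2.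
have e0 : 0 < e by rewrite divr_gt0 // lt_min a0.
have ea : e < a by rewrite /e ltr_pdivrMr // gt_min ltr_pMr // ltr1n.
have ep : e < pi / 2.
  by rewrite /e ltr_pdivrMr // gt_min orbC ltr_pMr // ltr1n.
pose e2 : R := e / 2.
have [e20 e2e] : 0 < e2 /\ e2 < e by rewrite /e2; split; lra.
pose F x := \int[@lebesgue_measure R]_(t in `[e2, x]) f t.
have dF x : e2 < x < pi -> is_derive x 1 F (f x).
  move=> /andP[x1 x2].
  have cf y : e2 <= y <= (x + pi) / 2 -> {for y, continuous f}.
    by move=> H; apply: continuous_sin_powR; lra.
  have xm : x < (x + pi) / 2 by lra.
  have [||d1 d2] := @continuous_FTC1_closed R f e2 x _ xm _ x1.
  - apply: continuous_compact_integrable; first exact: segment_compact.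
    exact: within_of_for.
  - by apply: cf; lra.
  by apply: DeriveDef; [exact: d1|rewrite -derive1E; exact: d2].
have cf x : e2 < x < pi -> {for x, continuous f}.
  by move=> H; apply: continuous_sin_powR; lra.
apply: (@near_eq_is_derive _ _ _ (fun x => F x - F (pi / 2))); last first.
  have H : is_derive a 1 F (f a) by apply: dF; lra.
  have := @is_deriveB _ _ _ F (cst (F (pi / 2))) a 1 _ _ H (is_derive_cst _ _ _).
  by rewrite subr0.
have : \forall x \near a, e2 < x < pi.
  have : a \in `]e2, pi[ by rewrite in_itv /=; lra.
  by move=> /near_in_itvoo; apply: filterS => x; rewrite in_itv.
apply: filterS => x Hx; apply/esym; apply: (oriented_integralE dF cf) => //.
by lra.
Qed.

Lemma angle_integral_pihalf lam : angle_integral lam (pi / 2) = 0.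
Proof. by rewrite /angle_integral /oriented_integral subrr. Qed.

Lemma angle_integral_mvt lam a b : 0 < a -> a < b -> b < pi ->
  exists2 c, a < c < b & angle_integral lam b - angle_integral lam a = sin c `^ lam * (b - a).
Proof.
move=> a0 ab bp.
have D x : 0 < x < pi -> is_derive x 1 (angle_integral lam) (sin x `^ lam).
  exact: is_derive_angle_integral.
have Doo x : x \in `]a, b[ -> is_derive x 1 (angle_integral lam) (sin x `^ lam).
  by rewrite in_itv /= => H; apply: D; lra.
have cc : {within `[a, b], continuous (angle_integral lam)}.
  by apply: within_of_for => x H; apply: continuous_of_is_derive (D x _); lra.
have [c cI E] := MVT ab Doo cc.
by exists c => //; move: cI; rewrite in_itv.
Qed.

Lemma angle_integral_lt lam a b : 0 < a -> a < b -> b < pi ->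
  angle_integral lam a < angle_integral lam b.
Proof.
move=> a0 ab bp; have [c cab] := angle_integral_mvt lam a0 ab bp.
rewrite -subr_gt0 => ->; rewrite mulr_gt0 ?subr_gt0 // powR_gt0 // sin_gt0_pi //.
by lra.
Qed.

Lemma is_derive_shiftl P c x dP : is_derive (x + c) 1 P dP ->
  is_derive x 1 (fun t => P (t + c)) dP.
Proof.
move=> H.
have H2 : is_derive x 1 (fun t : R => t + c) (1 : R).
  have := @is_deriveD _ _ _ (fun t : R => t) (cst c) x 1 _ _ (is_derive_id _ _) (is_derive_cst _ _ _).
  by rewrite addr0.
have := @is_derive1_comp _ P (fun t : R => t + c) x _ _ H H2.
by rewrite mulr1.
Qed.

(** By the symmetry of the sine about pi / 2, the opposite of the reflected integral is another
    primitive of the same integrand, also zero at pi / 2. *)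
Lemma angle_integralN lam a : 0 < a < pi ->
  angle_integral lam (pi - a) = - angle_integral lam a.
Proof.
move=> a0; have p0 := @pi_gt0 R.
have dP x : 0 < x < pi ->
    is_derive x 1 (fun t => - angle_integral lam (pi - t)) (sin x `^ lam).
  move=> x0.
  have x1 : 0 < pi - x < pi by lra.
  have H := is_derive_angle_integral lam x1.
  have H2 : is_derive x 1 (fun t : R => pi - t) (-1 : R).
    have := @is_deriveB _ _ _ (cst pi) (fun t : R => t) x 1 _ _ (is_derive_cst _ _ _) (is_derive_id _ _).
    by rewrite sub0r.
  have := @is_derive1_comp _ (angle_integral lam) (fun t : R => pi - t) x _ _ H H2.
  move=> /is_deriveN; rewrite mulrN1 opprK sinB sinpi cospi mul0r sub0r mulN1r opprK.
  exact.
have ph : 0 < (pi : R) / 2 < pi by lra.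
have := oriented_integralE dP (fun x H => continuous_sin_powR H) ph a0; rewrite -/(angle_integral lam a) => ->.
have -> : pi - pi / 2 = pi / 2 :> R by lra.
by rewrite angle_integral_pihalf oppr0 subr0 opprK.
Qed.

(** The shift cos t = sin (t + pi / 2) reduces the integrals of [Psi] to those of [Phi]. *)
Lemma cos_integralE lam x : - (pi / 2) < x < pi / 2 ->
  oriented_integral 0 x (fun t => cos t `^ lam) = angle_integral lam (x + pi / 2).
Proof.
move=> x0; have p0 := @pi_gt0 R.
have dP t : - (pi / 2) < t < pi / 2 ->
    is_derive t 1 (fun s => angle_integral lam (s + pi / 2)) (cos t `^ lam).
  move=> t0; apply: is_derive_shiftl; rewrite -sinDpihalf.
  by apply: is_derive_angle_integral; lra.
rewrite (oriented_integralE dP) //; last by lra.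
  by rewrite add0r angle_integral_pihalf subr0.
move=> t t0; have c0 := cos_gt0_pihalf t0.
apply: (@continuous_comp _ _ _ cos (fun t => t `^ lam)); first exact: continuous_cos.
by have H := is_derive1_powR lam c0; apply: continuous_of_is_derive H.
Qed.

Lemma angle_integral_odd lam x : - (pi / 2) < x < pi / 2 ->
  angle_integral lam (- x + pi / 2) = - angle_integral lam (x + pi / 2).
Proof.
move=> x0; rewrite -angle_integralN; last by lra.
by congr angle_integral; lra.
Qed.

(* Since [sin ^ lam >= cos / sin] for [lam <= -1], the integral is at most the logarithm
   of the sine, hence diverges at 0. *)
Lemma angle_integral_le_ln lam a : lam <= -1 -> 0 < a -> a < pi / 2 ->
  angle_integral lam a <= ln (sin a).
Proof.
move=> lam1 a0 ap; have [p1 p2] := pi_half.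
have D x : 0 < x < pi -> is_derive x 1 (fun t => ln (sin t) - angle_integral lam t)
    ((sin x)^-1 * cos x - sin x `^ lam).
  move=> x0; have s0 := sin_gt0_pi x0.
  apply: is_deriveB; last exact: is_derive_angle_integral.
  exact: (@is_derive1_comp _ (@ln R) sin x _ _ (is_derive1_ln s0) (is_derive_sin x)).
have Doo x : x \in `]a, pi / 2[ -> is_derive x 1 (fun t => ln (sin t) - angle_integral lam t)
    ((sin x)^-1 * cos x - sin x `^ lam).
  by rewrite in_itv /= => H; apply: D; lra.
have cc : {within `[a, pi / 2], continuous (fun t => ln (sin t) - angle_integral lam t)}.
  by apply: within_of_for => x H; apply: continuous_of_is_derive (D x _); lra.
have [c] := MVT ap Doo cc; rewrite in_itv /= => cI.
rewrite angle_integral_pihalf sin_pihalf ln1 subrr sub0r => E.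
have c0 : 0 < c < pi by lra.
have s0 := sin_gt0_pi c0; have s1 := sin_le1 c.
have : (sin c)^-1 * cos c <= sin c `^ lam.
  apply: (@le_trans _ _ (sin c)^-1).
    by rewrite ler_piMr ?invr_ge0 ?cos_le1 // ltW.
  by rewrite -powR_inv1 ?(ltW s0) // ger_powR // s0.
move: E; set X := _ - _ `^ _ => E H.
have : X * (pi / 2 - a) <= 0 by rewrite mulr_le0_ge0 // ?subr_le0 // subr_ge0 ltW.
by rewrite -E; lra.
Qed.

Lemma angle_integral_cvg0 lam M : lam <= -1 ->
  exists2 d, 0 < d & forall a, 0 < a -> a < d -> angle_integral lam a < M.
Proof.
move=> lam1; have [p1 p2] := pi_half.
have : \forall x \near (0 : R), `|sin 0 - sin x| <= expR M / 2.
  by apply: continuous_near; [exact: continuous_sin|rewrite divr_gt0 ?expR_gt0].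
move=> /nbhs_ballP[d d0 Hd]; exists (Num.min d (pi / 2)); first by rewrite lt_min d0.
move=> a a0; rewrite lt_min => /andP[ad ap].
rewrite (le_lt_trans (angle_integral_le_ln lam1 a0 ap)) //.
have s0 : 0 < sin a by apply: sin_gt0_pi; lra.
rewrite -ltr_expR lnK ?posrE //.
have := Hd a; rewrite /ball /= sub0r normrN gtr0_norm // => /(_ ad).
rewrite sin0 sub0r normrN gtr0_norm //; have := expR_gt0 M; lra.
Qed.

Lemma Cs_angle_integral n k lam (U : set 'rV[R]_n) (f : 'rV[R]_n -> R) : open U ->
  (forall x : 'rV[R]_n, U x -> 0 < f x < pi) -> Cs k U f ->
  Cs k U (fun x : 'rV[R]_n => angle_integral lam (f x)).
Proof.
move=> oU f0 Hf.
have D (x : 'rV[R]_n) : U x -> is_derive (f x) 1 (angle_integral lam) (sin (f x) `^ lam).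
  by move=> /f0; exact: is_derive_angle_integral.
case: k Hf => [|k] Hf.
  exact: (@Cs_comp0 _ n U (angle_integral lam) (fun t => sin t `^ lam)).
apply: (@Cs_comp1 _ n k U (angle_integral lam) (fun t => sin t `^ lam)) => //.
apply: Cs_powR => // [x /f0/sin_gt0_pi //|].
exact: (Cs_cos_sin oU (CsW Hf)).2.
Qed.

End AngleIntegral.

(** * Cosine laws *)

Section Triangles.
Variable R : realType.
Implicit Types (a b c : R) (x : 'I_3 -> R).

Lemma ordS_ordS (i : 'I_3) : ordS (ordS i) = ord_pred i.
Proof. by case: i => -[|[|[|]]] //= ?; apply: val_inj. Qed.
Lemma ord_pred_pred (i : 'I_3) : ord_pred (ord_pred i) = ordS i.
Proof. by case: i => -[|[|[|]]] //= ?; apply: val_inj. Qed.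
Definition ord3E := (ordS_ordS, ord_pred_pred, @ord_predK 3, @ordSK 3).

Lemma ord3_cases (i j : 'I_3) : [\/ j = i, j = ordS i | j = ord_pred i].
Proof.
by case: i => -[|[|[|]]] //= ?; case: j => -[|[|[|]]] //= ?;
  (by constructor 1; apply: val_inj) || (by constructor 2; apply: val_inj) || (by constructor 3; apply: val_inj).
Qed.

Lemma ord3_sum (V : nmodType) (F : 'I_3 -> V) i :
  \sum_j F j = F i + F (ordS i) + F (ord_pred i).
Proof.
have E (F' : 'I_3 -> V) : \sum_j F' j = F' 0 + F' 1 + F' 2%:R.
  rewrite !big_ord_recl big_ord0 addr0 addrA.
  by congr (_ + _ + _); congr F'; apply: val_inj.
have H0 (k : 'I_3) : k = 0 \/ k = 1 \/ k = 2%:R.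
  by case: k => -[|[|[|]]] //= ?; [left|right; left|right; right]; apply: val_inj.
have S0 : ordS (0 : 'I_3) = 1 by apply: val_inj.
have S1 : ordS (1 : 'I_3) = 2%:R by apply: val_inj.
have P0 : ord_pred (0 : 'I_3) = 2%:R by apply: val_inj.
have P1 : ord_pred (1 : 'I_3) = 0 by apply: val_inj.
have S2 : ordS (2%:R : 'I_3) = 0 by apply: val_inj.
have P2 : ord_pred (2%:R : 'I_3) = 1 by apply: val_inj.
rewrite E; case: (H0 i) => [|[]] ->; rewrite ?S0 ?S1 ?S2 ?P0 ?P1 ?P2 //.
- by rewrite -addrA addrC.
- by rewrite addrC addrA.
Qed.

Definition euclid_cos a b c := (b ^+ 2 + c ^+ 2 - a ^+ 2) / (2 * b * c).

Definition cosh a : R := (expR a + expR (- a)) / 2.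
Definition sinh a : R := (expR a - expR (- a)) / 2.

Definition hyp_cos a b c := (cosh b * cosh c - cosh a) / (sinh b * sinh c).

Lemma cosh2 a : cosh a ^+ 2 = 1 + sinh a ^+ 2.
Proof.
have := expRxMexpNx_1 a; rewrite /cosh /sinh; set u := expR a; set v := expR _.
by move=> uv; apply/eqP; rewrite -subr_eq0; apply/eqP; transitivity (u * v - 1); [field|rewrite uv subrr].
Qed.

Lemma coshDsinh a : cosh a + sinh a = expR a.
Proof. by rewrite /cosh /sinh; field. Qed.

Lemma sinh_gt0 a : 0 < a -> 0 < sinh a.
Proof.
move=> a0; have : expR (- a) < expR a by rewrite ltr_expR; lra.
by rewrite /sinh; lra.
Qed.

Lemma cosh_gt1 a : 0 < a -> 1 < cosh a.
Proof.
move=> /sinh_gt0 s0; have := cosh2 a; have : 0 < cosh a.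
  by rewrite /cosh divr_gt0 ?addr_gt0 ?expR_gt0.
by nra.
Qed.

Lemma arcosh_cosh a : 0 < a -> arcosh (cosh a) = a.
Proof.
move=> a0; rewrite /arcosh cosh2 [1 + _]addrC addrK sqrtr_sqr gtr0_norm ?sinh_gt0 //.
by rewrite coshDsinh expRK.
Qed.

(** Because of the default values of the square root and the logarithm, [arcosh] is defined
    everywhere; for u <= 1 its value is at most 0, so a positive value forces u > 1. *)
Lemma cosh_of_arcosh u a : 0 < a -> arcosh u = a -> u = cosh a.
Proof.
move=> a0; rewrite /arcosh => ua.
have u1 : 1 < u.
  rewrite ltNge; apply/negP => u1; move: a0; rewrite -ua ltNge => /negP; apply.
  apply: ln_le0; have [u2|u2] := leP (u ^+ 2 - 1) 0.
    by rewrite (ler0_sqrtr u2) addr0.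
  have : Num.sqrt (u ^+ 2 - 1) <= `|u|.
    by rewrite -sqrtr_sqr ler_sqrt ?sqr_ge0 //; lra.
  by case: (ler0P u); nra.
have u2 : 0 < u ^+ 2 - 1 by nra.
have := lnK (_ : u + Num.sqrt (u ^+ 2 - 1) \in Num.pos); rewrite ua => E.
have {}E : expR a = u + Num.sqrt (u ^+ 2 - 1).
  by apply: E; rewrite posrE ltr_wpDr ?sqrtr_ge0 //; lra.
have := sqr_sqrtr (ltW u2); set s := Num.sqrt _ in E * => s2.
have := expRxMexpNx_1 a; rewrite /cosh E => F.
have {}F : expR (- a) = u - s.
  have us : u + s != 0 by apply/eqP => us; move: F; rewrite us mul0r => /eqP; rewrite eq_sym oner_eq0.
  by apply: (mulfI us); rewrite F; nra.
by rewrite F; field.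
Qed.

Lemma is_derive_cosh a : is_derive a 1 cosh (sinh a).
Proof.
have H : is_derive a 1 (fun t => expR (- t)) (- expR (- a)).
  have := @is_derive1_comp _ (@expR R) (fun t : R => - t) a _ _ (is_derive_expR (- a)) (is_deriveNid a 1).
  by rewrite mulrN1.
have H3 := is_deriveD (is_derive_expR a) H.
have := @is_deriveM _ _ _ (cst (2^-1 : R)) a 1 _ _ H3 (is_derive_cst _ _ _).
by rewrite scaler0 add0r /= => E; apply: is_derive_eq; rewrite /sinh; rewrite -[LHS]/(_ * _) mulrC.
Qed.

Lemma is_derive_sinh a : is_derive a 1 sinh (cosh a).
Proof.
have H : is_derive a 1 (fun t => expR (- t)) (- expR (- a)).
  have := @is_derive1_comp _ (@expR R) (fun t : R => - t) a _ _ (is_derive_expR (- a)) (is_deriveNid a 1).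
  by rewrite mulrN1.
have H3 := is_deriveB (is_derive_expR a) H.
have := @is_deriveM _ _ _ (cst (2^-1 : R)) a 1 _ _ H3 (is_derive_cst _ _ _).
by rewrite scaler0 add0r /= opprK => E; apply: is_derive_eq; rewrite /cosh; rewrite -[LHS]/(_ * _) mulrC.
Qed.

Section Geometry.
Variables (K : geometry R) (kcos : R -> R -> R -> R).

(* kcos a b c is the cosine of the angle opposite to the side a; the triangles of K are
   exactly the triples of lengths for which it lies strictly between -1 and 1. *)
Definition cosine_law : Prop :=
  (forall (p : 'I_3 -> geo_point K) x, (forall i, 0 < x i) ->
     ~ geo_collinear (p 0) (p 1) (p 2%:R) ->
     (forall i, geo_dist (p (ordS i)) (p (ord_pred i)) = x i) ->
     forall i, -1 < kcos (x i) (x (ordS i)) (x (ord_pred i)) < 1 /\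
       geo_angle (p i) (p (ordS i)) (p (ord_pred i)) =
       acos (kcos (x i) (x (ordS i)) (x (ord_pred i)))) /\
  (forall x, (forall i, 0 < x i) ->
     (forall i, -1 < kcos (x i) (x (ordS i)) (x (ord_pred i)) < 1) ->
     exists p : 'I_3 -> geo_point K, ~ geo_collinear (p 0) (p 1) (p 2%:R) /\
       forall i, geo_dist (p (ordS i)) (p (ord_pred i)) = x i).

Hypothesis Kcos : cosine_law.
Variable S : triangulated_surface.
Implicit Types (l : 'rV[R]_(ts_nedge S)) (t : ts_tri S).

Definition corner_cos l (s : ts_tri S * 'I_3) :=
  kcos (l 0 (ts_edge s)) (l 0 (ts_edge (s.1, ordS s.2)))
    (l 0 (ts_edge (s.1, ord_pred s.2))).

Lemma polyhedral_metricP l : polyhedral_metric K S l <->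
  (forall e, 0 < l 0 e) /\ forall s, -1 < corner_cos l s < 1.
Proof.
split=> -[l0 H]; split=> //.
  move=> [t i]; have [p [p1 p2]] := H t.
  by have [] := Kcos.1 p (fun i => l 0 (ts_edge (t, i))) (fun=> l0 _) p1 p2 i.
move=> t; have [|p [p1 p2]] := Kcos.2 (fun i => l 0 (ts_edge (t, i))) (fun=> l0 _).
  by move=> i; exact: (H (t, i)).
by exists p.
Qed.

Lemma inner_angleE l s : polyhedral_metric K S l ->
  inner_angle K l s = acos (corner_cos l s).
Proof.
move=> [l0 H]; case: s => t i.
apply: xget_unique.
  have [p [p1 p2]] := H t; exists p => //=.
  by have [_ ->] := Kcos.1 p (fun i => l 0 (ts_edge (t, i))) (fun=> l0 _) p1 p2 i.
move=> y [p [p1 p2] ->] /=.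
by have [_ ->] := Kcos.1 p (fun i => l 0 (ts_edge (t, i))) (fun=> l0 _) p1 p2 i.
Qed.

End Geometry.
End Triangles.

Section CosineLaws.
Variable R : realType.
Implicit Types (a b c : R) (x : 'I_3 -> R).

Lemma euclid_dotE (u v : 'rV[R]_2) : euclid_dot u v = u 0 0 * v 0 0 + u 0 1 * v 0 1.
Proof.
rewrite /euclid_dot !big_ord_recl big_ord0 addr0.
by congr (_ * _ + _ * _); congr (_ _ _); apply: val_inj.
Qed.

Lemma det2E (M : 'M[R]_2) : \det M = M 0 0 * M 1 1 - M 0 1 * M 1 0.
Proof.
rewrite (expand_det_row _ 0) !big_ord_recl big_ord0 addr0 /cofactor !det_mx11 !mxE /=.
have -> : lift 0 (0 : 'I_1) = 1 :> 'I_2 by apply: val_inj.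
have -> : lift 1 (0 : 'I_1) = 0 :> 'I_2 by apply: val_inj.
by rewrite /= /bump /= !addn0 expr0 expr1; ring.
Qed.

Lemma det_col2E (u v : 'rV[R]_2) : \det (col_mx u v) = u 0 0 * v 0 1 - u 0 1 * v 0 0.
Proof.
rewrite det2E.
have H j : (col_mx u v) 0 j = u 0 j.
  have -> : (0 : 'I_2) = lshift 1 (0 : 'I_1) by apply: val_inj.
  by rewrite col_mxEu.
have H1 j : (col_mx u v) 1 j = v 0 j.
  have -> : (1 : 'I_2) = rshift 1 (0 : 'I_1) by apply: val_inj.
  by rewrite col_mxEd.
by rewrite !H !H1.
Qed.

Lemma det3E (M : 'M[R]_3) : \det M =
  M 0 0 * (M 1 1 * M 2%:R 2%:R - M 1 2%:R * M 2%:R 1)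
  - M 0 1 * (M 1 0 * M 2%:R 2%:R - M 1 2%:R * M 2%:R 0)
  + M 0 2%:R * (M 1 0 * M 2%:R 1 - M 1 1 * M 2%:R 0).
Proof.
rewrite (expand_det_row _ 0) !big_ord_recl big_ord0 addr0 /cofactor !det2E !mxE /=.
have e1 : lift 0 (0 : 'I_2) = 1 :> 'I_3 by apply: val_inj.
have e2 : lift 0 (1 : 'I_2) = 2%:R :> 'I_3 by apply: val_inj.
have e3 : lift 1 (0 : 'I_2) = 0 :> 'I_3 by apply: val_inj.
have e4 : lift 1 (1 : 'I_2) = 2%:R :> 'I_3 by apply: val_inj.
have e5 : lift (2%:R : 'I_3) (0 : 'I_2) = 0 :> 'I_3 by apply: val_inj.
have e6 : lift (2%:R : 'I_3) (1 : 'I_2) = 1 :> 'I_3 by apply: val_inj.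
have e7 : lift ord0 (0 : 'I_1) = 1 :> 'I_2 by apply: val_inj.
have e0 : ord0 = 0 :> 'I_3 by [].
rewrite ?e0 ?e7 ?e1 ?e2 ?e3 ?e4 ?e5 ?e6 /=.
by rewrite /bump /= !addn0 !add0n expr0 expr1 ?expr2; ring.
Qed.

(** Both sides say |b^2 + c^2 - a^2| < 2 b c; the difference of the squares is symmetric in the
    three sides, so the condition at one corner implies it at all. *)
Lemma euclid_cos_sym (x : 'I_3 -> R) i : (forall i, 0 < x i) ->
  (-1 < euclid_cos (x i) (x (ordS i)) (x (ord_pred i)) < 1) =
  (0 < 2 * (x i ^+ 2 * x (ordS i) ^+ 2 + x i ^+ 2 * x (ord_pred i) ^+ 2
     + x (ordS i) ^+ 2 * x (ord_pred i) ^+ 2)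
     - (x i ^+ 4 + x (ordS i) ^+ 4 + x (ord_pred i) ^+ 4)).
Proof.
move=> x0; rewrite /euclid_cos.
have a0 := x0 i; have b0 := x0 (ordS i); have c0 := x0 (ord_pred i).
move: a0 b0 c0; set a := x i; set b := x (ordS i); set c := x (ord_pred i) => a0 b0 c0.
have bc : 0 < 2 * b * c by rewrite !mulr_gt0.
rewrite ltr_pdivrMr // ltr_pdivlMr // mul1r mulN1r.
have -> : 2 * (a ^+ 2 * b ^+ 2 + a ^+ 2 * c ^+ 2 + b ^+ 2 * c ^+ 2)
   - (a ^+ 4 + b ^+ 4 + c ^+ 4) = (2 * b * c) ^+ 2 - (b ^+ 2 + c ^+ 2 - a ^+ 2) ^+ 2 by ring.
rewrite subr_gt0 -ltr_norml -[X in _ = (X < _)]real_normK ?num_real //.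
by rewrite ltr_pXn2r // ?nnegrE ?normr_ge0 // ltW.
Qed.

(** Sixteen times the squared area, by Heron's formula. *)
Definition heron (x : 'I_3 -> R) := 2 * (x 0 ^+ 2 * x 1 ^+ 2 + x 0 ^+ 2 * x 2%:R ^+ 2
     + x 1 ^+ 2 * x 2%:R ^+ 2) - (x 0 ^+ 4 + x 1 ^+ 4 + x 2%:R ^+ 4).

(** Minus the determinant of the Lorentz Gram matrix of three points of the hyperboloid at these
    mutual distances. *)
Definition hyp_gram (x : 'I_3 -> R) := 1 + 2 * cosh (x 0) * cosh (x 1) * cosh (x 2%:R)
  - cosh (x 0) ^+ 2 - cosh (x 1) ^+ 2 - cosh (x 2%:R) ^+ 2.

Lemma ord3_ind (P : 'I_3 -> Prop) : P 0 -> P 1 -> P 2%:R -> forall i, P i.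
Proof.
move=> P0 P1 P2 i; case: (ord3_cases 0 i) => ->; first exact: P0.
  by rewrite (_ : ordS 0 = 1) //; apply: val_inj.
by rewrite (_ : ord_pred 0 = 2%:R) //; apply: val_inj.
Qed.

Lemma ord3_val : (ordS (0 : 'I_3) = 1) * (ordS (1 : 'I_3) = 2%:R) * (ordS (2%:R : 'I_3) = 0)
  * (ord_pred (0 : 'I_3) = 2%:R) * (ord_pred (1 : 'I_3) = 0) * (ord_pred (2%:R : 'I_3) = 1).
Proof. by repeat split; apply: val_inj. Qed.

Lemma euclid_cos_heron (x : 'I_3 -> R) i : (forall i, 0 < x i) ->
  (-1 < euclid_cos (x i) (x (ordS i)) (x (ord_pred i)) < 1) = (0 < heron x).
Proof.
move=> x0; rewrite euclid_cos_sym // /heron; move: i.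
by apply: ord3_ind; rewrite !ord3_val; congr (0 < _); ring.
Qed.

Lemma hyp_cos_gram (x : 'I_3 -> R) i : (forall i, 0 < x i) ->
  (-1 < hyp_cos (x i) (x (ordS i)) (x (ord_pred i)) < 1) = (0 < hyp_gram x).
Proof.
move=> x0; rewrite /hyp_cos.
have := sinh_gt0 (x0 (ordS i)); have := sinh_gt0 (x0 (ord_pred i)).
have := cosh2 (x (ordS i)); have := cosh2 (x (ord_pred i)).
set b := cosh (x (ordS i)); set c := cosh (x (ord_pred i)); set a := cosh (x i).
set sb := sinh (x (ordS i)); set sc := sinh (x (ord_pred i)) => c2 b2 sc0 sb0.
have bc : 0 < sb * sc := mulr_gt0 sb0 sc0.
rewrite ltr_pdivrMr // ltr_pdivlMr // mul1r mulN1r.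
have -> : hyp_gram x = (sb * sc) ^+ 2 - (b * c - a) ^+ 2.
  have -> : (sb * sc) ^+ 2 = (b ^+ 2 - 1) * (c ^+ 2 - 1) by rewrite c2 b2; ring.
  rewrite /hyp_gram /a /b /c; clear; move: i.
  by apply: ord3_ind; rewrite !ord3_val; ring.
rewrite subr_gt0 -ltr_norml -[X in _ = (X < _)]real_normK ?num_real //.
by rewrite ltr_pXn2r // ?nnegrE ?normr_ge0 // ltW.
Qed.

Lemma vector_angle_eq (V : Type) (B : V -> V -> R) u v b c k : 0 < b -> 0 < c ->
  B u u = b ^+ 2 -> B v v = c ^+ 2 -> B u v = k * (b * c) ->
  vector_angle B u v = acos k.
Proof.
move=> b0 c0 uu vv uv; rewrite /vector_angle uu vv uv.
rewrite !sqrtr_sqr !gtr0_norm // mulfK //.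
by rewrite mulf_neq0 // gt_eqF.
Qed.

Lemma sqrt_eq_sqr a b : 0 < b -> Num.sqrt a = b -> a = b ^+ 2.
Proof.
move=> b0 ab; rewrite -ab sqr_sqrtr // leNgt; apply/negP => a0.
by move: b0; rewrite -ab ler0_sqrtr ?ltxx // ltW.
Qed.

Lemma euclidean_cosine_law : cosine_law (euclidean_plane R) (@euclid_cos R).
Proof.
split=> [p x x0 nc dist i|x x0 H].
  have D j : euclid_dot (p (ord_pred j) - p (ordS j)) (p (ord_pred j) - p (ordS j)) = x j ^+ 2.
    by apply: sqrt_eq_sqr => //; exact: dist.
  split.
    rewrite euclid_cos_heron //.
    have -> : heron x = 4 * \det (col_mx (p 1 - p 0) (p 2%:R - p 0)) ^+ 2.
      rewrite det_col2E.
      have -> : heron x = 2 * (x 0 ^+ 2 * x 1 ^+ 2 + x 0 ^+ 2 * x 2%:R ^+ 2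
     + x 1 ^+ 2 * x 2%:R ^+ 2) - ((x 0 ^+ 2) ^+ 2 + (x 1 ^+ 2) ^+ 2 + (x 2%:R ^+ 2) ^+ 2).
        by rewrite /heron; ring.
      rewrite -!D !ord3_val !euclid_dotE !mxE; ring.
    by rewrite mulr_gt0 // exprn_even_gt0 //=; apply/eqP => d0; apply: nc.
  have bb := D (ord_pred i); have cc := D (ordS i); have aa := D i.
  rewrite !ord3E in bb cc.
  rewrite /=; apply: (@vector_angle_eq _ _ _ _ (x (ord_pred i)) (x (ordS i))) => //.
  - by rewrite -cc !euclid_dotE !mxE; ring.
  - have b0 := x0 (ordS i); have c0 := x0 (ord_pred i).
    have -> : euclid_cos (x i) (x (ordS i)) (x (ord_pred i)) * (x (ord_pred i) * x (ordS i))
      = (x (ordS i) ^+ 2 + x (ord_pred i) ^+ 2 - x i ^+ 2) / 2.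
      by rewrite /euclid_cos; field; rewrite !gt_eqF.
    by rewrite -aa -bb -cc !euclid_dotE !mxE; field.
have /andP[k1 k2] := H 0; rewrite !ord3_val in k1 k2.
have x00 := x0 0; have x10 := x0 1; have x20 := x0 2%:R.
pose k := euclid_cos (x 0) (x 1) (x 2%:R).
have ek : (x 0) ^+ 2 = x 1 ^+ 2 + x 2%:R ^+ 2 - 2 * x 1 * x 2%:R * k.
  by rewrite /k /euclid_cos; field; rewrite !gt_eqF.
have s0 : 0 < 1 - k ^+ 2 by rewrite /k; nra.
pose s := Num.sqrt (1 - k ^+ 2).
have s2 : s ^+ 2 = 1 - k ^+ 2 by rewrite sqr_sqrtr // ltW.
have sp : 0 < s by rewrite sqrtr_gt0.
pose vec a b : 'rV[R]_2 := \row_j (if j == 0 then a else b).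
(* Vertex 0 is the origin, vertex 1 lies on the first axis, and vertex 2 is in the direction with
   cosine [k] and sine [s]. *)
pose p (i : 'I_3) := if i == 0 then vec 0 0 else if i == 1 then vec (x 2%:R) 0
  else vec (x 1 * k) (x 1 * s).
exists p => /=; split.
  rewrite /p /= det_col2E.
  rewrite /vec !mxE /= !subr0 mul0r subr0.
  by apply/eqP; rewrite !mulf_neq0 // gt_eqF.
apply: ord3_ind; rewrite !ord3_val /p /=;
  rewrite euclid_dotE /vec !mxE /=; rewrite -[RHS]gtr0_norm // -sqrtr_sqr; congr Num.sqrt.
- apply/eqP; rewrite ek -subr_eq0; apply/eqP.
  by transitivity (x 1 ^+ 2 * (s ^+ 2 - (1 - k ^+ 2))); [ring|rewrite s2 subrr mulr0].
- apply/eqP; rewrite -subr_eq0; apply/eqP.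
  by transitivity (x 1 ^+ 2 * (s ^+ 2 - (1 - k ^+ 2))); [ring|rewrite s2 subrr mulr0].
- ring.
Qed.
End CosineLaws.

(** * The cosine law in the hyperboloid model *)

Section HyperbolicLaw.
Variable R : realType.
Implicit Types (a b c : R) (x : 'I_3 -> R).

Lemma det_col3E (u v w : 'rV[R]_3) : \det (col_mx u (col_mx v w)) =
  u 0 0 * (v 0 1 * w 0 2%:R - v 0 2%:R * w 0 1)
  - u 0 1 * (v 0 0 * w 0 2%:R - v 0 2%:R * w 0 0)
  + u 0 2%:R * (v 0 0 * w 0 1 - v 0 1 * w 0 0).
Proof.
rewrite det3E.
have H j : (col_mx u (col_mx v w)) 0 j = u 0 j.
  have -> : (0 : 'I_3) = lshift 2 (0 : 'I_1) by apply: val_inj.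
  by rewrite col_mxEu.
have H1 j : (col_mx u (col_mx v w)) 1 j = v 0 j.
  have -> : (1 : 'I_3) = rshift 1 (lshift 1 (0 : 'I_1)) by apply: val_inj.
  by rewrite col_mxEd col_mxEu.
have H2 j : (col_mx u (col_mx v w)) 2%:R j = w 0 j.
  have -> : (2%:R : 'I_3) = rshift 1 (rshift 1 (0 : 'I_1)) by apply: val_inj.
  by rewrite col_mxEd col_mxEd.
by rewrite !H !H1 !H2.
Qed.

Lemma lorentzC (u v : 'rV[R]_3) : lorentz u v = lorentz v u.
Proof. by rewrite /lorentz; ring. Qed.

Lemma lorentz_tangent (p q r : 'rV[R]_3) : lorentz p p = -1 ->
  lorentz (hyp_tangent p q) (hyp_tangent p r) = lorentz q r + lorentz p q * lorentz p r.
Proof.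
move=> pp.
have -> : lorentz (hyp_tangent p q) (hyp_tangent p r) = lorentz q r
   + lorentz p q * lorentz p r * (2 + lorentz p p).
  by rewrite /hyp_tangent /lorentz !mxE; ring.
by rewrite pp; ring.
Qed.

Lemma hyperbolic_cosine_law : cosine_law (hyperbolic_plane R) (@hyp_cos R).
Proof.
split=> [p x x0 nc dist i|x x0 H].
  have D j : lorentz (p (ordS j)) (p (ord_pred j)) = - cosh (x j).
    by rewrite -(cosh_of_arcosh (x0 j) (dist j)) opprK.
  have N j : lorentz (p j) (p j) = -1 by exact: hyp_eq.
  split.
    rewrite hyp_cos_gram //.
    (* The Gram determinant is the squared determinant of the vectors times that of the Lorentz
       form, which is -1. *)
    have -> : hyp_gram x = \det (col_mx (p 0) (col_mx (p 1) (p 2%:R))) ^+ 2.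
      have -> : hyp_gram x = - ((-1) ^+ 3 + 2 * (- cosh (x 0)) * (- cosh (x 1)) * (- cosh (x 2%:R))
         + cosh (x 0) ^+ 2 + cosh (x 1) ^+ 2 + cosh (x 2%:R) ^+ 2).
        by rewrite /hyp_gram; ring.
      have -> : (-1) ^+ 3 = lorentz (p 0) (p 0) * lorentz (p 1) (p 1) * lorentz (p 2%:R) (p 2%:R).
        by rewrite !N; ring.
      have e j : cosh (x j) ^+ 2 = - (lorentz (p j) (p j)) * (- cosh (x j)) ^+ 2.
        by rewrite N; ring.
      rewrite !e -!D !ord3_val det_col3E /lorentz; ring.
    by rewrite exprn_even_gt0 //=; apply/eqP => d0; apply: nc.
  have bb := D (ordS i); have cc := D (ord_pred i); have aa := D i.
  rewrite !ord3E in bb cc.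
  have b0 := sinh_gt0 (x0 (ordS i)); have c0 := sinh_gt0 (x0 (ord_pred i)).
  apply: (@vector_angle_eq _ _ _ _ _ (sinh (x (ord_pred i))) (sinh (x (ordS i)))) => //.
  - by rewrite lorentz_tangent // N cc mulrNN -expr2 cosh2; ring.
  - by rewrite lorentz_tangent // N (lorentzC (p i)) bb mulrNN -expr2 cosh2; ring.
  - rewrite lorentz_tangent // aa cc (lorentzC (p i)) bb /hyp_cos.
    by field; rewrite !gt_eqF.
have /andP[k1 k2] := H 0; rewrite !ord3_val in k1 k2.
have x10 := sinh_gt0 (x0 1); have x20 := sinh_gt0 (x0 2%:R).
pose k := hyp_cos (x 0) (x 1) (x 2%:R).
have ek : cosh (x 0) = cosh (x 1) * cosh (x 2%:R) - sinh (x 1) * sinh (x 2%:R) * k.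
  by rewrite /k /hyp_cos; field; rewrite !gt_eqF.
have s0 : 0 < 1 - k ^+ 2 by rewrite /k; nra.
pose s := Num.sqrt (1 - k ^+ 2).
have s2 : s ^+ 2 = 1 - k ^+ 2 by rewrite sqr_sqrtr // ltW.
have sp : 0 < s by rewrite sqrtr_gt0.
pose vec a b c : 'rV[R]_3 := \row_j (if j == 0 then a else if j == 1 then b else c).
(* As in the Euclidean plane, in geodesic polar coordinates around the apex of the hyperboloid. *)
pose v (i : 'I_3) := if i == 0 then vec 1 0 0 else if i == 1 then vec (cosh (x 2%:R)) (sinh (x 2%:R)) 0
  else vec (cosh (x 1)) (sinh (x 1) * k) (sinh (x 1) * s).
have vH : forall i, lorentz (v i) (v i) = -1 /\ 0 < v i 0 0.
  apply: ord3_ind; rewrite /v /lorentz /vec /= !mxE /=; split=> //.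
  - by ring.
  - by rewrite -!expr2 cosh2; ring.
  - by have := cosh_gt1 (x0 2%:R); lra.
  - have -> : - (cosh (x 1) * cosh (x 1)) + sinh (x 1) * k * (sinh (x 1) * k) +
       sinh (x 1) * s * (sinh (x 1) * s) = - (cosh (x 1)) ^+ 2 + sinh (x 1) ^+ 2 * (k ^+ 2 + s ^+ 2) by ring.
    by rewrite s2 cosh2; ring.
  - by have := cosh_gt1 (x0 1); lra.
pose p i : geo_point (hyperbolic_plane R) := Hyperboloid (vH i).1 (vH i).2.
exists p; split.
  rewrite [X in ~ X]/=/v /= det_col3E /vec !mxE /=.
  rewrite (_ : _ + _ = sinh (x 2%:R) * (sinh (x 1) * s)); last by ring.
  by apply/eqP/mulf_neq0; [|apply: mulf_neq0]; exact: lt0r_neq0.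
apply: ord3_ind; rewrite !ord3_val /= -[RHS]arcosh_cosh //; congr arcosh;
  rewrite /v /lorentz /vec /= !mxE /=; [rewrite ek|idtac..]; ring.
Qed.
End HyperbolicLaw.

(** * Trigonometry of a triangle *)

Section TriangleTrig.
Variable R : realType.
Implicit Types (a b c x y z A B C : R).

Lemma sin_pos_le_pi x : 0 <= x <= 2 * pi -> 0 < sin x -> x < pi.
Proof.
move=> /andP[x0 x2] s0; rewrite ltNge; apply/negP => px; move: s0.
have : 0 <= x - pi <= pi by lra.
move=> /sin_ge0_pi; rewrite sinB sinpi cospi mulr0 subr0 mulrN1; lra.
Qed.

Lemma cos_lt_pi x y : 0 <= x <= pi -> 0 <= y <= pi -> cos x < cos y -> y < x.
Proof.
by move=> x0 y0; rewrite ltr_cos // in_itv.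
Qed.

Lemma sin_eq_sqrt x (k : R) : 0 < x < pi -> 0 < k -> sin x ^+ 2 = k ^+ 2 -> sin x = k.
Proof.
move=> /sin_gt0_pi s0 k0 /eqP; rewrite eqf_sqr => /orP[/eqP//|/eqP E].
by move: s0; rewrite E oppr_gt0 ltNge (ltW k0).
Qed.

Section Euclid.
Variables a b c A B C : R.
Hypotheses (a0 : 0 < a) (b0 : 0 < b) (c0 : 0 < c).
Hypotheses (A0 : 0 < A < pi) (B0 : 0 < B < pi) (C0 : 0 < C < pi).
Hypotheses (cA : cos A = euclid_cos a b c) (cB : cos B = euclid_cos b c a)
  (cC : cos C = euclid_cos c a b).

(** Law of sines. The factor, the square root of H divided by 2 a b c, is the inverse of the
    circumscribed diameter. *)
Lemma euclid_sines : exists2 k, 0 < k & [/\ sin A = k * a, sin B = k * b & sin C = k * c].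
Proof.
pose H := 2 * (a ^+ 2 * b ^+ 2 + a ^+ 2 * c ^+ 2 + b ^+ 2 * c ^+ 2) - (a ^+ 4 + b ^+ 4 + c ^+ 4).
have a00 : a != 0 by rewrite gt_eqF.
have b00 : b != 0 by rewrite gt_eqF.
have c00 : c != 0 by rewrite gt_eqF.
have abc0 : 0 < 2 * a * b * c by rewrite !mulr_gt0.
have sA : sin A ^+ 2 = H / (2 * a * b * c) ^+ 2 * a ^+ 2.
  by rewrite sin2cos2 cA /euclid_cos /H; field; rewrite a00 b00 c00.
have sB : sin B ^+ 2 = H / (2 * a * b * c) ^+ 2 * b ^+ 2.
  by rewrite sin2cos2 cB /euclid_cos /H; field; rewrite a00 b00 c00.
have sC : sin C ^+ 2 = H / (2 * a * b * c) ^+ 2 * c ^+ 2.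
  by rewrite sin2cos2 cC /euclid_cos /H; field; rewrite a00 b00 c00.
have k0 : 0 < H / (2 * a * b * c) ^+ 2.
  have := exprn_gt0 2 (sin_gt0_pi A0); rewrite sA.
  by rewrite pmulr_lgt0 // exprn_gt0.
exists (Num.sqrt (H / (2 * a * b * c) ^+ 2)); first by rewrite sqrtr_gt0.
by split; apply: sin_eq_sqrt; rewrite ?mulr_gt0 ?sqrtr_gt0 // exprMn sqr_sqrtr ?(ltW k0).
Qed.

Lemma euclid_proj : a * cos B + b * cos A = c.
Proof. by rewrite cA cB /euclid_cos; field; rewrite !gt_eqF. Qed.

(** A + B and pi - C have the same cosine. Both are in [0, pi], because sin (A + B) = k c > 0 by the
    law of sines. *)
Lemma euclid_angle_sum : A + B + C = pi.
Proof.
have [k k0 [sA sB sC]] := euclid_sines.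
have E : cos (A + B) = cos (pi - C).
  rewrite cosD cosB cospi sinpi mul0r addr0 mulN1r sA sB.
  have : sin A * sin B + (k * a) * (k * b) = 2 * (k * a) * (k * b) by rewrite sA sB; ring.
  have s2 : (k * c) ^+ 2 = 1 - cos C ^+ 2 by rewrite -sC sin2cos2.
  have -> : k * a * (k * b) = (k * c) ^+ 2 * (a * b / c ^+ 2) by field; rewrite gt_eqF.
  by rewrite s2 cA cB cC /euclid_cos => _; field; rewrite !gt_eqF.
have p0 := @pi_gt0 R.
have /andP[A1 A2] := A0; have /andP[B1 B2] := B0; have /andP[C1 C2] := C0.
have sAB : 0 < sin (A + B).
  rewrite sinD sA sB (_ : _ + _ = k * (a * cos B + b * cos A)); last by ring.
  by rewrite euclid_proj mulr_gt0.
have AB2 : 0 <= A + B <= 2 * pi by apply/andP; split; lra.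
have ABpi : A + B < pi := sin_pos_le_pi AB2 sAB.
have := cos_inj _ _ E; rewrite !in_itv /=.
have -> : 0 <= A + B <= pi by lra.
have -> : 0 <= pi - C <= pi by lra.
by move=> /(_ isT isT); lra.
Qed.

Lemma euclid_obtuse : cos A < 0 -> b < a /\ c < a.
Proof.
have bc : 0 < 2 * b * c by rewrite !mulr_gt0.
rewrite cA /euclid_cos pmulr_llt0 ?invr_gt0 // => H.
have [[a1 b1] c1] := (a0, b0, c0); split; nra.
Qed.
End Euclid.

(** Converse of the law of sines, by which limit metrics are recognized from their limit angles. *)
Lemma euclid_cos_of_sines a b c A B C k : 0 < k -> 0 < A < pi -> 0 < B < pi -> 0 < C < pi ->
  A + B + C = pi -> a = k * sin A -> b = k * sin B -> c = k * sin C ->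
  euclid_cos a b c = cos A.
Proof.
move=> k0 A0 B0 C0 S -> -> ->; have EA : A = pi - (B + C) by lra.
have sB := sin_gt0_pi B0; have sC := sin_gt0_pi C0.
have E : sin A = sin B * cos C + cos B * sin C.
  by rewrite EA sinB sinpi cospi mul0r sub0r mulN1r opprK sinD.
have F : cos A = sin B * sin C - cos B * cos C.
  by rewrite EA cosB sinpi cospi mul0r addr0 mulN1r cosD opprB.
have B2 := sin2cos2 B; have C2 := sin2cos2 C.
rewrite /euclid_cos E F.
have -> : (k * sin B) ^+ 2 + (k * sin C) ^+ 2 - (k * (sin B * cos C + cos B * sin C)) ^+ 2
   = 2 * (k * sin B) * (k * sin C) * (sin B * sin C - cos B * cos C)
   + k ^+ 2 * (sin B ^+ 2 * (1 - cos C ^+ 2 - sin C ^+ 2) + sin C ^+ 2 * (1 - cos B ^+ 2 - sin B ^+ 2)).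
  by ring.
rewrite -B2 -C2 !subrr !mulr0 addr0 mulr0 addr0.
by field; rewrite !gt_eqF.
Qed.

Lemma hyp_cosE a b c : 0 < b -> 0 < c ->
  cosh a = cosh b * cosh c - sinh b * sinh c * hyp_cos a b c.
Proof.
move=> /sinh_gt0/lt0r_neq0 + /sinh_gt0/lt0r_neq0; rewrite /hyp_cos.
by move: (sinh b) (sinh c) (cosh a) (cosh b) (cosh c) => *; field; apply/andP.
Qed.

Section Hyperbolic.
Variables a b c A B C : R.
Hypotheses (a0 : 0 < a) (b0 : 0 < b) (c0 : 0 < c).
Hypotheses (A0 : 0 < A < pi) (B0 : 0 < B < pi) (C0 : 0 < C < pi).
Hypotheses (cA : cos A = hyp_cos a b c) (cB : cos B = hyp_cos b c a)
  (cC : cos C = hyp_cos c a b).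

Let sa0 : sinh a != 0. Proof. exact/lt0r_neq0/sinh_gt0. Qed.
Let sb0 : sinh b != 0. Proof. exact/lt0r_neq0/sinh_gt0. Qed.
Let sc0 : sinh c != 0. Proof. exact/lt0r_neq0/sinh_gt0. Qed.

Lemma hyp_cosA : cosh a = cosh b * cosh c - sinh b * sinh c * cos A.
Proof.
by rewrite cA; exact: hyp_cosE.
Qed.
Lemma hyp_cosB : cosh b = cosh c * cosh a - sinh c * sinh a * cos B.
Proof.
by rewrite cB; exact: hyp_cosE.
Qed.
Lemma hyp_cosC : cosh c = cosh a * cosh b - sinh a * sinh b * cos C.
Proof.
by rewrite cC; exact: hyp_cosE.
Qed.

(** Law of sines in symmetric form: the three products are positive and have the same square, the
    quantity [hyp_gram]. *)
Lemma hyp_sines : exists2 g, 0 < g &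
  [/\ g ^+ 2 = 1 + 2 * cosh a * cosh b * cosh c - cosh a ^+ 2 - cosh b ^+ 2 - cosh c ^+ 2,
      sin A * (sinh b * sinh c) = g, sin B * (sinh c * sinh a) = g & sin C * (sinh a * sinh b) = g].
Proof.
have := hyp_cosA; have := hyp_cosB; have := hyp_cosC.
have := cosh2 a; have := cosh2 b; have := cosh2 c.
have := sinh_gt0 a0; have := sinh_gt0 b0; have := sinh_gt0 c0.
have := sin2cos2 A; have := sin2cos2 B; have := sin2cos2 C.
have := sin_gt0_pi A0; have := sin_gt0_pi B0; have := sin_gt0_pi C0.
move: (sinh a) (sinh b) (sinh c) (cosh a) (cosh b) (cosh c) => sa sb sc ca cb cc.
move: (sin A) (sin B) (sin C) (cos A) (cos B) (cos C) => sA sB sC kA kB kC.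
move=> sC1 sB1 sA1 eC eB eA sc1 sb1 sa1 hc hb ha hC hB hA.
pose g2 := 1 + 2 * ca * cb * cc - ca ^+ 2 - cb ^+ 2 - cc ^+ 2.
have GA : (sA * (sb * sc)) ^+ 2 = g2.
  transitivity ((cb ^+ 2 - 1) * (cc ^+ 2 - 1) - (cb * cc - ca) ^+ 2); last by rewrite /g2; ring.
  by rewrite hb hc hA exprMn eA; ring.
have GB : (sB * (sc * sa)) ^+ 2 = g2.
  transitivity ((cc ^+ 2 - 1) * (ca ^+ 2 - 1) - (cc * ca - cb) ^+ 2); last by rewrite /g2; ring.
  by rewrite hc ha hB exprMn eB; ring.
have GC : (sC * (sa * sb)) ^+ 2 = g2.
  transitivity ((ca ^+ 2 - 1) * (cb ^+ 2 - 1) - (ca * cb - cc) ^+ 2); last by rewrite /g2; ring.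
  by rewrite ha hb hC exprMn eC; ring.
have pos u v : 0 < u -> 0 < v -> u ^+ 2 = v ^+ 2 -> u = v.
  by move=> u0 v0 /eqP; rewrite eqrXn2 ?(ltW u0) ?(ltW v0) // => /eqP.
have pA : 0 < sA * (sb * sc) by rewrite !mulr_gt0.
have pB : 0 < sB * (sc * sa) by rewrite !mulr_gt0.
have pC : 0 < sC * (sa * sb) by rewrite !mulr_gt0.
exists (sA * (sb * sc)) => //; split=> //; apply: pos => //.
  by rewrite GB GA.
by rewrite GC GA.
Qed.

Lemma hyp_law_of_sines : sin A * sinh b = sin B * sinh a.
Proof.
have [g _ [_ gA gB _]] := hyp_sines.
by apply: (mulIf sc0); rewrite -mulrA gA -gB; ring.
Qed.

(** After multiplication by sinh^2 a sinh b sinh c the sines combine into g^2 of [hyp_sines], and an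
    identity in the hyperbolic cosines remains. *)
Lemma hyp_dual_cosine : cosh a * (sin B * sin C) = cos A + cos B * cos C.
Proof.
have [g g0 [g2 gA gB gC]] := hyp_sines.
have P : sinh a ^+ 2 * sinh b * sinh c != 0.
  by apply: mulf_neq0 => //; apply: mulf_neq0 => //; rewrite expf_neq0.
apply: (mulIf P).
have -> : cosh a * (sin B * sin C) * (sinh a ^+ 2 * sinh b * sinh c) =
   cosh a * ((sin B * (sinh c * sinh a)) * (sin C * (sinh a * sinh b))) by ring.
rewrite gB gC -expr2 g2 cA cB cC /hyp_cos.
have ea : sinh a ^+ 2 = cosh a ^+ 2 - 1 by rewrite cosh2 addrC addKr.
move: sa0 sb0 sc0 ea; move: (sinh a) (sinh b) (sinh c) (cosh a) (cosh b) (cosh c) => sa sb sc ca cb cc.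
move=> ? ? ? ea.
transitivity ((cb * cc - ca) * sa ^+ 2 + (cc * ca - cb) * (ca * cb - cc)); first by rewrite ea; ring.
by field; apply/and3P.
Qed.

Lemma hyp_obtuse : cos A < 0 -> b < a /\ c < a.
Proof.
have mono x y : 0 < x -> cosh x < cosh y -> 0 < y -> x < y.
  move=> x0 xy y0; have := cosh2 x; have := cosh2 y.
  have sx := sinh_gt0 x0; have sy := sinh_gt0 y0.
  have := cosh_gt1 x0; have := cosh_gt1 y0; have := coshDsinh x; have := coshDsinh y.
  rewrite -(ltr_expR x y) => <- <-; move: xy sx sy.
  by move: (sinh x) (sinh y) (cosh x) (cosh y) => *; nra.
have := hyp_cosA; have := sinh_gt0 b0; have := sinh_gt0 c0.
have := cosh_gt1 b0; have := cosh_gt1 c0 => cc1 cb1 sc1 sb1 hA kA.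
have sbc : 0 < sinh b * sinh c := mulr_gt0 sb1 sc1.
have sbk : sinh b * sinh c * cos A < 0 by rewrite pmulr_rlt0.
have H : cosh b * cosh c < cosh a by rewrite hA; lra.
split; apply: mono => //; apply: lt_trans H.
  by rewrite ltr_pMr //; lra.
by rewrite ltr_pMl //; lra.
Qed.

End Hyperbolic.

(** The dual cosine law together with cosh a > 1. *)
Lemma cos_supplement_lt a b c A B C : 0 < a -> 0 < b -> 0 < c ->
  0 < A < pi -> 0 < B < pi -> 0 < C < pi ->
  cos A = hyp_cos a b c -> cos B = hyp_cos b c a -> cos C = hyp_cos c a b ->
  cos (pi - (B + C)) < cos A.
Proof.
move=> a0 b0 c0 A0 B0 C0 cA cB cC.
have := hyp_dual_cosine a0 b0 c0 A0 B0 C0 cA cB cC.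
have := cosh_gt1 a0; have sB := sin_gt0_pi B0; have sC := sin_gt0_pi C0.
rewrite cosB cospi sinpi mul0r addr0 mulN1r cosD => ca1 E.
have : sin B * sin C < cosh a * (sin B * sin C) by rewrite ltr_pMl // mulr_gt0.
by rewrite E; lra.
Qed.

Lemma hyp_angle_sum a b c A B C : 0 < a -> 0 < b -> 0 < c ->
  0 < A < pi -> 0 < B < pi -> 0 < C < pi ->
  cos A = hyp_cos a b c -> cos B = hyp_cos b c a -> cos C = hyp_cos c a b ->
  A + B + C < pi.
Proof.
move=> a0 b0 c0 A0 B0 C0 cA cB cC.
have HA := cos_supplement_lt a0 b0 c0 A0 B0 C0 cA cB cC.
have HB := cos_supplement_lt b0 c0 a0 B0 C0 A0 cB cC cA.
have HC := cos_supplement_lt c0 a0 b0 C0 A0 B0 cC cA cB.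
have p0 := @pi_gt0 R.
(* If the second alternative held at all three corners, adding up would give A + B + C > 3 pi. *)
have key x y z : 0 < x < pi -> 0 < y < pi -> 0 < z < pi ->
    cos (pi - (y + z)) < cos x -> x + y + z < pi \/ x < y + z - pi.
  move=> x0 y0 z0 H; have [yz|yz] := leP (y + z) pi.
    by left; have := cos_lt_pi (_ : 0 <= pi - (y + z) <= pi) (_ : 0 <= x <= pi) H; lra.
  right; move: H; rewrite -cosN => H.
  by have := cos_lt_pi (_ : 0 <= - (pi - (y + z)) <= pi) (_ : 0 <= x <= pi) H; lra.
by have := key _ _ _ A0 B0 C0 HA; have := key _ _ _ B0 C0 A0 HB;
  have := key _ _ _ C0 A0 B0 HC; lra.
Qed.

End TriangleTrig.

(** * The quadratic form of a triangle *)

Section QuadraticForms.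
Variable R : realType.
Implicit Types (a b c x y z u v w A B C : R).

Lemma sin_sqr_sub x y : sin x ^+ 2 - sin y ^+ 2 = sin (x - y) * sin (x + y).
Proof.
rewrite sinB sinD; have := sin2cos2 x; have := sin2cos2 y.
move: (sin x) (sin y) (cos x) (cos y) => p q k m hq hp.
have -> : (p * m - k * q) * (p * m + k * q) = p ^+ 2 * m ^+ 2 - k ^+ 2 * q ^+ 2 by ring.
by rewrite hp hq; ring.
Qed.

(** Ptolemy's identity; with [sin_sqr_sub] it factors the minors of [hyp_quad] into sines. *)
Lemma sin_mul_add x y z :
  sin (x + y + z) * sin x + sin y * sin z = sin (x + y) * sin (x + z).
Proof.
rewrite !sinD !cosD; have := cos2sin2 x.
move: (sin x) (sin y) (sin z) (cos x) (cos y) (cos z) => p q r k m n hk.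
apply/eqP; rewrite -subr_eq0; apply/eqP.
transitivity ((1 - p ^+ 2 - k ^+ 2) * (q * r)); first by ring.
by rewrite hk subrr mul0r.
Qed.

(** The form is degenerate: its kernel is spanned by (sin A, sin B, sin C), that is, by the sides,
    in accordance with scaling. *)
Lemma euclid_quadE A B C u v w : A + B + C = pi ->
  u * (u - cos C * v - cos B * w) + v * (v - cos A * w - cos C * u)
    + w * (w - cos B * u - cos A * v)
  = (u - cos C * v - cos B * w) ^+ 2 + (sin C * v - sin B * w) ^+ 2.
Proof.
move=> S; have EA : A = pi - (B + C) by lra.
have F : cos A = sin B * sin C - cos B * cos C.
  by rewrite EA cosB cospi sinpi mul0r addr0 mulN1r cosD opprB.
have := sin2cos2 B; have := sin2cos2 C; rewrite F.
move: (sin B) (sin C) (cos B) (cos C) => q r m n hr hq.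
apply/eqP; rewrite -subr_eq0; apply/eqP.
transitivity ((1 - n ^+ 2 - r ^+ 2) * v ^+ 2 + (1 - m ^+ 2 - q ^+ 2) * w ^+ 2); first by ring.
by rewrite hr hq !subrr !mul0r addr0.
Qed.

(** For A + B + C = pi this is the form of [euclid_quadE]. *)
Definition hyp_quad A B C u v w :=
  sin ((A + B + C) / 2) * (u ^+ 2 + v ^+ 2 + w ^+ 2)
  - 2 * (sin ((A + B - C) / 2) * u * v + sin ((C + A - B) / 2) * u * w
       + sin ((B + C - A) / 2) * v * w).

(** Completion of squares. The pivots are s, P = sin C sin (A + B) and P Q - m^2 = sin A sin B sin C
    sin (A + B + C), all positive because the angle sum is below pi. *)
Lemma hyp_quad_ge0 A B C u v w : 0 < A -> 0 < B -> 0 < C -> A + B + C < pi ->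
  0 <= hyp_quad A B C u v w /\
  (hyp_quad A B C u v w = 0 -> [/\ u = 0, v = 0 & w = 0]).
Proof.
move=> A0 B0 C0 S.
pose s := sin ((A + B + C) / 2).
pose r := sin ((A + B - C) / 2); pose q := sin ((C + A - B) / 2); pose p := sin ((B + C - A) / 2).
have s0 : 0 < s by apply: sin_gt0_pi; lra.
have sA : 0 < sin A by apply: sin_gt0_pi; lra.
have sB : 0 < sin B by apply: sin_gt0_pi; lra.
have sC : 0 < sin C by apply: sin_gt0_pi; lra.
have sAB : 0 < sin (A + B) by apply: sin_gt0_pi; lra.
have sABC : 0 < sin (A + B + C) by apply: sin_gt0_pi; lra.
have e1 : s ^+ 2 - r ^+ 2 = sin C * sin (A + B).
  by rewrite sin_sqr_sub; congr (sin _ * sin _); lra.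
have e2 : s ^+ 2 - q ^+ 2 = sin B * sin (A + C).
  by rewrite sin_sqr_sub; congr (sin _ * sin _); lra.
have e3 : s * p + q * r = sin B * sin C.
  have := sin_mul_add ((B + C - A) / 2) ((C + A - B) / 2) ((A + B - C) / 2).
  rewrite (_ : _ + _ + _ = (A + B + C) / 2); last by lra.
  rewrite (_ : _ + (C + A - B) / 2 = C); last by lra.
  rewrite (_ : _ + (A + B - C) / 2 = B); last by lra.
  by rewrite -/s -/p -/q -/r => ->; ring.
have e4 : sin (A + B) * sin (A + C) = sin A * sin (A + B + C) + sin B * sin C.
  by rewrite -sin_mul_add; ring.
pose P := sin C * sin (A + B); pose Q := sin B * sin (A + C); pose m := sin B * sin C.
have P0 : 0 < P by rewrite mulr_gt0.
have PQ : 0 < P * Q - m ^+ 2.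
  have -> : P * Q - m ^+ 2 = (sin B * sin C) * (sin (A + B) * sin (A + C) - sin B * sin C).
    by rewrite /P /Q /m; ring.
  by rewrite e4 addrK !mulr_gt0.
have E : P * (s * hyp_quad A B C u v w) = P * (s * u - r * v - q * w) ^+ 2
   + ((P * v - m * w) ^+ 2 + (P * Q - m ^+ 2) * w ^+ 2).
  rewrite /P /Q /m -e1 -e2 -e3 /hyp_quad -/s -/r -/q -/p; ring.
have Ps : 0 < P * s by rewrite mulr_gt0.
have T1 z : 0 <= P * z ^+ 2 by apply: mulr_ge0; [exact: ltW|exact: sqr_ge0].
have T2 : 0 <= (P * Q - m ^+ 2) * w ^+ 2 by apply: mulr_ge0; [exact: ltW|exact: sqr_ge0].
have T3 : 0 <= (P * v - m * w) ^+ 2 + (P * Q - m ^+ 2) * w ^+ 2 by rewrite addr_ge0 ?sqr_ge0.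
split; first by rewrite -(pmulr_rge0 _ Ps) -mulrA E addr_ge0.
move=> h0; move: E; rewrite h0 !mulr0 => /esym/eqP.
rewrite (paddr_eq0 (T1 _) T3) mulf_eq0 (gt_eqF P0) sqrf_eq0 => /andP[/eqP h1].
rewrite (paddr_eq0 (sqr_ge0 _) T2) sqrf_eq0 mulf_eq0 (gt_eqF PQ) sqrf_eq0.
move=> /andP[/eqP h2 /eqP w0]; move: h2 h1.
rewrite w0 !mulr0 !subr0 => /eqP; rewrite mulf_eq0 (gt_eqF P0) => /eqP v0.
by rewrite v0 mulr0 subr0 => /eqP; rewrite mulf_eq0 (gt_eqF s0) => /eqP.
Qed.

Definition tanh_half a : R := sinh a / (cosh a + 1).

Lemma tanh_half_gt0 a : 0 < a -> 0 < tanh_half a.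
Proof.
move=> a0; apply: divr_gt0; first exact: sinh_gt0.
by have := cosh_gt1 a0; lra.
Qed.

Section Radii.
Variables a b c A B C : R.
Hypotheses (a0 : 0 < a) (b0 : 0 < b) (c0 : 0 < c).
Hypotheses (A0 : 0 < A < pi) (B0 : 0 < B < pi) (C0 : 0 < C < pi).
Hypotheses (cA : cos A = hyp_cos a b c) (cB : cos B = hyp_cos b c a)
  (cC : cos C = hyp_cos c a b).

(** By the dual cosine law, sin Y sin Z times cosh x - 1 and cosh x + 1 are sums of two cosines,
    hence the products 2 s p and 2 q r. Their quotient is the square of tanh (x / 2). *)
Lemma radii_tanh_half_aux x y z X Y Z : 0 < x -> 0 < y -> 0 < z ->
  0 < X < pi -> 0 < Y < pi -> 0 < Z < pi ->
  cos X = hyp_cos x y z -> cos Y = hyp_cos y z x -> cos Z = hyp_cos z x y ->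
  cos ((Y + Z - X) / 2) = Num.sqrt (cos ((X + Y - Z) / 2) * cos ((Y + Z - X) / 2)
      * cos ((Z + X - Y) / 2) / cos ((X + Y + Z) / 2)) * tanh_half x.
Proof.
move=> x0 y0 z0 X0 Y0 Z0 cX cY cZ.
have S := hyp_angle_sum x0 y0 z0 X0 Y0 Z0 cX cY cZ.
have /andP[X1 _] := X0; have /andP[Y1 _] := Y0; have /andP[Z1 _] := Z0.
have D := hyp_dual_cosine x0 y0 z0 X0 Y0 Z0 cX cY cZ.
set s := cos ((X + Y + Z) / 2); set p := cos ((Y + Z - X) / 2).
set q := cos ((Z + X - Y) / 2); set r := cos ((X + Y - Z) / 2).
have s0 : 0 < s by apply: cos_gt0_pihalf; lra.
have p0 : 0 < p by apply: cos_gt0_pihalf; lra.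
have q0 : 0 < q by apply: cos_gt0_pihalf; lra.
have r0 : 0 < r by apply: cos_gt0_pihalf; lra.
have sY := sin_gt0_pi Y0; have sZ := sin_gt0_pi Z0.
have sYZ : 0 < sin Y * sin Z by rewrite mulr_gt0.
have prodsum t t' : 2 * cos t * cos t' = cos (t + t') + cos (t - t') :> R.
  by rewrite cosD cosB; ring.
have e1 : 2 * s * p = cos (Y + Z) + cos X by rewrite prodsum; congr (cos _ + cos _); lra.
have e2 : 2 * q * r = cos X + cos (Z - Y) by rewrite prodsum; congr (cos _ + cos _); lra.
have h1 : (cosh x - 1) * (sin Y * sin Z) = 2 * s * p.
  by rewrite e1 mulrBl D cosD; ring.
have h2 : (cosh x + 1) * (sin Y * sin Z) = 2 * q * r.
  by rewrite e2 mulrDl D cosB; ring.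
have t0 := tanh_half_gt0 x0.
have x1 := cosh_gt1 x0.
have t2 : tanh_half x ^+ 2 = s * p / (q * r).
  have -> : tanh_half x ^+ 2 = (cosh x - 1) / (cosh x + 1).
    rewrite /tanh_half expr_div_n (_ : sinh x ^+ 2 = (cosh x - 1) * (cosh x + 1)).
      by field; rewrite gt_eqF //; lra.
    by have := cosh2 x; move: (sinh x) (cosh x) => *; lra.
  have -> : (cosh x - 1) / (cosh x + 1) = (cosh x - 1) * (sin Y * sin Z) / ((cosh x + 1) * (sin Y * sin Z)).
    by field; rewrite !gt_eqF //; lra.
  by rewrite h1 h2; field; rewrite !gt_eqF.
have k0 : 0 < r * p * q / s by rewrite divr_gt0 ?mulr_gt0.
have : p ^+ 2 = (Num.sqrt (r * p * q / s) * tanh_half x) ^+ 2.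
  by rewrite exprMn sqr_sqrtr ?(ltW k0) // t2; field; rewrite !gt_eqF.
move=> /eqP; rewrite eqrXn2 ?(ltW p0) // => [/eqP//|].
by rewrite mulr_ge0 ?sqrtr_ge0 ?(ltW t0).
Qed.

(** The analogue of the law of sines for the radii: the square root in [radii_tanh_half_aux] is
    symmetric in the three corners. *)
Lemma radii_tanh_half : exists2 k, 0 < k &
  [/\ cos ((B + C - A) / 2) = k * tanh_half a, cos ((C + A - B) / 2) = k * tanh_half b
    & cos ((A + B - C) / 2) = k * tanh_half c].
Proof.
have S := hyp_angle_sum a0 b0 c0 A0 B0 C0 cA cB cC.
have := radii_tanh_half_aux a0 b0 c0 A0 B0 C0 cA cB cC.
have := radii_tanh_half_aux b0 c0 a0 B0 C0 A0 cB cC cA.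
have := radii_tanh_half_aux c0 a0 b0 C0 A0 B0 cC cA cB.
have -> : B + C + A = A + B + C by ring.
have -> : C + A + B = A + B + C by ring.
set p := cos ((B + C - A) / 2); set q := cos ((C + A - B) / 2); set r := cos ((A + B - C) / 2).
have -> : p * q * r = r * p * q by ring.
have -> : q * r * p = r * p * q by ring.
set k := Num.sqrt _ => h3 h2 h1; exists k => //.
rewrite sqrtr_gt0.
have /andP[A1 _] := A0; have /andP[B1 _] := B0; have /andP[C1 _] := C0.
have s0 : 0 < cos ((A + B + C) / 2) by apply: cos_gt0_pihalf; lra.
have p0 : 0 < p by apply: cos_gt0_pihalf; lra.
have q0 : 0 < q by apply: cos_gt0_pihalf; lra.
have r0 : 0 < r by apply: cos_gt0_pihalf; lra.
by rewrite divr_gt0 ?mulr_gt0.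
Qed.

(* The radii are half the differences (b + c - a) / 2; u, v, w and dA, dB, dC are the
   derivatives of the sides and of the angles. *)
Lemma radius_derivative x y z X Y Z g k u v w dX dY dZ :
  sinh x = k * sin X -> sinh y = k * sin Y -> sinh z = k * sin Z ->
  g * dX = sinh x * (u - cos Z * v - cos Y * w) ->
  g * dY = sinh y * (v - cos X * w - cos Z * u) ->
  g * dZ = sinh z * (w - cos Y * u - cos X * v) ->
  g * ((dY + dZ - dX) / 2) = k * cos ((Y + Z - X) / 2) *
    (- sin ((X + Y + Z) / 2) * u + sin ((X + Y - Z) / 2) * v + sin ((Z + X - Y) / 2) * w).
Proof.
move=> sx sy sz hX hY hZ.
have -> : g * ((dY + dZ - dX) / 2) = (g * dY + g * dZ - g * dX) / 2 by ring.
rewrite hX hY hZ sx sy sz.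
have sp t t' : sin t * cos t' = (sin (t + t') + sin (t - t')) / 2 :> R.
  by rewrite sinD sinB; field.
transitivity (- (k * u) * (sin ((X + Y + Z) / 2) * cos ((Y + Z - X) / 2))
  + (k * v) * (sin ((X + Y - Z) / 2) * cos ((Y + Z - X) / 2))
  + (k * w) * (sin ((Z + X - Y) / 2) * cos ((Y + Z - X) / 2))); last by ring.
rewrite !sp.
have -> : (X + Y + Z) / 2 + (Y + Z - X) / 2 = Y + Z by lra.
have -> : (X + Y + Z) / 2 - (Y + Z - X) / 2 = X by lra.
have -> : (X + Y - Z) / 2 + (Y + Z - X) / 2 = Y by lra.
have -> : (X + Y - Z) / 2 - (Y + Z - X) / 2 = X - Z by lra.
have -> : (Z + X - Y) / 2 + (Y + Z - X) / 2 = Z by lra.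
have -> : (Z + X - Y) / 2 - (Y + Z - X) / 2 = X - Y by lra.
rewrite sinD !sinB; ring.
Qed.

(** By [radius_derivative] the derivative of a radius contains the cosine of that radius, so each
    term has the power lam + 1 of a cosine; the weight cancels its dependence on the corner. *)
Lemma hyp_gradient_form lam g u v w dA dB dC : 0 < g ->
  g * dA = sinh a * (u - cos C * v - cos B * w) ->
  g * dB = sinh b * (v - cos A * w - cos C * u) ->
  g * dC = sinh c * (w - cos B * u - cos A * v) ->
  exists2 K, 0 < K &
   cos ((B + C - A) / 2) `^ lam * ((dB + dC - dA) / 2) * (tanh_half a `^ (- (lam + 1)) * u)
   + cos ((C + A - B) / 2) `^ lam * ((dC + dA - dB) / 2) * (tanh_half b `^ (- (lam + 1)) * v)
   + cos ((A + B - C) / 2) `^ lam * ((dA + dB - dC) / 2) * (tanh_half c `^ (- (lam + 1)) * w)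
   = - K * hyp_quad A B C u v w.
Proof.
move=> g0 hA hB hC.
have [[a1 b1] c1] := (a0, b0, c0).
have S := hyp_angle_sum a0 b0 c0 A0 B0 C0 cA cB cC.
have /andP[A1 _] := A0; have /andP[B1 _] := B0; have /andP[C1 _] := C0.
have sA := sin_gt0_pi A0; have sB := sin_gt0_pi B0; have sC := sin_gt0_pi C0.
pose k := sinh a / sin A.
have k0 : 0 < k by rewrite divr_gt0 // sinh_gt0.
have ka : sinh a = k * sin A by rewrite /k divfK // gt_eqF.
have kb : sinh b = k * sin B.
  have := hyp_law_of_sines a0 b0 c0 A0 B0 C0 cA cB cC.
  by rewrite ka => E; apply: (mulfI (lt0r_neq0 sA)); rewrite E; ring.
have kc : sinh c = k * sin C.
  have := hyp_law_of_sines c0 a0 b0 C0 A0 B0 cC cA cB.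
  by rewrite ka => E; apply: (mulfI (lt0r_neq0 sA)); rewrite -E; ring.
have rA := radius_derivative ka kb kc hA hB hC.
have rB := radius_derivative kb kc ka hB hC hA.
have rC := radius_derivative kc ka kb hC hA hB.
have [t t0 [tA tB tC]] := radii_tanh_half.
have pA : 0 < cos ((B + C - A) / 2) by apply: cos_gt0_pihalf; lra.
have pB : 0 < cos ((C + A - B) / 2) by apply: cos_gt0_pihalf; lra.
have pC : 0 < cos ((A + B - C) / 2) by apply: cos_gt0_pihalf; lra.
have ta := tanh_half_gt0 a0; have tb := tanh_half_gt0 b0; have tc := tanh_half_gt0 c0.
(* Here p is the cosine of a radius and q the tanh of the half side; only the common ratio t
   survives. *)
have W p q : 0 < p -> 0 < q -> p = t * q -> p `^ lam * q `^ (- (lam + 1)) * p = t `^ (lam + 1).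
  move=> p0 q0 E; rewrite -[X in _ * X](@powRr1 _ p) ?(ltW p0) // mulrAC -powRD ?(gt_eqF p0) ?implybT //.
  rewrite E powRM ?(ltW t0) ?(ltW q0) // -mulrA -powRD; last by rewrite (gt_eqF q0) implybT.
  by rewrite subrr powRr0 mulr1.
exists (k / g * t `^ (lam + 1)); first by apply: mulr_gt0; [exact: divr_gt0|exact: powR_gt0].
have F p q d u' M : 0 < p -> 0 < q -> p = t * q -> g * d = k * p * M ->
   p `^ lam * d * (q `^ (- (lam + 1)) * u') = k / g * t `^ (lam + 1) * (u' * M).
  move=> p0 q0 E gd; rewrite -(W p q) //.
  have -> : d = k * p * M / g by rewrite -gd mulrC mulKf // gt_eqF.
  by ring.
rewrite (F _ _ _ _ _ pA ta tA rA) (F _ _ _ _ _ pB tb tB rB) (F _ _ _ _ _ pC tc tC rC).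
rewrite /hyp_quad.
have -> : (B + C + A) / 2 = (A + B + C) / 2 by lra.
have -> : (C + A + B) / 2 = (A + B + C) / 2 by lra.
move: (t `^ _) => T; ring.
Qed.

End Radii.
End QuadraticForms.

(** * Combinatorics of a triangulated surface *)

Section Combinatorics.
Variable S : triangulated_surface.
Implicit Types (t : ts_tri S) (s : ts_tri S * 'I_3) (e : 'I_(ts_nedge S)).

Lemma edge_side e : exists s, ts_edge s = e.
Proof.
have : (0 < #|[set s : ts_tri S * 'I_3 | ts_edge s == e]%SET|)%N.
  by rewrite ts_edge_two_sides.
by move=> /card_gt0P[s]; rewrite inE => /eqP; exists s.
Qed.

Lemma edge_partner s : exists s', [/\ s' != s, ts_edge s' = ts_edge s &
  forall s'', ts_edge s'' = ts_edge s -> s'' = s \/ s'' = s'].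
Proof.
have /eqP := ts_edge_two_sides (ts_edge s); case/cards2P => a [b [ab E]].
have H s'' : (ts_edge s'' == ts_edge s) = (s'' == a) || (s'' == b).
  by have := congr1 (fun A : {set _} => s'' \in A) E; rewrite !inE.
have := H s; rewrite eqxx => /esym/orP[/eqP sa|/eqP sb].
  exists b; split; [by rewrite sa eq_sym|by apply/eqP; rewrite H eqxx orbT|].
  by move=> s'' /eqP; rewrite H sa => /orP[] /eqP ->; [left|right].
exists a; split; [by rewrite sb|by apply/eqP; rewrite H eqxx|].
by move=> s'' /eqP; rewrite H sb => /orP[] /eqP ->; [right|left].
Qed.

Lemma sum_two_sides (V : nmodType) (X : ts_tri S * 'I_3 -> V) s s' :
  s' != s -> ts_edge s' = ts_edge s ->
  \sum_(c | ts_edge c == ts_edge s) X c = X s + X s'.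
Proof.
move=> ss' es'.
have [p [ps ep up]] := edge_partner s.
have -> : s' = p by have [E|//] := up s' es'; rewrite E eqxx in ss'.
rewrite (bigD1 s) ?eqxx //=; congr (_ + _).
rewrite (big_pred1 p) // => c /=.
have [->|cs] := eqVneq c s; first by rewrite andbF eq_sym (negbTE ps).
rewrite andbT; apply/eqP/eqP => [/up[E|//]|->//].
by rewrite E eqxx in cs.
Qed.

(** Turns a pairing over the edges into a sum over triangles, to which the quadratic forms apply. *)
Lemma sum_edges_sides (R : comPzRingType) (X : ts_tri S * 'I_3 -> R) (w : 'I_(ts_nedge S) -> R) :
  \sum_e (\sum_(c | ts_edge c == e) X c) * w e =
  \sum_t \sum_i X (t, i) * w (ts_edge (t, i)).
Proof.
rewrite pair_big /=.
rewrite [RHS](eq_bigr (fun c => X c * w (ts_edge c))); last by case.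
rewrite [RHS](partition_big (@ts_edge S) xpredT) //=.
apply: eq_bigr => e _; rewrite mulr_suml; apply: eq_bigr => c /eqP ->.
by [].
Qed.

Lemma edges_connected (P : 'I_(ts_nedge S) -> Prop) e0 : P e0 ->
  (forall t i j, P (ts_edge (t, i)) -> P (ts_edge (t, j))) -> forall e, P e.
Proof.
move=> P0 H e.
have [[t0 i0] e0E] := edge_side e0; have [[t i] eE] := edge_side e.
have /connectP[p pp tE] := ts_connected t0 t.
have H0 : forall j, P (ts_edge (t0, j)) by move=> j; apply: (H _ i0); rewrite e0E.
suff Ht : forall j, P (ts_edge (t, j)) by rewrite -eE.
rewrite tE; elim: p t0 pp H0 {tE e0E} => [//|u p IH] t0 /= /andP[/existsP[a /existsP[b /eqP ab]] pp] H0.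
by apply: IH pp _ => j; apply: (H _ b); rewrite -ab.
Qed.

Lemma edge_exists : exists e : 'I_(ts_nedge S), True.
Proof.
have /card_gt0P[t _] := ts_nonempty S.
by exists (ts_edge (t, 0)).
Qed.

(** The two sides of the i-th edge are the entry of triangle i and the exit of triangle i - 1; a
    cyclic shift of the exits regroups the sum by triangles. *)
Lemma cycle_sum_sides (R : realType) (c : edge_cycle S) (z : 'rV[R]_(ts_nedge S))
    (X : ts_tri S * 'I_3 -> R) :
  (forall e, z 0 e = \sum_(s | ts_edge s == e) X s) ->
  cycle_sum c z = \sum_i (X (ec_tri i, @ec_in _ c i) + X (ec_tri i, @ec_out _ c i)).
Proof.
move=> zX; rewrite /cycle_sum big_split /=.
rewrite [X in _ + X](reindex_inj (@ord_pred_inj _)) /= -big_split /=.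
apply: eq_bigr => i _; rewrite zX.
have e1 := ec_same_edge (e := c) (ord_pred i); have e2 := ec_two_sides (e := c) (ord_pred i).
rewrite ord_predK in e1 e2.
exact: sum_two_sides.
Qed.

End Combinatorics.

(** * Derivatives of angles and curvatures *)

Section SmoothCurvature.
Variable R : realType.
Variable S : triangulated_surface.
Local Notation E := ('rV[R]_(ts_nedge S)).
Implicit Types (l v : E) (s : ts_tri S * 'I_3) (t : ts_tri S) (e : 'I_(ts_nedge S)).

Lemma near_gt (V : normedModType R) (f : V -> R) x c : {for x, continuous f} ->
  c < f x -> \forall y \near x, c < f y.
Proof. by move=> cf H; exact: (cvgr_gt _ cf). Qed.

Lemma near_lt (V : normedModType R) (f : V -> R) x c : {for x, continuous f} ->
  f x < c -> \forall y \near x, f y < c.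
Proof. by move=> cf H; exact: (cvgr_lt _ cf). Qed.

Definition pos_lengths : set E := [set l : E | forall e, 0 < l 0 e].

Lemma open_pos_lengths : open pos_lengths.
Proof.
rewrite openE => l l0.
have : \forall y \near l, forall e, 0 < (y : E) 0 e.
  apply: near_forall => e; exact: (near_gt (@coord_continuous _ _ _ _ _ _) (l0 e)).
exact.
Qed.

Section Model.
Variables (K : geometry R) (kcos : R -> R -> R -> R).
Hypothesis Kcos : cosine_law K kcos.
Hypothesis Ksm : forall k s, Cs k pos_lengths (fun l : E => corner_cos kcos l s).

Local Notation P := (polyhedral_metric K S).
Local Notation ang := (inner_angle K).

Lemma metric_pos l : P l -> pos_lengths l.
Proof. by case/(polyhedral_metricP Kcos). Qed.

Lemma corner_cos_bound l s : P l -> -1 < corner_cos kcos l s < 1.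
Proof. by case/(polyhedral_metricP Kcos) => _; apply. Qed.

Lemma ang_bound l s : P l -> 0 < ang l s < pi.
Proof.
move=> Pl; have := corner_cos_bound s Pl => /andP[c1 c2].
by rewrite (inner_angleE Kcos) // acos_gt0 ?acos_ltpi ?c1 ?c2 ?ltW.
Qed.

Lemma cos_ang l s : P l -> cos (ang l s) = corner_cos kcos l s.
Proof.
move=> Pl; have := corner_cos_bound s Pl => /andP[c1 c2].
by rewrite (inner_angleE Kcos) // acosK // in_itv /= !ltW.
Qed.

(** The criterion by which limits of metrics are shown to be metrics with the limit angles. *)
Lemma metric_of_angles l (th : ts_tri S * 'I_3 -> R) : pos_lengths l ->
  (forall s, 0 < th s < pi) -> (forall s, corner_cos kcos l s = cos (th s)) ->
  P l /\ forall s, ang l s = th s.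
Proof.
move=> l0 th0 cc; have p0 := @pi_ge0 R.
have Pl : P l.
  apply/(polyhedral_metricP Kcos); split=> // s; rewrite cc.
  have /andP[t1 t2] := th0 s.
  have h1 : cos (th s) < cos 0 by rewrite ltr_cos // in_itv /= ?lexx ?p0 ?(ltW t1) ?(ltW t2).
  have h2 : cos pi < cos (th s) by rewrite ltr_cos // in_itv /= ?lexx ?p0 ?(ltW t1) ?(ltW t2).
  by rewrite -{2}(@cos0 R) h1 -(@cospi R) h2.
split=> // s; rewrite (inner_angleE Kcos) // cc cosK // in_itv /=.
by have /andP[t1 t2] := th0 s; rewrite !ltW.
Qed.

Lemma open_metric : open P.
Proof.
rewrite openE => l Pl.
have H1 : \forall y \near l, pos_lengths y.
  by apply: open_nbhs_nbhs; split; [exact: open_pos_lengths|exact: metric_pos].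
have H2 : \forall y \near l, forall s, -1 < corner_cos kcos y s < 1.
  apply: near_forall => s.
  have cc : {for l, continuous (fun l : E => corner_cos kcos l s)}.
    exact: (Cs_continuous (Ksm 0 s) (metric_pos Pl)).
  have /andP[c1 c2] := corner_cos_bound s Pl.
  by apply: (nearS2 (near_gt cc c1) (near_lt cc c2)) => y -> ->.
by apply: (nearS2 H1 H2) => y y1 y2; apply/(polyhedral_metricP Kcos).
Qed.

Lemma Cs_ang k s : Cs k P (fun l => ang l s).
Proof.
apply: (@Cs_eq _ _ k P (fun l => acos (corner_cos kcos l s)) _ open_metric).
  by move=> l Pl; rewrite (inner_angleE Kcos).
apply: Cs_acos; first exact: open_metric.
  by move=> l; exact: corner_cos_bound.
by apply: (Cs_sub _ (Ksm k s)) => l; exact: metric_pos.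
Qed.

Lemma ang_differentiable l s : P l -> differentiable (fun l => ang l s) l.
Proof. by move=> Pl; exact: (Cs_ang 1 s).1. Qed.

Lemma PhiE lam l e : Phi K lam l 0 e =
  \sum_(c | ts_edge c == e) angle_integral lam (ang l c).
Proof. by rewrite mxE. Qed.

Lemma Cs_Phi lam k e : Cs k P (fun l => Phi K lam l 0 e).
Proof.
apply: (@Cs_eq _ _ k P (fun l => \sum_(c | ts_edge c == e) angle_integral lam (ang l c)) _ open_metric).
  by move=> l _; rewrite PhiE.
apply: Cs_sum => [|s _]; first exact: open_metric.
apply: Cs_angle_integral; [exact: open_metric|by move=> l; exact: ang_bound|exact: Cs_ang].
Qed.

Lemma derive_sum_pred (f df : ts_tri S * 'I_3 -> E -> R) l v (p : pred (ts_tri S * 'I_3)) :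
  (forall c, differentiable (f c) l) ->
  'D_v (fun x => \sum_(c | p c) f c x) l = \sum_(c | p c) 'D_v (f c) l.
Proof.
move=> df'.
have H (r : seq (ts_tri S * 'I_3)) : is_derive l v (fun x => \sum_(c <- r | p c) f c x)
    (\sum_(c <- r | p c) 'D_v (f c) l).
  elim: r => [|c r IH].
    have -> : (fun x : E => \sum_(c <- [::] | p c) f c x) = cst 0.
      by apply/funext => x; rewrite big_nil.
    by rewrite big_nil; exact: is_derive_cst.
  have -> : (fun x : E => \sum_(c <- c :: r | p c) f c x) =
     (fun x => (if p c then f c x else 0) + \sum_(c <- r | p c) f c x).
    by apply/funext => x; rewrite big_cons; case: (p c); rewrite ?add0r.
  rewrite big_cons; case: (p c).
    apply: is_deriveD; apply/derivableP/diff_derivable/df'.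
  have -> : (fun x : E => 0 + \sum_(c <- r | p c) f c x) = (fun x => \sum_(c <- r | p c) f c x).
    by apply/funext => x; rewrite add0r.
  exact: IH.
by have h := H (index_enum _); rewrite derive_val.
Qed.

Lemma derive_Phi lam l v e : P l ->
  'D_v (fun l => Phi K lam l 0 e) l =
  \sum_(c | ts_edge c == e) sin (ang l c) `^ lam * 'D_v (fun l => ang l c) l.
Proof.
move=> Pl.
have H c : differentiable (fun l => angle_integral lam (ang l c)) l /\
   'D_v (fun l => angle_integral lam (ang l c)) l = sin (ang l c) `^ lam * 'D_v (fun l => ang l c) l.
  apply: (@derive_comp1 _ _ (angle_integral lam)); first exact: ang_differentiable.
  by apply: is_derive_angle_integral; exact: ang_bound.
have -> : (fun l => Phi K lam l 0 e) =
    (fun l => \sum_(c | ts_edge c == e) angle_integral lam (ang l c)).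
  by apply/funext => x; rewrite PhiE.
rewrite (@derive_sum_pred (fun c l => angle_integral lam (ang l c))) //.
  by apply: eq_bigr => c _; exact: (H c).2.
by move=> c; exact: (H c).1.
Qed.

(** Kept for both geometries, since [Phi] is later studied through the Euclidean [Psi]. *)
Definition radius l s := (ang l (s.1, ordS s.2) + ang l (s.1, ord_pred s.2) - ang l s) / 2.

(** A weak inequality, to cover equality in the Euclidean and strictness in the hyperbolic case. *)
Hypothesis Ksum : forall l t i, P l ->
  ang l (t, i) + ang l (t, ordS i) + ang l (t, ord_pred i) <= pi.

Lemma radius_bound l s : P l -> - (pi / 2) < radius l s < pi / 2.
Proof.
case: s => t i Pl; have := Ksum t i Pl; rewrite /radius /=.
have := ang_bound (t, i) Pl; have := ang_bound (t, ordS i) Pl; have := ang_bound (t, ord_pred i) Pl.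
by lra.
Qed.

Lemma PsiE lam l e : P l -> Psi K lam l 0 e =
  \sum_(c | ts_edge c == e) angle_integral lam (radius l c + pi / 2).
Proof.
move=> Pl; rewrite mxE; apply: eq_bigr => c _.
by rewrite -cos_integralE //; exact: radius_bound.
Qed.

Lemma Cs_radius k s : Cs k P (fun l => radius l s).
Proof.
have oP := open_metric.
apply: (CsM oP) (Cs_cst _ _ _); apply: (CsB oP); last exact: Cs_ang.
by apply: (CsD oP); exact: Cs_ang.
Qed.

Lemma Cs_Psi lam k e : Cs k P (fun l => Psi K lam l 0 e).
Proof.
have oP := open_metric.
apply: (@Cs_eq _ _ k P (fun l => \sum_(c | ts_edge c == e) angle_integral lam (radius l c + pi / 2)) _ oP).
  by move=> l Pl; rewrite PsiE.
apply: Cs_sum => // s _; apply: Cs_angle_integral => //.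
  by move=> l Pl; have := radius_bound s Pl; lra.
by apply: (CsD oP (Cs_radius k s)); exact: Cs_cst.
Qed.

Lemma derive_radius l v s : P l -> 'D_v (fun l => radius l s) l =
  ('D_v (fun l => ang l (s.1, ordS s.2)) l + 'D_v (fun l => ang l (s.1, ord_pred s.2)) l
    - 'D_v (fun l => ang l s) l) / 2.
Proof.
move=> Pl.
have H c : is_derive l v (fun l => ang l c) ('D_v (fun l => ang l c) l).
  by apply/derivableP/diff_derivable/ang_differentiable.
have H2 := is_deriveB (is_deriveD (H (s.1, ordS s.2)) (H (s.1, ord_pred s.2))) (H s).
have := @is_deriveM _ _ _ (cst (2^-1 : R)) l v _ _ H2 (is_derive_cst _ _ _).
rewrite scaler0 add0r => H3.
by have [_ EE] := H3; rewrite [RHS]mulrC; exact: EE.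
Qed.

Lemma derive_Psi lam l v e : P l ->
  'D_v (fun l => Psi K lam l 0 e) l =
  \sum_(c | ts_edge c == e) cos (radius l c) `^ lam * 'D_v (fun l => radius l c) l.
Proof.
move=> Pl.
have H c : differentiable (fun l => angle_integral lam (radius l c + pi / 2)) l /\
   'D_v (fun l => angle_integral lam (radius l c + pi / 2)) l
   = cos (radius l c) `^ lam * 'D_v (fun l => radius l c) l.
  have D : is_derive (radius l c) 1 (fun x => angle_integral lam (x + pi / 2)) (cos (radius l c) `^ lam).
    apply: is_derive_shiftl; rewrite -sinDpihalf.
    by apply: is_derive_angle_integral; have := radius_bound c Pl; lra.
  apply: (@derive_comp1 _ _ (fun x => angle_integral lam (x + pi / 2)) _ (fun l => radius l c)) => //.
  exact: (Cs_radius 1 c).1.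
rewrite (_ : 'D_v _ l =  'D_v (fun l => \sum_(c | ts_edge c == e) angle_integral lam (radius l c + pi / 2)) l).
  rewrite (@derive_sum_pred (fun c l => angle_integral lam (radius l c + pi / 2))) //.
    by apply: eq_bigr => c _; exact: (H c).2.
  by move=> c; exact: (H c).1.
apply: near_eq_derive.
by apply: (open_near open_metric Pl) => x Px; rewrite PsiE.
Qed.

End Model.
End SmoothCurvature.

(** * Derivatives of the angles with respect to the lengths *)

Section AngleDerivatives.
Variable R : realType.
Variable S : triangulated_surface.
Local Notation E := ('rV[R]_(ts_nedge S)).
Implicit Types (l v : E) (s : ts_tri S * 'I_3) (t : ts_tri S) (e : 'I_(ts_nedge S)).
Local Notation PE := (polyhedral_metric (euclidean_plane R) S).
Local Notation PH := (polyhedral_metric (hyperbolic_plane R) S).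
Local Notation angE := (inner_angle (euclidean_plane R)).
Local Notation angH := (inner_angle (hyperbolic_plane R)).
Local Notation Ecos := (@euclidean_cosine_law R).
Local Notation Hcos := (@hyperbolic_cosine_law R).

Lemma Cs_euclid_cos k s : Cs k (@pos_lengths R S) (fun l : E => corner_cos (@euclid_cos R) l s).
Proof.
have oP := @open_pos_lengths R S.
have c e : Cs k (@pos_lengths R S) (fun l => l 0 e) by exact: Cs_coord.
have c2 e : Cs k (@pos_lengths R S) (fun l => l 0 e ^+ 2).
  by apply: (Cs_eq oP) (CsM oP (c e) (c e)) => x _; rewrite expr2.
apply: (CsM oP); first by apply: (CsB oP) => //; exact: (CsD oP).
apply: (Cs_inv oP).
  move=> x x0; have a0 := x0 (ts_edge (s.1, ordS s.2)); have b0 := x0 (ts_edge (s.1, ord_pred s.2)).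
  by rewrite gt_eqF // !mulr_gt0.
by apply: (CsM oP) => //; apply: (CsM oP) => //; exact: Cs_cst.
Qed.

Lemma Cs_hyp_cos k s : Cs k (@pos_lengths R S) (fun l : E => corner_cos (@hyp_cos R) l s).
Proof.
have oP := @open_pos_lengths R S.
have cx e : Cs k (@pos_lengths R S) (fun l => expR (l 0 e)) by apply: (Cs_expR oP); exact: Cs_coord.
have cn e : Cs k (@pos_lengths R S) (fun l => expR (- l 0 e)).
  by apply: (Cs_expR oP); apply: (CsN oP); exact: Cs_coord.
have cc e : Cs k (@pos_lengths R S) (fun l => cosh (l 0 e)).
  by apply: (CsM oP); [exact: (CsD oP)|exact: Cs_cst].
have cs e : Cs k (@pos_lengths R S) (fun l => sinh (l 0 e)).
  by apply: (CsM oP); [exact: (CsB oP)|exact: Cs_cst].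
apply: (CsM oP); first by apply: (CsB oP) => //; exact: (CsM oP).
apply: (Cs_inv oP); last exact: (CsM oP).
move=> x x0; have a0 := x0 (ts_edge (s.1, ordS s.2)); have b0 := x0 (ts_edge (s.1, ord_pred s.2)).
by apply: mulf_neq0; apply/lt0r_neq0/sinh_gt0.
Qed.

Section CornerData.
Variables (K : geometry R) (kcos : R -> R -> R -> R).
Hypothesis Kcos : cosine_law K kcos.

Lemma corner_data l t i : polyhedral_metric K S l ->
  [/\ cos (inner_angle K l (t, i)) =
        kcos (l 0 (ts_edge (t, i))) (l 0 (ts_edge (t, ordS i))) (l 0 (ts_edge (t, ord_pred i))),
      cos (inner_angle K l (t, ordS i)) =
        kcos (l 0 (ts_edge (t, ordS i))) (l 0 (ts_edge (t, ord_pred i))) (l 0 (ts_edge (t, i))) &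
      cos (inner_angle K l (t, ord_pred i)) =
        kcos (l 0 (ts_edge (t, ord_pred i))) (l 0 (ts_edge (t, i))) (l 0 (ts_edge (t, ordS i)))].
Proof.
by move=> Pl; split; rewrite (cos_ang Kcos) // /corner_cos /= ?ord3E.
Qed.
End CornerData.

Lemma euclid_ang_sum l t i : PE l ->
  angE l (t, i) + angE l (t, ordS i) + angE l (t, ord_pred i) = pi.
Proof.
move=> Pl; have [cA cB cC] := corner_data Ecos t i Pl.
have l0 := metric_pos Ecos Pl.
by apply: (euclid_angle_sum (l0 _) (l0 _) (l0 _)) cA cB cC; exact: (ang_bound Ecos).
Qed.

Lemma hyp_ang_sum l t i : PH l ->
  angH l (t, i) + angH l (t, ordS i) + angH l (t, ord_pred i) < pi.
Proof.
move=> Pl; have [cA cB cC] := corner_data Hcos t i Pl.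
have l0 := metric_pos Hcos Pl.
by apply: (hyp_angle_sum (l0 _) (l0 _) (l0 _)) cA cB cC; exact: (ang_bound Hcos).
Qed.

Lemma hyp_ang_sum_le l t i : PH l ->
  angH l (t, i) + angH l (t, ordS i) + angH l (t, ord_pred i) <= pi.
Proof. by move=> Pl; rewrite ltW // hyp_ang_sum. Qed.

Lemma is_derive_coordv l v e : is_derive l v (fun x : E => x 0 e) (v 0 e).
Proof.
apply: DeriveDef; last exact: derive_coord.
exact/diff_derivable/differentiable_coord.
Qed.

Lemma is_derive_comp (h : R -> R) dh (f : E -> R) l v df : differentiable f l ->
  is_derive l v f df -> is_derive (f l) 1 h dh -> is_derive l v (fun x => h (f x)) (dh * df).
Proof.
move=> dfl [_ <-] Hh; have [H1 H2] := @derive_comp1 _ _ h dh f l v dfl Hh.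
by apply: DeriveDef => //; exact: diff_derivable.
Qed.

Lemma is_derive_cos_ang (K : geometry R) kcos (Kcos : cosine_law K kcos)
    (Ksm : forall k s, Cs k (@pos_lengths R S) (fun l : E => corner_cos kcos l s)) l v s :
  polyhedral_metric K S l ->
  is_derive l v (fun x => cos (inner_angle K x s))
    (- sin (inner_angle K l s) * 'D_v (fun x => inner_angle K x s) l).
Proof.
move=> Pl; have d := ang_differentiable Kcos Ksm s Pl.
apply: is_derive_comp => //.
exact/derivableP/diff_derivable.
Qed.

Lemma is_derive_near_unique (f g : E -> R) l v df dg : (\near l, f l = g l) ->
  is_derive l v f df -> is_derive l v g dg -> df = dg.
Proof.
by move=> fg [_ <-] [_ <-]; exact: near_eq_derive.
Qed.

Lemma is_deriveM' (f g : E -> R) l v df dg : is_derive l v f df -> is_derive l v g dg ->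
  is_derive l v (fun x => f x * g x) (f l * dg + g l * df).
Proof. by move=> Hf Hg; exact: (is_deriveM Hf Hg). Qed.

Lemma is_deriveD' (f g : E -> R) l v df dg : is_derive l v f df -> is_derive l v g dg ->
  is_derive l v (fun x => f x + g x) (df + dg).
Proof. by move=> Hf Hg; exact: (is_deriveD Hf Hg). Qed.

Lemma is_deriveB' (f g : E -> R) l v df dg : is_derive l v f df -> is_derive l v g dg ->
  is_derive l v (fun x => f x - g x) (df - dg).
Proof. by move=> Hf Hg; exact: (is_deriveB Hf Hg). Qed.

(** Differentiation of 2 b c cos A = b^2 + c^2 - a^2, which holds on the open set of metrics; the
    law of sines removes sin A. *)
Lemma euclid_ang_derivative l v t i k : PE l ->
  sin (angE l (t, i)) = k * l 0 (ts_edge (t, i)) ->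
  k * l 0 (ts_edge (t, ordS i)) * l 0 (ts_edge (t, ord_pred i)) *
    'D_v (fun x => angE x (t, i)) l =
  v 0 (ts_edge (t, i)) - cos (angE l (t, ord_pred i)) * v 0 (ts_edge (t, ordS i))
   - cos (angE l (t, ordS i)) * v 0 (ts_edge (t, ord_pred i)).
Proof.
move=> Pl sA.
have X e := is_derive_coordv l v e.
have [cA cB cC] := corner_data Ecos t i Pl.
have l0 := metric_pos Ecos Pl.
have dc := is_derive_cos_ang Ecos Cs_euclid_cos v (t, i) Pl.
have F := is_deriveM' dc (is_deriveM' (X (ts_edge (t, ordS i))) (X (ts_edge (t, ord_pred i)))).
have G := is_deriveB' (is_deriveD'
  (is_deriveM' (X (ts_edge (t, ordS i))) (X (ts_edge (t, ordS i))))
  (is_deriveM' (X (ts_edge (t, ord_pred i))) (X (ts_edge (t, ord_pred i)))))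
  (is_deriveM' (X (ts_edge (t, i))) (X (ts_edge (t, i)))).
have {}F := is_deriveM' (@is_derive_cst _ _ _ (2 : R) l v) F.
have FG : \near l, cst (2 : R) l * (cos (angE l (t, i)) * (l 0 (ts_edge (t, ordS i)) * l 0 (ts_edge (t, ord_pred i))))
   = l 0 (ts_edge (t, ordS i)) * l 0 (ts_edge (t, ordS i)) +
     l 0 (ts_edge (t, ord_pred i)) * l 0 (ts_edge (t, ord_pred i)) -
     l 0 (ts_edge (t, i)) * l 0 (ts_edge (t, i)).
  apply: (open_near (open_metric Ecos Cs_euclid_cos) Pl) => x Px.
  have [-> _ _] := corner_data Ecos t i Px.
  have x0 := metric_pos Ecos Px.
  by rewrite /euclid_cos /=; field; rewrite !gt_eqF.
have := is_derive_near_unique FG F G.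
rewrite sA cB cC; move: cA; rewrite /euclid_cos.
move: (l0 (ts_edge (t, i))) (l0 (ts_edge (t, ordS i))) (l0 (ts_edge (t, ord_pred i))).
move: (l 0 (ts_edge (t, i))) (l 0 (ts_edge (t, ordS i))) (l 0 (ts_edge (t, ord_pred i))) => a b c a0 b0 c0.
set dA := 'D_v _ l => -> /=; rewrite mulr0 addr0 => H.
apply: (mulfI (lt0r_neq0 a0)); apply: (mulfI (_ : (-2 : R) != 0)).
  by rewrite oppr_eq0 pnatr_eq0.
transitivity (2 * (((b ^+ 2 + c ^+ 2 - a ^+ 2) / (2 * b * c)) *
     (b * v 0 (ts_edge (t, ord_pred i)) + c * v 0 (ts_edge (t, ordS i))) + b * c * (- (k * a) * dA))
   - 2 * (((b ^+ 2 + c ^+ 2 - a ^+ 2) / (2 * b * c)) *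
     (b * v 0 (ts_edge (t, ord_pred i)) + c * v 0 (ts_edge (t, ordS i))))); first by ring.
by rewrite H; field; rewrite !gt_eqF.
Qed.

(** Differentiation of cos A sinh b sinh c = cosh b cosh c - cosh a. The factor [g] is the same at
    the three corners by [hyp_sines]. *)
Lemma hyp_ang_derivative l v t i g : PH l ->
  sin (angH l (t, i)) * (sinh (l 0 (ts_edge (t, ordS i))) * sinh (l 0 (ts_edge (t, ord_pred i)))) = g ->
  g * 'D_v (fun x => angH x (t, i)) l =
  sinh (l 0 (ts_edge (t, i))) *
   (v 0 (ts_edge (t, i)) - cos (angH l (t, ord_pred i)) * v 0 (ts_edge (t, ordS i))
   - cos (angH l (t, ordS i)) * v 0 (ts_edge (t, ord_pred i))).
Proof.
move=> Pl <-.
have X e := is_derive_coordv l v e.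
have C e : is_derive l v (fun x : E => cosh (x 0 e)) (sinh (l 0 e) * v 0 e).
  apply: is_derive_comp => //; [exact: differentiable_coord|exact: is_derive_cosh].
have D e : is_derive l v (fun x : E => sinh (x 0 e)) (cosh (l 0 e) * v 0 e).
  apply: is_derive_comp => //; [exact: differentiable_coord|exact: is_derive_sinh].
have [cA cB cC] := corner_data Hcos t i Pl.
have l0 := metric_pos Hcos Pl.
have dc := is_derive_cos_ang Hcos Cs_hyp_cos v (t, i) Pl.
have F := is_deriveM' dc (is_deriveM' (D (ts_edge (t, ordS i))) (D (ts_edge (t, ord_pred i)))).
have G := is_deriveB' (is_deriveM' (C (ts_edge (t, ordS i))) (C (ts_edge (t, ord_pred i))))
  (C (ts_edge (t, i))).
have FG : \near l, cos (angH l (t, i)) * (sinh (l 0 (ts_edge (t, ordS i))) * sinh (l 0 (ts_edge (t, ord_pred i))))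
   = cosh (l 0 (ts_edge (t, ordS i))) * cosh (l 0 (ts_edge (t, ord_pred i))) - cosh (l 0 (ts_edge (t, i))).
  apply: (open_near (open_metric Hcos Cs_hyp_cos) Pl) => x Px.
  have [-> _ _] := corner_data Hcos t i Px.
  have x0 := metric_pos Hcos Px.
  have := sinh_gt0 (x0 (ts_edge (t, ordS i))); have := sinh_gt0 (x0 (ts_edge (t, ord_pred i))).
  rewrite /hyp_cos; move: (sinh _) (sinh _) (cosh _) (cosh _) => p q m n p0 q0.
  by field; rewrite !gt_eqF.
have := is_derive_near_unique FG F G.
have HA := cA; move: cA cB cC; rewrite /hyp_cos.
have := sinh_gt0 (l0 (ts_edge (t, i))); have := sinh_gt0 (l0 (ts_edge (t, ordS i))); have := sinh_gt0 (l0 (ts_edge (t, ord_pred i))).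
have := cosh2 (l 0 (ts_edge (t, i))); have := cosh2 (l 0 (ts_edge (t, ordS i))); have := cosh2 (l 0 (ts_edge (t, ord_pred i))).
move: (sinh (l 0 (ts_edge (t, i)))) (sinh (l 0 (ts_edge (t, ordS i)))) (sinh (l 0 (ts_edge (t, ord_pred i)))).
move: (cosh (l 0 (ts_edge (t, i)))) (cosh (l 0 (ts_edge (t, ordS i)))) (cosh (l 0 (ts_edge (t, ord_pred i)))).
move=> ca cb cc sa sb sc hc hb ha sc0 sb0 sa0 -> -> ->.
set dA := 'D_v _ l; set sA := sin _; set vc := v 0 _; set vb := v 0 _; set va := v 0 _ => H.
have nza : sa != 0 by rewrite gt_eqF.
have nzb : sb != 0 by rewrite gt_eqF.
have nzc : sc != 0 by rewrite gt_eqF.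
apply: oppr_inj.
transitivity (((cb * cc - ca) / (sb * sc) * (sb * (cc * vc) + sc * (cb * vb)) + sb * sc * (- sA * dA))
   - (cb * cc - ca) / (sb * sc) * (sb * (cc * vc) + sc * (cb * vb))); first by ring.
rewrite H.
transitivity ((cc * sb ^+ 2 - cb * (cb * cc - ca)) / sb * vb
  + (cb * sc ^+ 2 - cc * (cb * cc - ca)) / sc * vc - sa * va).
  by field; rewrite nzb nzc.
have -> : sb ^+ 2 = cb ^+ 2 - 1 by rewrite hb; ring.
have -> : sc ^+ 2 = cc ^+ 2 - 1 by rewrite hc; ring.
by field; rewrite nza nzb nzc.
Qed.

End AngleDerivatives.

(** * Definiteness of the pairings and openness of the image of Psi *)

Section Gradients.
Variable R : realType.
Variable S : triangulated_surface.
Local Notation E := ('rV[R]_(ts_nedge S)).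
Implicit Types (l v : E) (s : ts_tri S * 'I_3) (t : ts_tri S) (e : 'I_(ts_nedge S)).
Local Notation PE := (polyhedral_metric (euclidean_plane R) S).
Local Notation PH := (polyhedral_metric (hyperbolic_plane R) S).
Local Notation angE := (inner_angle (euclidean_plane R)).
Local Notation angH := (inner_angle (hyperbolic_plane R)).
Local Notation Ecos := (@euclidean_cosine_law R).
Local Notation Hcos := (@hyperbolic_cosine_law R).

Lemma euclid_ang_sines l t i : PE l -> exists2 k, 0 < k &
  [/\ sin (angE l (t, i)) = k * l 0 (ts_edge (t, i)),
      sin (angE l (t, ordS i)) = k * l 0 (ts_edge (t, ordS i)) &
      sin (angE l (t, ord_pred i)) = k * l 0 (ts_edge (t, ord_pred i))].
Proof.
move=> Pl; have l0 := metric_pos Ecos Pl; have [cA cB cC] := corner_data Ecos t i Pl.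
by apply: (euclid_sines (l0 _) (l0 _) (l0 _)) cA cB cC; exact: (ang_bound Ecos).
Qed.

(** With sin A = k a, the powers of the side coming from the sine, from the angle derivative and
    from the weight cancel, leaving the factor k^lam / (k a b c) common to the corners. *)
Lemma euclid_triangle_form lam l v t i : PE l -> exists2 K, 0 < K &
  \sum_j sin (angE l (t, j)) `^ lam * 'D_v (fun x => angE x (t, j)) l *
     (l 0 (ts_edge (t, j)) `^ (- (lam + 1)) * v 0 (ts_edge (t, j)))
  = K * ((v 0 (ts_edge (t, i)) - cos (angE l (t, ord_pred i)) * v 0 (ts_edge (t, ordS i))
     - cos (angE l (t, ordS i)) * v 0 (ts_edge (t, ord_pred i))) ^+ 2
     + (sin (angE l (t, ord_pred i)) * v 0 (ts_edge (t, ordS i))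
        - sin (angE l (t, ordS i)) * v 0 (ts_edge (t, ord_pred i))) ^+ 2).
Proof.
move=> Pl; have l0 := metric_pos Ecos Pl.
have [k k0 [sA sB sC]] := euclid_ang_sines t i Pl.
have dA := @euclid_ang_derivative _ _ l v t i k Pl sA.
have dB := @euclid_ang_derivative _ _ l v t (ordS i) k Pl sB.
have dC := @euclid_ang_derivative _ _ l v t (ord_pred i) k Pl sC.
rewrite !ord3E in dB dC.
have sum := euclid_ang_sum t i Pl.
have a0 := l0 (ts_edge (t, i)); have b0 := l0 (ts_edge (t, ordS i)); have c0 := l0 (ts_edge (t, ord_pred i)).
move: a0 b0 c0 sA sB sC dA dB dC.
rewrite (ord3_sum _ i).
set a := l 0 (ts_edge (t, i)); set b := l 0 (ts_edge (t, ordS i)); set c := l 0 (ts_edge (t, ord_pred i)).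
move=> a0 b0 c0 sA sB sC dA dB dC.
exists (k `^ lam / (k * a * b * c)); first by rewrite divr_gt0 ?powR_gt0 // !mulr_gt0.
have W x X d u M : 0 < x -> X = k * x -> k * a * b * c * d = x * M ->
   X `^ lam * d * (x `^ (- (lam + 1)) * u) = k `^ lam / (k * a * b * c) * (u * M).
  move=> x0 -> E1; rewrite powRM ?(ltW k0) ?(ltW x0) //.
  have -> : d = x * M / (k * a * b * c).
    by rewrite -E1 mulrC mulKf // gt_eqF // !mulr_gt0.
  have xx : x `^ lam * x `^ (- (lam + 1)) * x = 1.
    rewrite -[X in _ * X](@powRr1 _ x) ?(ltW x0) // -powRD ?(gt_eqF x0) ?implybT //.
    rewrite -powRD ?(gt_eqF x0) ?implybT //.
    by rewrite (_ : lam + - (lam + 1) + 1 = 0) ?powRr0 //; ring.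
  transitivity (k `^ lam / (k * a * b * c) * (u * M) * (x `^ lam * x `^ (- (lam + 1)) * x)).
    by ring.
  by rewrite xx mulr1.
rewrite -(euclid_quadE _ _ _ sum) [RHS]mulrDr [X in _ = X + _]mulrDr.
congr (_ + _ + _); apply: W => //.
- by rewrite -dA; ring.
- by rewrite -dB; ring.
- by rewrite -dC; ring.
Qed.

(** The derivative of the coordinate l_e ^ (- lam) along v, divided by - lam; it is constant along
    segments in these coordinates. *)
Definition Phi_weight lam l v e := l 0 e `^ (- (lam + 1)) * v 0 e.

Lemma Phi_gradient_ge0 lam l v : PE l ->
  0 <= \sum_e 'D_v (fun x => Phi (euclidean_plane R) lam x 0 e) l * Phi_weight lam l v e /\
  (\sum_e 'D_v (fun x => Phi (euclidean_plane R) lam x 0 e) l * Phi_weight lam l v e = 0 ->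
   exists c, v = c *: l).
Proof.
move=> Pl; have l0 := metric_pos Ecos Pl.
pose F t := \sum_j sin (angE l (t, j)) `^ lam * 'D_v (fun x => angE x (t, j)) l *
     (l 0 (ts_edge (t, j)) `^ (- (lam + 1)) * v 0 (ts_edge (t, j))).
have -> : \sum_e 'D_v (fun x => Phi (euclidean_plane R) lam x 0 e) l * Phi_weight lam l v e
    = \sum_t F t.
  under eq_bigr => e _ do rewrite (derive_Phi Ecos (@Cs_euclid_cos R S)) //.
  exact: (sum_edges_sides (fun c => sin (angE l c) `^ lam * 'D_v (fun x => angE x c) l)).
have F0 t : 0 <= F t.
  rewrite /F; have [K K0 ->] := euclid_triangle_form lam v t 0 Pl.
  by rewrite mulr_ge0 ?(ltW K0) // addr_ge0 ?sqr_ge0.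
split; first by apply: sumr_ge0.
move=> /eqP; rewrite psumr_eq0 // => /allP sF.
(* The second square and the law of sines give equal ratios v / l on two sides of a triangle; i is
   arbitrary, and connectedness spreads the equality over the surface. *)
have H t i : v 0 (ts_edge (t, ordS i)) / l 0 (ts_edge (t, ordS i)) =
             v 0 (ts_edge (t, ord_pred i)) / l 0 (ts_edge (t, ord_pred i)).
  have := sF t; rewrite mem_index_enum => /(_ isT) /= /eqP.
  rewrite /F; have [K K0 ->] := euclid_triangle_form lam v t i Pl.
  move=> /eqP; rewrite mulf_eq0 (gt_eqF K0) /= paddr_eq0 ?sqr_ge0 //.
  move=> /andP[_]; rewrite sqrf_eq0 subr_eq0 => /eqP.
  have [k k0 [_ -> ->]] := euclid_ang_sines t i Pl.
  rewrite -!mulrA => /(mulfI (lt0r_neq0 k0)) E1.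
  apply/eqP; rewrite eqr_div ?lt0r_neq0 //; apply/eqP.
  by rewrite mulrC E1 mulrC.
have [e0 _] := edge_exists S.
exists (v 0 e0 / l 0 e0); apply/rowP => e; rewrite !mxE.
suff <- : v 0 e / l 0 e = v 0 e0 / l 0 e0 by rewrite divfK // gt_eqF.
apply: (@edges_connected S (fun e => v 0 e / l 0 e = v 0 e0 / l 0 e0) e0) => // t i j <-.
have [->//|->|->] := ord3_cases i j.
  by have := H t (ord_pred i); rewrite !ord3E.
by have := H t (ordS i); rewrite !ord3E.
Qed.

Lemma radius_quad lam l v t : PH l -> exists2 K, 0 < K &
  \sum_j cos (radius (hyperbolic_plane R) l (t, j)) `^ lam *
     'D_v (fun x => radius (hyperbolic_plane R) x (t, j)) l *
     (tanh_half (l 0 (ts_edge (t, j))) `^ (- (lam + 1)) * v 0 (ts_edge (t, j)))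
  = - K * hyp_quad (angH l (t, 0)) (angH l (t, ordS 0)) (angH l (t, ord_pred 0))
     (v 0 (ts_edge (t, 0))) (v 0 (ts_edge (t, ordS 0))) (v 0 (ts_edge (t, ord_pred 0))).
Proof.
move=> Pl; have l0 := metric_pos Hcos Pl; have [cA cB cC] := corner_data Hcos t 0 Pl.
have ab s := ang_bound Hcos s Pl.
have [g g0 [_ gA gB gC]] := hyp_sines (l0 _) (l0 _) (l0 _) (ab _) (ab _) (ab _) cA cB cC.
have dA := @hyp_ang_derivative _ _ l v t 0 g Pl gA.
have dB := @hyp_ang_derivative _ _ l v t (ordS 0) g Pl.
have dC := @hyp_ang_derivative _ _ l v t (ord_pred 0) g Pl.
rewrite !ord3E in dB dC.
have {}dB := dB gB; have {}dC := dC gC.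
have [K K0 EK] := hyp_gradient_form (l0 _) (l0 _) (l0 _) (ab _) (ab _) (ab _) cA cB cC lam g0 dA dB dC.
exists K => //; rewrite -EK (ord3_sum _ 0).
have rE j : radius (hyperbolic_plane R) l (t, j) =
    (angH l (t, ordS j) + angH l (t, ord_pred j) - angH l (t, j)) / 2 by [].
have dE j : 'D_v (fun x => radius (hyperbolic_plane R) x (t, j)) l =
    ('D_v (fun x => angH x (t, ordS j)) l + 'D_v (fun x => angH x (t, ord_pred j)) l
     - 'D_v (fun x => angH x (t, j)) l) / 2.
  exact: (derive_radius Hcos (@Cs_hyp_cos R S)).
by rewrite (dE 0) (dE (ordS 0)) (dE (ord_pred 0)) (rE 0) (rE (ordS 0)) (rE (ord_pred 0)) !ord3E.
Qed.

Lemma Psi_derivative_inj lam l v : PH l ->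
  (forall e, 'D_v (fun x => Psi (hyperbolic_plane R) lam x 0 e) l = 0) -> v = 0.
Proof.
move=> Pl H0.
have ab s := ang_bound Hcos s Pl.
have Hsum t i := hyp_ang_sum t i Pl.
pose F t := \sum_j cos (radius (hyperbolic_plane R) l (t, j)) `^ lam *
     'D_v (fun x => radius (hyperbolic_plane R) x (t, j)) l *
     (tanh_half (l 0 (ts_edge (t, j))) `^ (- (lam + 1)) * v 0 (ts_edge (t, j))).
have SF : \sum_t F t = 0.
  transitivity (\sum_e 'D_v (fun x => Psi (hyperbolic_plane R) lam x 0 e) l
     * (tanh_half (l 0 e) `^ (- (lam + 1)) * v 0 e)); last first.
    by apply: big1 => e _; rewrite H0 mul0r.
  under [RHS]eq_bigr => e _ do rewrite (derive_Psi Hcos (@Cs_hyp_cos R S) (@hyp_ang_sum_le R S)) //.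
  by rewrite (sum_edges_sides (fun c => cos (radius (hyperbolic_plane R) l c) `^ lam
     * 'D_v (fun x => radius (hyperbolic_plane R) x c) l)
     (fun e => tanh_half (l 0 e) `^ (- (lam + 1)) * v 0 e)).
have Q t : 0 <= hyp_quad (angH l (t, 0)) (angH l (t, ordS 0)) (angH l (t, ord_pred 0))
     (v 0 (ts_edge (t, 0))) (v 0 (ts_edge (t, ordS 0))) (v 0 (ts_edge (t, ord_pred 0)))
   /\ (hyp_quad (angH l (t, 0)) (angH l (t, ordS 0)) (angH l (t, ord_pred 0))
     (v 0 (ts_edge (t, 0))) (v 0 (ts_edge (t, ordS 0))) (v 0 (ts_edge (t, ord_pred 0))) = 0 ->
   [/\ v 0 (ts_edge (t, 0)) = 0, v 0 (ts_edge (t, ordS 0)) = 0 & v 0 (ts_edge (t, ord_pred 0)) = 0]).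
  have /andP[A0 _] := ab (t, 0); have /andP[B0 _] := ab (t, ordS 0); have /andP[C0 _] := ab (t, ord_pred 0).
  exact: hyp_quad_ge0.
have F0 t : 0 <= - F t.
  rewrite /F; have [K K0 ->] := radius_quad lam v t Pl.
  by rewrite mulNr opprK mulr_ge0 ?(ltW K0) //; exact: (Q t).1.
move: SF => /eqP; rewrite -oppr_eq0 -sumrN psumr_eq0 // => /allP sF.
apply/rowP => e; rewrite mxE; have [[t i] <-] := edge_side e.
have := sF t; rewrite mem_index_enum => /(_ isT) /= /eqP.
rewrite /F; have [K K0 ->] := radius_quad lam v t Pl.
rewrite mulNr opprK => /eqP; rewrite mulf_eq0 (gt_eqF K0) => /eqP /(Q t).2 [h1 h2 h3].
by have [->|->|->] := ord3_cases 0 i.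
Qed.

Lemma differentiable_Psi lam l : PH l -> differentiable (Psi (hyperbolic_plane R) lam : E -> E) l.
Proof.
move=> Pl; apply: differentiable_rV => e.
exact: (Cs_Psi Hcos (@Cs_hyp_cos R S) (@hyp_ang_sum_le R S) lam 1 e).1.
Qed.

Lemma open_Psi_image lam : open (Psi (hyperbolic_plane R) lam @` PH).
Proof.
rewrite openE => _ [l Pl <-].
have [|||v Dv|U [V [g [oU Ul UP oV [_ _ UV VU]]]]] :=
  @inverse_function R _ (Psi (hyperbolic_plane R) lam) PH l.
- exact: (open_metric Hcos (@Cs_hyp_cos R S)).
- exact: Pl.
- by move=> k e; exact: (Cs_Psi Hcos (@Cs_hyp_cos R S) (@hyp_ang_sum_le R S) lam k e).
- apply: (Psi_derivative_inj (lam := lam) Pl) => e.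
  by rewrite derive_coordf ?Dv ?mxE //; exact: differentiable_Psi.
have [VP _] := UV l Ul.
apply: (filterS _ (open_nbhs_nbhs (conj oV VP))) => y Vy.
by have [Ug gy] := VU y Vy; exists (g y) => //; exact: UP.
Qed.

End Gradients.

(** * Rigidity of Euclidean metrics *)

Section Rigidity.
Variable R : realType.

Lemma powR_convex (p t x y : R) : 1 <= p -> 0 <= t -> t <= 1 -> 0 <= x -> 0 <= y ->
  (t * x + (1 - t) * y) `^ p <= t * x `^ p + (1 - t) * y `^ p.
Proof.
move=> p1 t0 t1 x0 y0.
have := @convex_powR R p p1 (Itv01 t0 t1) x y.
by rewrite !inE /= !in_itv /= x0 y0 /= => /(_ isT isT); rewrite !convRE.
Qed.

Lemma powRK (p x : R) : p != 0 -> 0 <= x -> (x `^ p) `^ p^-1 = x.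
Proof. by move=> p0 x0; rewrite -powRrM mulfV // powRr1. Qed.

Lemma powRVK (p x : R) : p != 0 -> 0 <= x -> (x `^ p^-1) `^ p = x.
Proof. by move=> p0 x0; rewrite -powRrM mulVf // powRr1. Qed.

Lemma powR_lt (p x y : R) : 0 < p -> 0 < x -> x < y -> x `^ p < y `^ p.
Proof.
by move=> p0 x0 xy; apply: gt0_ltr_powR => //; rewrite nnegrE ltW // (lt_trans x0).
Qed.

(* Reverse Minkowski inequality: (x, y) |-> (x ^ (1/p) + y ^ (1/p)) ^ p is concave for
   p >= 1, so that triangle inequalities define a convex set in the coordinates a ^ p. *)
Lemma triangle_ineq_convex (p s a b c a' b' c' : R) : 1 <= p -> 0 <= s -> s <= 1 ->
  0 < a -> 0 < b -> 0 < c -> 0 < a' -> 0 < b' -> 0 < c' ->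
  a < b + c -> a' < b' + c' ->
  ((1 - s) * a `^ p + s * a' `^ p) `^ p^-1 <
  ((1 - s) * b `^ p + s * b' `^ p) `^ p^-1 + ((1 - s) * c `^ p + s * c' `^ p) `^ p^-1.
Proof.
move=> p1 s0 s1 a0 b0 c0 a0' b0' c0' abc abc'.
have p0 : 0 < p by apply: lt_le_trans p1.
have pn0 : p != 0 by rewrite gt_eqF.
have q0 : 0 < p^-1 by rewrite invr_gt0.
pose M := b + c; pose M' := b' + c'.
have M0 : 0 < M by rewrite addr_gt0.
have M0' : 0 < M' by rewrite addr_gt0.
have pos x x' : 0 < x -> 0 < x' -> 0 < (1 - s) * x `^ p + s * x' `^ p.
  move=> x0 x0'; have xp := powR_gt0 p x0; have xp' := powR_gt0 p x0'.
  have [->|sn1] := eqVneq s 1; first by rewrite subrr mul0r add0r mul1r.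
  have s1' : 0 < 1 - s by rewrite subr_gt0 lt_neqAle sn1.
  by rewrite ltr_pwDl ?mulr_gt0 // mulr_ge0 // ltW.
pose Np := (1 - s) * M `^ p + s * M' `^ p.
have Np0 : 0 < Np by exact: pos.
pose N := Np `^ p^-1.
have N0 : 0 < N by exact: powR_gt0.
have NE : N `^ p = Np by rewrite powRVK // ltW.
(* [N] is the combination of the sums M = b + c and M' = b' + c'; it exceeds the combination of a
   and a' by monotonicity, so it remains to bound [N] by the right-hand side. *)
apply: (@lt_le_trans _ _ N).
  apply: powR_lt => //; first exact: pos.
  have h1 : a `^ p < M `^ p by exact: powR_lt.
  have h2 : a' `^ p < M' `^ p by exact: powR_lt.
  have [se1|sn1] := eqVneq s 1; first by rewrite /Np se1 subrr !mul0r !add0r !mul1r.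
  have s1' : 0 < 1 - s by rewrite subr_gt0 lt_neqAle sn1.
  by apply: ltr_leD; [rewrite ltr_pM2l|rewrite ler_wpM2l // ltW].
(* The share of the first triangle in N^p; with it the combination of x and x' is N^p times a convex
   combination of powers of x / M and x' / M'. Convexity of the power p then gives [key]. *)
pose t := (1 - s) * M `^ p / Np.
have t0 : 0 <= t by rewrite divr_ge0 ?(ltW Np0) // mulr_ge0 ?powR_ge0 // subr_ge0.
have tE : 1 - t = s * M' `^ p / Np.
  by rewrite /t /Np; field; exact: lt0r_neq0.
have t1 : t <= 1 by rewrite -subr_ge0 tE divr_ge0 ?(ltW Np0) // mulr_ge0 ?powR_ge0.
have key x x' : 0 < x -> 0 < x' ->
   N * (t * (x / M) + (1 - t) * (x' / M')) <= ((1 - s) * x `^ p + s * x' `^ p) `^ p^-1.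
  move=> x0 x0'.
  have d0 : 0 <= x / M by rewrite divr_ge0 ?ltW.
  have d0' : 0 <= x' / M' by rewrite divr_ge0 ?ltW.
  have e0 : 0 <= t * (x / M) + (1 - t) * (x' / M').
    by rewrite addr_ge0 // mulr_ge0 // subr_ge0.
  have -> : (1 - s) * x `^ p + s * x' `^ p = N `^ p * (t * (x / M) `^ p + (1 - t) * (x' / M') `^ p).
    have ex : x `^ p = M `^ p * (x / M) `^ p.
      by rewrite -powRM ?(ltW M0) // mulrC divfK // gt_eqF.
    have ex' : x' `^ p = M' `^ p * (x' / M') `^ p.
      by rewrite -powRM ?(ltW M0') // mulrC divfK // gt_eqF.
    by rewrite ex ex' NE tE /t; field; exact: lt0r_neq0.
  have Ne0 : 0 <= N * (t * (x / M) + (1 - t) * (x' / M')) by rewrite mulr_ge0 // ltW.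
  rewrite -[leLHS](@powRK p) //; apply: ge0_ler_powR; rewrite ?nnegrE ?(ltW q0) ?powR_ge0 //.
    by rewrite mulr_ge0 ?powR_ge0 // addr_ge0 // mulr_ge0 ?powR_ge0 // subr_ge0.
  by rewrite powRM ?(ltW N0) // ler_wpM2l ?powR_ge0 // powR_convex.
apply: le_trans (lerD (key b b' b0 b0') (key c c' c0 c0')).
rewrite -mulrDr.
have -> : t * (b / M) + (1 - t) * (b' / M') + (t * (c / M) + (1 - t) * (c' / M')) =
  t * ((b + c) / M) + (1 - t) * ((b' + c') / M') by ring.
by rewrite -/M -/M' !divff ?gt_eqF // !mulr1 addrC subrK mulr1.
Qed.

Lemma euclid_cos_triangle (a b c : R) : 0 < a -> 0 < b -> 0 < c ->
  -1 < euclid_cos a b c < 1 <-> [/\ a < b + c, b < c + a & c < a + b].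
Proof.
move=> a0 b0 c0; have bc : 0 < 2 * b * c by rewrite !mulr_gt0.
rewrite /euclid_cos ltr_pdivrMr // ltr_pdivlMr // mul1r mulN1r.
split=> [/andP[h1 h2]|[h1 h2 h3]]; first by split; nra.
by apply/andP; split; nra.
Qed.

End Rigidity.

Section PhiRigidity.
Variable R : realType.
Variable S : triangulated_surface.
Local Notation E := ('rV[R]_(ts_nedge S)).
Implicit Types (l v : E) (s : R) (t : ts_tri S) (e : 'I_(ts_nedge S)).
Local Notation PE := (polyhedral_metric (euclidean_plane R) S).
Local Notation Ecos := (@euclidean_cosine_law R).

Lemma derive_path (f : E -> R) (g : R -> E) (dg : E) (x : R) : differentiable f (g x) ->
  (forall e, is_derive x 1 (fun y => g y 0 e) (dg 0 e)) ->
  is_derive x 1 (fun y => f (g y)) ('D_dg f (g x)).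
Proof.
move=> df Dg.
have gx : differentiable g x.
  by apply: differentiable_rV => e; apply/derivable1_diffP; have ? := Dg e; apply: ex_derive.
have dgx : 'd g x 1 = dg.
  rewrite -deriveE // derive_mx; last exact: diff_derivable.
  by apply/rowP => e; rewrite mxE; have ? := Dg e; rewrite derive_val.
have fg : differentiable (f \o g) x by apply: differentiable_comp.
apply: DeriveDef; first exact/derivable1_diffP.
by rewrite deriveE // diff_comp //= dgx deriveE.
Qed.

Lemma powR_mulr (x a : R) : 0 < x -> x `^ a * x = x `^ (a + 1).
Proof.
by move=> x0; rewrite powRD ?(gt_eqF x0) ?implybT // powRr1 // ltW.
Qed.

Lemma euclid_metricP l : PE l <-> (forall e, 0 < l 0 e) /\
  forall t i, l 0 (ts_edge (t, i)) < l 0 (ts_edge (t, ordS i)) + l 0 (ts_edge (t, ord_pred i)).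
Proof.
split=> [/(polyhedral_metricP Ecos)[l0 H]|[l0 H]]; [split=> // t i|apply/(polyhedral_metricP Ecos); split=> // -[t i]].
  by have /(euclid_cos_triangle (l0 _) (l0 _) (l0 _)) [] := H (t, i).
apply/(euclid_cos_triangle (l0 _) (l0 _) (l0 _)) => /=; split; first exact: H.
  by have := H t (ordS i); rewrite !ord3E.
by have := H t (ord_pred i); rewrite !ord3E.
Qed.

Lemma euclid_metric_scale l c : 0 < c -> PE l -> PE (c *: l).
Proof.
move=> c0 /euclid_metricP[l0 H]; apply/euclid_metricP; split=> [e|t i].
  by rewrite mxE mulr_gt0.
by rewrite !mxE -mulrDr ltr_pM2l.
Qed.

Lemma Phi_scale lam l c : 0 < c -> PE l ->
  Phi (euclidean_plane R) lam (c *: l) = Phi (euclidean_plane R) lam l.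
Proof.
move=> c0 Pl; have Pc := euclid_metric_scale c0 Pl.
have l0 := metric_pos Ecos Pl.
apply/rowP => e; rewrite !PhiE; apply: eq_bigr => s _; congr angle_integral.
rewrite !(inner_angleE Ecos) //; congr acos; rewrite /corner_cos /euclid_cos !mxE.
have b0 := l0 (ts_edge (s.1, ordS s.2)); have d0 := l0 (ts_edge (s.1, ord_pred s.2)).
by field; rewrite !gt_eqF.
Qed.

Lemma no_double_root (s k : R) : 1 - k * s = 0 -> 1 + k * (1 - s) = 0 -> False.
Proof.
move=> h1 h2; have k0 : k = 0 by lra.
by move: h1; rewrite k0 mul0r subr0 => /eqP; rewrite oner_eq0.
Qed.

Section Path.
Variables (lam : R) (l l' : E).
Hypotheses (lam1 : lam <= -1) (Pl : PE l) (Pl' : PE l').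
Let p := - lam.
Let u e := l 0 e `^ p.
Let u' e := l' 0 e `^ p.
(** The segment from [l] to [l'] in the coordinates l ^ p. *)
Let path (s : R) : E := \row_e ((1 - s) * u e + s * u' e) `^ p^-1.
Let dpath (s : R) : E := \row_e (p^-1 * ((1 - s) * u e + s * u' e) `^ (p^-1 - 1) * (u' e - u e)).

Let p1 : 1 <= p.
Proof. by rewrite /p lerNr. Qed.

Let p0 : 0 < p.
Proof. exact: lt_le_trans p1. Qed.

Let l0 : forall e, 0 < l 0 e := metric_pos Ecos Pl.
Let l0' : forall e, 0 < l' 0 e := metric_pos Ecos Pl'.

Let base0 s e : 0 <= s -> s <= 1 -> 0 < (1 - s) * u e + s * u' e.
Proof.
move=> s0 s1; have h1 : 0 < u e by exact: powR_gt0.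
have h2 : 0 < u' e by exact: powR_gt0.
have [->|sn1] := eqVneq s 1; first by rewrite subrr mul0r add0r mul1r.
have s1' : 0 < 1 - s by rewrite subr_gt0 lt_neqAle sn1.
by rewrite ltr_pwDl ?mulr_gt0 // mulr_ge0 // ltW.
Qed.

Let path_metric s : 0 <= s -> s <= 1 -> PE (path s).
Proof.
move=> s0 s1; apply/euclid_metricP; split=> [e|t i].
  by rewrite mxE; apply: powR_gt0; exact: base0.
rewrite !mxE; have /euclid_metricP[_ H] := Pl; have /euclid_metricP[_ H'] := Pl'.
exact: triangle_ineq_convex.
Qed.

Let path_derive s e : 0 <= s -> s <= 1 -> is_derive s 1 (fun y => path y 0 e) (dpath s 0 e).
Proof.
move=> s0 s1; rewrite mxE.
have -> : (fun y => path y 0 e) = (fun y => ((1 - y) * u e + y * u' e) `^ p^-1).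
  by apply/funext => y; rewrite mxE.
have D : is_derive s 1 (fun y : R => (1 - y) * u e + y * u' e) (u' e - u e).
  have -> : (fun y : R => (1 - y) * u e + y * u' e) = (fun y => u e + y * (u' e - u e)).
    by apply/funext => y; ring.
  have H := @is_deriveM _ _ (fun y : R => y) (cst (u' e - u e)) s 1 _ _ (is_derive_id _ _) (is_derive_cst _ _ _).
  have := is_deriveD (is_derive_cst (u e) s 1) H.
  by rewrite scaler0 !add0r -[X in is_derive _ _ _ X]/(_ * _) mulr1.
have := @is_derive1_comp _ (fun x => x `^ p^-1) _ s _ _ (is_derive1_powR p^-1 (base0 e s0 s1)) D.
by [].
Qed.

(** The weighted velocity does not depend on s, so differentiating the pairing of [Phi] with this
    fixed vector gives exactly the form of [Phi_gradient_ge0]. *)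
Let path_weight s e : 0 <= s -> s <= 1 ->
  Phi_weight lam (path s) (dpath s) e = p^-1 * (u' e - u e).
Proof.
move=> s0 s1; rewrite /Phi_weight !mxE.
set b := _ + _; have b0 : 0 < b by exact: base0.
have E1 : b `^ (p^-1 * - (lam + 1)) * b `^ (p^-1 - 1) = 1.
  rewrite -powRD ?(gt_eqF b0) ?implybT //.
  rewrite (_ : p^-1 * - (lam + 1) + (p^-1 - 1) = p^-1 * p - 1); last by rewrite /p; ring.
  by rewrite mulVf ?gt_eqF // subrr powRr0.
rewrite -powRrM; transitivity ((b `^ (p^-1 * - (lam + 1)) * b `^ (p^-1 - 1)) * (p^-1 * (u' e - u e))).
  by move: (b `^ _) (b `^ _) => X Y; ring.
by rewrite E1 mul1r.
Qed.

(* Along the path the pairing of Phi with the direction u' - u is nondecreasing; it takes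
   the same value at both ends, so its derivative vanishes somewhere. *)
Lemma Phi_rigid_path : Phi (euclidean_plane R) lam l = Phi (euclidean_plane R) lam l' ->
  exists c, forall e, u' e = c * u e.
Proof.
move=> Phill'.
pose g s := \sum_e Phi (euclidean_plane R) lam (path s) 0 e * (p^-1 * (u' e - u e)).
pose dg s := \sum_e 'D_(dpath s) (fun x => Phi (euclidean_plane R) lam x 0 e) (path s) * (p^-1 * (u' e - u e)).
have gD s : 0 <= s -> s <= 1 -> is_derive s 1 g (dg s).
  move=> s0 s1.
  have H e : is_derive s 1 (fun s => Phi (euclidean_plane R) lam (path s) 0 e * (p^-1 * (u' e - u e)))
     ('D_(dpath s) (fun x => Phi (euclidean_plane R) lam x 0 e) (path s) * (p^-1 * (u' e - u e))).
    have D := @derive_path (fun x => Phi (euclidean_plane R) lam x 0 e) path (dpath s) s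
      ((Cs_Phi Ecos (@Cs_euclid_cos R S) lam 1 e).1 _ (path_metric s0 s1)) (fun e => path_derive e s0 s1).
    have := @is_deriveM _ _ _ (cst (p^-1 * (u' e - u e))) s 1 _ _ D (is_derive_cst _ _ _).
    by rewrite scaler0 add0r => H; apply: is_derive_eq; rewrite -[LHS]/(_ * _) mulrC.
  have := is_derive_sum H.
  rewrite /g /dg; congr is_derive; apply/funext => y.
  by rewrite fct_sumE.
have pathl : path 0 = l.
  apply/rowP => e; rewrite mxE subr0 mul1r mul0r addr0 /u powRK ?gt_eqF //.
  by rewrite ltW.
have pathl' : path 1 = l'.
  apply/rowP => e; rewrite mxE subrr mul0r mul1r add0r /u' powRK ?gt_eqF //.
  by rewrite ltW.
have g01 : g 0 = g 1 by rewrite /g pathl pathl' Phill'.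
have [||s] := @Rolle R g 0 1 ltr01 _ _ g01.
- by move=> x; rewrite in_itv /= => /andP[x0 x1]; have ? := gD x (ltW x0) (ltW x1); apply: ex_derive.
- by apply: within_of_for => x /andP[x0 x1]; apply: continuous_of_is_derive (gD x x0 x1).
rewrite in_itv /= => /andP[s0 s1] Hs.
have dg0 : dg s = 0.
  by have [_ <-] := gD s (ltW s0) (ltW s1); have [_ ->] := Hs.
have Ps := path_metric (ltW s0) (ltW s1).
have [_ H] := Phi_gradient_ge0 lam (dpath s) Ps.
have [|c Hc] := H.
  rewrite -[RHS]dg0 /dg; apply: eq_bigr => e _; congr (_ * _).
  exact: (path_weight e (ltW s0) (ltW s1)).
pose k := p * c.
(* At the parameter found, the velocity is c times the metric; in the coordinates l ^ p this is
   linear in u and u'. *)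
have E1 e : u' e - u e = k * ((1 - s) * u e + s * u' e).
  have := path_weight e (ltW s0) (ltW s1); rewrite Hc /Phi_weight !mxE.
  set b := (1 - s) * u e + s * u' e; have b0 : 0 < b by apply: base0; exact: ltW.
  move=> E2; apply: (mulfI (_ : p^-1 != 0)); first by rewrite invr_eq0 gt_eqF.
  have -> : p^-1 * (k * b) = c * b by rewrite /k; field; exact: lt0r_neq0.
  rewrite -E2 mulrCA; congr (_ * _).
  have pb : 0 < b `^ p^-1 by exact: powR_gt0.
  rewrite (powR_mulr _ pb).
  have -> : - (lam + 1) + 1 = p by rewrite /p; ring.
  exact: (powRVK (lt0r_neq0 p0) (ltW b0)).
have F1 e : u' e * (1 - k * s) = u e * (1 + k * (1 - s)).
  move: (E1 e); move: (u e) (u' e) => x y h.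
  apply/eqP; rewrite -subr_eq0; apply/eqP.
  by transitivity (y - x - k * ((1 - s) * x + s * y)); [ring|rewrite h subrr].
(* If the coefficient of u' vanished, so would that of u, since u is positive; the two equations are
   incompatible. *)
have [ks|ks] := eqVneq (1 - k * s) 0; last first.
  exists ((1 + k * (1 - s)) / (1 - k * s)) => e.
  by rewrite mulrAC -[_ * u e]mulrC -F1 mulfK.
have [e0 _] := edge_exists S.
have ue0 : u e0 != 0 := lt0r_neq0 (powR_gt0 _ (l0 e0)).
have h : u e0 * (1 + k * (1 - s)) = u e0 * 0 by rewrite -F1 ks !mulr0.
have {}h := mulfI ue0 h.
by case: (no_double_root ks h).
Qed.

Lemma Phi_rigid : Phi (euclidean_plane R) lam l = Phi (euclidean_plane R) lam l' ->
  exists2 c, 0 < c & l' = c *: l.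
Proof.
move=> /Phi_rigid_path[c Hc].
have [e0 _] := edge_exists S.
have u0 e : 0 < u e by exact: powR_gt0.
have c0 : 0 < c.
  have : 0 < c * u e0 by rewrite -Hc; exact: powR_gt0.
  by rewrite pmulr_lgt0.
exists (c `^ p^-1); first exact: powR_gt0.
apply/rowP => e; rewrite mxE -[LHS](@powRK _ p) ?gt_eqF ?(ltW (l0' e)) //.
rewrite -/(u' e) Hc powRM ?(ltW c0) ?(ltW (u0 e)) //.
by rewrite /u powRK ?gt_eqF ?(ltW (l0 e)).
Qed.
End Path.
End PhiRigidity.

(** * Limits of metrics along an ultrafilter *)

Section UltraLimits.
Variable R : realType.

Section Ultra.
Variables (T : Type) (U : set_system T).
Context {UU : UltraFilter U}.

(** Compactness of [a, b] gives a cluster point of the image, and along an ultrafilter a cluster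
    point is a limit. Thus finitely many angles converge at once, without subsequences. *)
Lemma ultra_bounded_cvg (f : T -> R) a b : (\forall x \near U, a <= f x <= b) ->
  exists2 c, a <= c <= b & f @ U --> c.
Proof.
move=> H.
have FAB : (f @ U) `[a, b]%classic.
  by apply: filterS H => x; rewrite /= in_itv.
have [c [Ic cl]] := @segment_compact R a b (f @ U) _ FAB.
exists c; first by move: Ic; rewrite /= in_itv.
apply/cvgrPdist_lt => e e0.
have [//|N] := in_ultra_setVsetC [set x | `|c - f x| < e] UU.
have [y [y1 y2]] := cl [set y | ~ `|c - y| < e] [set y | `|c - y| < e] N
   (nbhsx_ballx c e e0).
by exfalso; exact: y1 y2.
Qed.

End Ultra.

(** The ultrafilter lives on the domain: it refines the filter generated by [D] and the preimages of
    the neighbourhoods of z. *)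
Lemma closure_image_ultra (T : Type) (V : topologicalType) (f : T -> V) (D : set T) z :
  closure (f @` D) z -> exists2 U : set_system T, UltraFilter U & U D /\ f @ U --> z.
Proof.
move=> cl.
pose F := [set A : set T | exists2 B, nbhs z B & forall x, D x -> B (f x) -> A x].
have FF : ProperFilter F.
  apply: Build_ProperFilter_ex.
    move=> A [B nB H]; have [_ [[x Dx <-] Bx]] := cl B nB.
    by exists x; exact: H.
  split.
  - by exists setT => //; exact: filterT.
  - move=> A1 A2 [B1 n1 H1] [B2 n2 H2]; exists (B1 `&` B2); first exact: filterI.
    by move=> x Dx [b1 b2]; split; [exact: H1|exact: H2].
  - by move=> A1 A2 s12 [B n H]; exists B => // x Dx Bx; apply: s12; exact: H.
have [U [UU FU]] := ultraFilterLemma FF; exists U => //; split.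
  by apply: FU; exists setT => //; exact: filterT.
by move=> B nB; apply: FU; exists B.
Qed.

Section FinLimits.
Variables (T : Type) (U : set_system T).
Context {FU : ProperFilter U}.

Lemma cvg_sum_fin (I : finType) (p : pred I) (f : I -> T -> R) (c : I -> R) :
  (forall i, f i @ U --> c i) ->
  (fun x => \sum_(i | p i) f i x) @ U --> \sum_(i | p i) c i.
Proof.
move=> H; have E (r : seq I) : (fun x => \sum_(i <- r | p i) f i x) @ U --> \sum_(i <- r | p i) c i.
  elim: r => [|i r IH].
    by under eq_fun do rewrite big_nil; rewrite big_nil; exact: cvg_cst.
  rewrite big_cons; under eq_fun do rewrite big_cons.
  by case: (p i); [exact: cvgD|exact: IH].
exact: E.
Qed.

Lemma cvg_comp_continuous (f : T -> R) (h : R -> R) c : f @ U --> c ->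
  {for c, continuous h} -> (fun x => h (f x)) @ U --> h c.
Proof. by move=> fc hc; exact: (@cvg_comp _ _ _ f h U (nbhs c) (nbhs (h c)) fc hc). Qed.

Lemma cvg_uniq (f : T -> R) (a b : R) : f @ U --> a -> f @ U --> b -> a = b.
Proof. by move=> H1 H2; exact: (norm_cvg_unique H1 H2). Qed.

Lemma cvg_near_eq (f g : T -> R) (c : R) : (\forall x \near U, f x = g x) ->
  f @ U --> c -> g @ U --> c.
Proof.
move=> fg fc; apply: cvg_trans fc; exact: near_eq_cvg.
Qed.

Lemma cvg_near_gt (f : T -> R) (c m : R) : f @ U --> c -> m < c ->
  \forall x \near U, m < f x.
Proof. by move=> fc; apply: (cvgr_gt c). Qed.

Lemma cvg_near_lt (f : T -> R) (c m : R) : f @ U --> c -> c < m ->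
  \forall x \near U, f x < m.
Proof. by move=> fc; apply: (cvgr_lt c). Qed.

End FinLimits.
End UltraLimits.

(** * Limit angles and limit radii, for both geometries *)

Section AngleLimits.
Variable R : realType.
Variable S : triangulated_surface.
Local Notation E := ('rV[R]_(ts_nedge S)).
Implicit Types (l v : E) (s : ts_tri S * 'I_3) (t : ts_tri S) (e : 'I_(ts_nedge S)).
Variables (K : geometry R) (kcos : R -> R -> R -> R).
Hypothesis Kcos : cosine_law K kcos.
Local Notation P := (polyhedral_metric K S).
Local Notation ang := (inner_angle K).
Hypothesis Ksum : forall l t i, P l ->
  ang l (t, i) + ang l (t, ordS i) + ang l (t, ord_pred i) <= pi.
Hypothesis Kobtuse : forall l t i, P l -> cos (ang l (t, i)) < 0 ->
  l 0 (ts_edge (t, ordS i)) < l 0 (ts_edge (t, i)) /\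
  l 0 (ts_edge (t, ord_pred i)) < l 0 (ts_edge (t, i)).
Variables (lam : R) (lam1 : lam <= -1).
Variables (U : set_system E).
Hypothesis UU : UltraFilter U.
Hypothesis UP : U P.
Variable z : E.
Hypothesis Uz : forall e, (fun l => Psi K lam l 0 e) @ U --> z 0 e.

Lemma angle_limits : exists th : ts_tri S * 'I_3 -> R,
  [/\ forall s, (fun l => ang l s) @ U --> th s, forall s, 0 <= th s <= pi &
     forall t i, th (t, i) + th (t, ordS i) + th (t, ord_pred i) <= pi].
Proof.
have H s : exists c, 0 <= c <= pi /\ (fun l => ang l s) @ U --> c.
  have [|c c0 Hc] := @ultra_bounded_cvg R E U UU (fun l => ang l s) 0 pi; last by exists c.
  by apply: filterS UP => l /(ang_bound Kcos s) /andP[? ?]; rewrite !ltW.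
have [th Hth] := choice H; exists th; split=> [s|s|t i]; [exact: (Hth s).2|exact: (Hth s).1|].
have C : (fun l => ang l (t, i) + ang l (t, ordS i) + ang l (t, ord_pred i)) @ U
   --> th (t, i) + th (t, ordS i) + th (t, ord_pred i).
  by apply: cvgD; [apply: cvgD|]; exact: (Hth _).2.
apply: (cvgr_to_le C); apply: filterS UP => l Pl; exact: Ksum.
Qed.

Variable th : ts_tri S * 'I_3 -> R.
Hypothesis thU : forall s, (fun l => ang l s) @ U --> th s.
Hypothesis th0 : forall s, 0 <= th s <= pi.
Hypothesis thsum : forall t i, th (t, i) + th (t, ordS i) + th (t, ord_pred i) <= pi.

Definition limit_radius s := (th (s.1, ordS s.2) + th (s.1, ord_pred s.2) - th s) / 2.

Lemma limit_radius_cvg s : (fun l => radius K l s) @ U --> limit_radius s.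
Proof.
apply: cvgM; last exact: cvg_cst.
by apply: cvgB; [apply: cvgD|]; exact: thU.
Qed.

Lemma limit_radius_le s : - (pi / 2) <= limit_radius s <= pi / 2.
Proof.
case: s => t i; have := thsum t i; rewrite /limit_radius /=.
have := th0 (t, i); have := th0 (t, ordS i); have := th0 (t, ord_pred i).
by lra.
Qed.

(** Eventual strict comparison of two edges along the ultrafilter. The number of eventually shorter
    edges, [rank], drives a descent on the finite edge set. *)
Let lessedge e e' : bool := `[< \forall l \near U, (l : E) 0 e < l 0 e' >].

Let rank e := #|[set e' | lessedge e' e]%SET|.

Let rank_lt e e' : (\forall l \near U, (l : E) 0 e < l 0 e') -> (rank e < rank e')%N.
Proof.
move=> H; apply: proper_card; apply/properP; split.
  apply/fintype.subsetP => x; rewrite !finset.in_set => /asboolP Hx; apply/asboolP.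
  by apply: filterS (filterI Hx H) => l [h1 h2]; exact: lt_trans h1 h2.
exists e; rewrite !finset.in_set; first exact/asboolP.
apply/negP => /asboolP Hx; have [l] := filter_ex Hx.
by rewrite ltxx.
Qed.

(* If a corner radius tends to pi / 2, the radius across the edge tends to - pi / 2,
   so the edge is opposite to an angle tending to pi and exceeds the two other sides. *)
Lemma limit_radius_step s : limit_radius s = pi / 2 ->
  exists2 s', limit_radius s' = pi / 2 &
    \forall l \near U, (l : E) 0 (ts_edge s') < l 0 (ts_edge s).
Proof.
move=> rs; have [s' [ss' es' _]] := edge_partner s.
have p0 := @pi_gt0 R.
have rs' : limit_radius s' = - (pi / 2).
  apply/eqP; rewrite eq_le; have := limit_radius_le s' => /andP[r1 r2].
  rewrite r1 andbT leNgt; apply/negP => r3.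
  (* The midpoint between - pi / 2 and the limit radius. Otherwise the integral at s' would stay
     above its value at [m] while that at s tends to infinity; [M] is chosen so that their sum
     exceeds z + 2, against the bound z + 1. *)
  pose m := (limit_radius s' - pi / 2) / 2.
  have m1 : - (pi / 2) < m by rewrite /m; lra.
  have m2 : m < limit_radius s' by rewrite /m; lra.
  pose M := angle_integral lam (m + pi / 2) - z 0 (ts_edge s) - 2.
  have [d d0 Hd] := angle_integral_cvg0 M lam1.
  have n1 : \forall l \near U, m < radius K l s' by apply: (cvg_near_gt (@limit_radius_cvg s')).
  have n2 : \forall l \near U, pi / 2 - d < radius K l s.
    by apply: (cvg_near_gt (@limit_radius_cvg s)); rewrite rs; lra.
  have n3 : \forall l \near U, Psi K lam l 0 (ts_edge s) < z 0 (ts_edge s) + 1.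
    by apply: (cvg_near_lt (@Uz (ts_edge s))); lra.
  have [l [[[Pl l1] l2] l3]] := filter_ex (filterI (filterI (filterI UP n1) n2) n3).
  move: l3; rewrite (PsiE Kcos Ksum) // (sum_two_sides _ ss' es').
  have /andP[b1 b2] := radius_bound Kcos Ksum s Pl.
  have /andP[b3 b4] := radius_bound Kcos Ksum s' Pl.
  have i1 : angle_integral lam (m + pi / 2) < angle_integral lam (radius K l s' + pi / 2).
    by apply: angle_integral_lt; lra.
  have : angle_integral lam (- radius K l s + pi / 2) < M by apply: Hd; lra.
  rewrite angle_integral_odd ?b1 //; move: i1; rewrite /M.
  by move: (angle_integral lam _) (angle_integral lam _) (angle_integral lam _) => x y w; lra.
case: s' rs' ss' es' => t i rs' ss' es'.
have thi : [/\ th (t, i) = pi, th (t, ordS i) = 0 & th (t, ord_pred i) = 0].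
  move: rs'; rewrite /limit_radius /=.
  have := th0 (t, i); have := th0 (t, ordS i); have := th0 (t, ord_pred i).
  by move=> /andP[? ?] /andP[? ?] /andP[? ?] ?; split; lra.
have [t1 t2 t3] := thi.
exists (t, ordS i).
  by rewrite /limit_radius /= !ord3E t1 t2 t3; lra.
have nc : \forall l \near U, cos (ang l (t, i)) < 0.
  have C := cvg_comp_continuous (@thU (t, i)) (@continuous_cos R (th (t, i))).
  by apply: (cvg_near_lt C); rewrite t1 cospi; lra.
by rewrite -es'; apply: filterS (filterI UP nc) => l [Pl /(Kobtuse Pl) []].
Qed.

(** [limit_radius_step] would produce an infinite strictly decreasing chain of edges. *)
Lemma limit_radius_lt s : limit_radius s < pi / 2.
Proof.
rewrite lt_neqAle; have /andP[_ ->] := limit_radius_le s; rewrite andbT.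
apply/eqP => rs.
have [n Hn] : exists n, (rank (ts_edge s) < n)%N by exists (rank (ts_edge s)).+1.
elim: n s rs Hn => [//|n IH] s rs Hn.
have [s' rs' /rank_lt lt'] := limit_radius_step rs.
by apply: (IH s' rs'); exact: leq_trans lt' Hn.
Qed.

(** The value - pi / 2 forces the limit angles pi, 0, 0, and then another radius of the triangle
    tends to pi / 2. *)
Lemma limit_radius_gt s : - (pi / 2) < limit_radius s.
Proof.
rewrite lt_neqAle; have /andP[-> _] := limit_radius_le s; rewrite andbT.
apply/eqP; case: s => t i rs.
have := limit_radius_lt (t, ordS i); move: rs; rewrite /limit_radius /= !ord3E.
have := th0 (t, i); have := th0 (t, ordS i); have := th0 (t, ord_pred i).
by move=> /andP[? ?] /andP[? ?] /andP[? ?]; lra.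
Qed.

Lemma limit_value e :
  z 0 e = \sum_(c | ts_edge c == e) angle_integral lam (limit_radius c + pi / 2).
Proof.
apply: (cvg_uniq (@Uz e)).
have H c : (fun l => angle_integral lam (radius K l c + pi / 2)) @ U -->
   angle_integral lam (limit_radius c + pi / 2).
  have C : (fun l => radius K l c + pi / 2) @ U --> limit_radius c + pi / 2.
    by apply: cvgD; [exact: limit_radius_cvg|exact: cvg_cst].
  apply: (cvg_comp_continuous C).
  apply: continuous_of_is_derive (is_derive_angle_integral lam _).
  by have := limit_radius_gt c; have := limit_radius_lt c; lra.
have C : (fun l => \sum_(c | ts_edge c == e) angle_integral lam (radius K l c + pi / 2)) @ U
   --> \sum_(c | ts_edge c == e) angle_integral lam (limit_radius c + pi / 2).
  exact: cvg_sum_fin (H : forall c, _).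
apply: cvg_near_eq C; apply: filterS UP => l Pl.
by rewrite (PsiE Kcos Ksum).
Qed.

End AngleLimits.

(** * Limits of Euclidean metrics *)

Section EuclidLimits.
Variable R : realType.
Variable S : triangulated_surface.
Local Notation E := ('rV[R]_(ts_nedge S)).
Implicit Types (l v : E) (s : ts_tri S * 'I_3) (t : ts_tri S) (e : 'I_(ts_nedge S)).
Local Notation PE := (polyhedral_metric (euclidean_plane R) S).
Local Notation PH := (polyhedral_metric (hyperbolic_plane R) S).
Local Notation angE := (inner_angle (euclidean_plane R)).
Local Notation angH := (inner_angle (hyperbolic_plane R)).
Local Notation Ecos := (@euclidean_cosine_law R).
Local Notation Hcos := (@hyperbolic_cosine_law R).

Lemma euclid_ang_obtuse l t i : PE l -> cos (angE l (t, i)) < 0 ->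
  l 0 (ts_edge (t, ordS i)) < l 0 (ts_edge (t, i)) /\
  l 0 (ts_edge (t, ord_pred i)) < l 0 (ts_edge (t, i)).
Proof.
move=> Pl; have l0 := metric_pos Ecos Pl; have [cA _ _] := corner_data Ecos t i Pl.
exact: (euclid_obtuse (l0 _) (l0 _) (l0 _) cA).
Qed.

Lemma hyp_ang_obtuse l t i : PH l -> cos (angH l (t, i)) < 0 ->
  l 0 (ts_edge (t, ordS i)) < l 0 (ts_edge (t, i)) /\
  l 0 (ts_edge (t, ord_pred i)) < l 0 (ts_edge (t, i)).
Proof.
move=> Pl; have l0 := metric_pos Hcos Pl; have [cA _ _] := corner_data Hcos t i Pl.
exact: (hyp_obtuse (l0 _) (l0 _) (l0 _) cA).
Qed.

Lemma euclid_sine_ratio l t i j : PE l ->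
  l 0 (ts_edge (t, j)) / l 0 (ts_edge (t, i)) = sin (angE l (t, j)) / sin (angE l (t, i)).
Proof.
move=> Pl; have [k k0 [sA sB sC]] := euclid_ang_sines t i Pl.
have l0 := metric_pos Ecos Pl.
have k00 := lt0r_neq0 k0; have li0 := lt0r_neq0 (l0 (ts_edge (t, i))).
by have [->|->|->] := ord3_cases i j; rewrite ?sA ?sB ?sC; field; rewrite k00 li0.
Qed.

(** The functions [len] are abstract in order to cover both normalized Euclidean lengths and
    rescaled hyperbolic ones that collapse. *)
Lemma euclid_limit_metric (T : Type) (U : set_system T) (FU : ProperFilter U)
    (th : ts_tri S * 'I_3 -> R) (len : 'I_(ts_nedge S) -> T -> R) e0 :
  (forall s, 0 < th s < pi) ->
  (forall t i, th (t, i) + th (t, ordS i) + th (t, ord_pred i) = pi) ->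
  (forall t i j, (fun x => len (ts_edge (t, j)) x / len (ts_edge (t, i)) x) @ U -->
     sin (th (t, j)) / sin (th (t, i))) ->
  (\forall x \near U, forall e, 0 < len e x) ->
  (\forall x \near U, len e0 x = 1) ->
  exists2 l : E, PE l & [/\ l 0 e0 = 1, forall e, len e @ U --> l 0 e &
     forall s, angE l s = th s].
Proof.
move=> th0 thS ratio lpos l1.
have s0 s : 0 < sin (th s) by apply: sin_gt0_pi.
have C e : exists c : R, 0 < c /\ len e @ U --> c.
  (* Convergence to a positive limit spreads from [e0] through the triangles, in which the ratios
     converge. *)
  apply: (@edges_connected S (fun e => exists c : R, 0 < c /\ len e @ U --> c) e0).
    by exists 1; split => //; apply: cvg_near_eq (cvg_cst (1 : R)); apply: filterS l1 => x ->.
  move=> t i j [c [c0 Hc]]; exists (c * (sin (th (t, j)) / sin (th (t, i)))); split.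
    by rewrite mulr_gt0 // divr_gt0.
  have H : (fun x => len (ts_edge (t, i)) x * (len (ts_edge (t, j)) x / len (ts_edge (t, i)) x)) @ U
      --> c * (sin (th (t, j)) / sin (th (t, i))) by apply: cvgM; [exact: Hc|exact: ratio].
  apply: cvg_near_eq H; apply: filterS lpos => x x0 /=.
  by rewrite mulrC divfK // lt0r_neq0.
have [L HL] := choice C.
pose l : E := \row_e L e.
have lE e : l 0 e = L e by rewrite mxE.
have l0 e : 0 < l 0 e by rewrite lE; exact: (HL e).1.
have lU e : len e @ U --> l 0 e by rewrite lE; exact: (HL e).2.
have R' t i j : l 0 (ts_edge (t, j)) = l 0 (ts_edge (t, i)) / sin (th (t, i)) * sin (th (t, j)).
  have H : (fun x => len (ts_edge (t, i)) x * (len (ts_edge (t, j)) x / len (ts_edge (t, i)) x)) @ U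
      --> l 0 (ts_edge (t, i)) * (sin (th (t, j)) / sin (th (t, i))).
    by apply: cvgM; [exact: lU|exact: ratio].
  have H2 : len (ts_edge (t, j)) @ U -->
     l 0 (ts_edge (t, i)) * (sin (th (t, j)) / sin (th (t, i))).
    apply: cvg_near_eq H; apply: filterS lpos => x x0 /=.
    by rewrite mulrC divfK // lt0r_neq0.
  by rewrite (cvg_uniq (@lU (ts_edge (t, j))) H2); ring.
have cc s : corner_cos (@euclid_cos R) l s = cos (th s).
  case: s => t i; rewrite /corner_cos /=.
  apply: (@euclid_cos_of_sines _ _ _ _ (th (t, i)) (th (t, ordS i)) (th (t, ord_pred i))
    (l 0 (ts_edge (t, i)) / sin (th (t, i)))) => //.
  by rewrite divr_gt0.
have [Pl lth] := metric_of_angles Ecos l0 th0 cc.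
exists l => //; split=> //.
  by apply: (cvg_uniq (@lU e0)); apply: cvg_near_eq (cvg_cst (1 : R)); apply: filterS l1 => x ->.
Qed.

Lemma euclid_radius l s : PE l -> radius (euclidean_plane R) l s = pi / 2 - angE l s.
Proof. by case: s => t i /(euclid_ang_sum t i); rewrite /radius /=; lra. Qed.

Lemma euclid_ang_sum_le l t i : PE l ->
  angE l (t, i) + angE l (t, ordS i) + angE l (t, ord_pred i) <= pi.
Proof. by move=> /(euclid_ang_sum t i) ->. Qed.

Lemma Psi_euclid lam l e : PE l ->
  Psi (euclidean_plane R) lam l 0 e = - Phi (euclidean_plane R) lam l 0 e.
Proof.
move=> Pl; rewrite (PsiE Ecos euclid_ang_sum_le) // PhiE -sumrN; apply: eq_bigr => c _.
rewrite euclid_radius // -angle_integralN; last exact: (ang_bound Ecos).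
by congr angle_integral; lra.
Qed.

Lemma Phi_limit lam (U : set_system E) e0 (z : E) : lam <= -1 -> UltraFilter U -> U PE ->
  (\forall l \near U, (l : E) 0 e0 = 1) ->
  (forall e, (fun l => Phi (euclidean_plane R) lam l 0 e) @ U --> z 0 e) ->
  exists2 l : E, PE l & [/\ l 0 e0 = 1, forall e, (fun x : E => x 0 e) @ U --> l 0 e &
     Phi (euclidean_plane R) lam l = z].
Proof.
move=> lam1 UU UP U1 Uz.
have Uz' e : (fun l => Psi (euclidean_plane R) lam l 0 e) @ U --> (- z) 0 e.
  have H : (fun l => - Phi (euclidean_plane R) lam l 0 e) @ U --> - z 0 e by apply: cvgN; exact: Uz.
  by rewrite mxE; apply: cvg_near_eq H; apply: filterS UP => l Pl /=; rewrite Psi_euclid.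
have [th [thU th0 thS]] := angle_limits Ecos euclid_ang_sum_le UU UP.
have r1 := limit_radius_lt Ecos euclid_ang_sum_le euclid_ang_obtuse lam1 UU UP Uz' thU th0 thS.
have r2 := limit_radius_gt Ecos euclid_ang_sum_le euclid_ang_obtuse lam1 UU UP Uz' thU th0 thS.
have zE := limit_value Ecos euclid_ang_sum_le euclid_ang_obtuse lam1 UU UP Uz' thU th0 thS.
have sumE t i : th (t, i) + th (t, ordS i) + th (t, ord_pred i) = pi.
  have C : (fun l => angE l (t, i) + angE l (t, ordS i) + angE l (t, ord_pred i)) @ U
     --> th (t, i) + th (t, ordS i) + th (t, ord_pred i).
    by apply: cvgD; [apply: cvgD|]; exact: thU.
  apply: (cvg_uniq C); apply: cvg_near_eq (cvg_cst (pi : R)).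
  by apply: filterS UP => l Pl; rewrite euclid_ang_sum.
have lr s : limit_radius th s = pi / 2 - th s.
  by case: s => t i; have := sumE t i; rewrite /limit_radius /=; lra.
(* Flatness makes the limit radius pi / 2 - th, so the strict bounds on the radii are strict bounds
   on the angles. *)
have thb s : 0 < th s < pi by have := r1 s; have := r2 s; rewrite lr; lra.
have s0 s : 0 < sin (th s) by apply: sin_gt0_pi.
have [|||l Pl [l1 lU lth]] := @euclid_limit_metric E U _ th (fun e x => x 0 e) e0 thb sumE.
- move=> t i j.
  have H s : (fun l => sin (angE l s)) @ U --> sin (th s).
    exact: cvg_comp_continuous (@thU s) (@continuous_sin R (th s)).
  have C : (fun l => sin (angE l (t, j)) / sin (angE l (t, i))) @ U --> sin (th (t, j)) / sin (th (t, i)).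
    by apply: cvgM; [exact: H|apply: cvgV; [exact: lt0r_neq0|exact: H]].
  by apply: cvg_near_eq C; apply: filterS UP => l Pl; rewrite euclid_sine_ratio.
- by apply: filterS UP => l /(metric_pos Ecos).
- exact: U1.
exists l => //; split=> //; apply/rowP => e.
rewrite PhiE -[RHS]opprK; have := zE e; rewrite mxE => ->.
rewrite -sumrN; apply: eq_bigr => c _; rewrite lth lr.
by rewrite -angle_integralN ?thb //; [congr angle_integral|have := thb c]; lra.
Qed.

End EuclidLimits.

(** * The image of Phi *)

Section PhiImage.
Variable R : realType.
Variable S : triangulated_surface.
Local Notation n := (ts_nedge S).
Local Notation E := ('rV[R]_(ts_nedge S)).
Implicit Types (l v : E) (t : ts_tri S) (e : 'I_(ts_nedge S)).
Local Notation PE := (polyhedral_metric (euclidean_plane R) S).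
Local Notation Ecos := (@euclidean_cosine_law R).
Local Notation angE := (inner_angle (euclidean_plane R)).
Local Notation PhiE := (Phi (euclidean_plane R)).

Lemma Ck_coord k m (W : set 'rV[R]_m) (f : 'rV[R]_m -> E) : open W ->
  Ck k W f -> forall e, Cs k W (fun x => f x 0 e).
Proof.
move=> oW; elim: k f => [|k IH] f.
  move=> H e x Wx; apply: (@continuous_comp _ _ _ f (fun v : E => v 0 e)); first exact: H.
  exact: coord_continuous.
move=> [H1 H2] e; split=> [x Wx|v]; first by apply: differentiable_coordf; exact: H1.
apply: (Cs_eq oW) (IH _ (H2 v) e) => x Wx.
by rewrite derive_coordf //; exact: H1.
Qed.

Lemma cvg_coord (U : set_system E) (FU : Filter U) (l : E) :
  (forall e, (fun x : E => x 0 e) @ U --> l 0 e) -> forall A : set E, nbhs l A -> U A.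
Proof.
move=> H A /nbhs_ballP[r r0 Hr]; apply: (filterS Hr).
have H2 : \forall x \near U, forall e, `|l 0 e - (x : E) 0 e| < r.
  apply: filter_forall => e; move/cvgrPdist_lt: (@H e); exact.
apply: filterS H2 => x Hx; split=> // i j; rewrite (ord1 i).
exact: Hx.
Qed.

(** By the law of sines the factor of the angle derivatives is the same at the three corners of a
    triangle, and the angle sum is constant. So l ^ (- lam) is normal to the image. *)
Lemma Phi_derivative_orthogonal lam l v : PE l ->
  \sum_e 'D_v (fun x => PhiE lam x 0 e) l * l 0 e `^ (- lam) = 0.
Proof.
move=> Pl; have l0 := metric_pos Ecos Pl.
under eq_bigr => e _ do rewrite (derive_Phi Ecos (@Cs_euclid_cos R S)) //.
rewrite (sum_edges_sides (fun c => sin (angE l c) `^ lam * 'D_v (fun x => angE x c) l)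
  (fun e => l 0 e `^ (- lam))).
apply: big1 => t _.
have [k k0 [sA sB sC]] := euclid_ang_sines t 0 Pl.
have W j : sin (angE l (t, j)) = k * l 0 (ts_edge (t, j)) ->
   sin (angE l (t, j)) `^ lam * 'D_v (fun x => angE x (t, j)) l * l 0 (ts_edge (t, j)) `^ (- lam)
   = k `^ lam * 'D_v (fun x => angE x (t, j)) l.
  move=> ->; have a0 := l0 (ts_edge (t, j)).
  rewrite powRM ?(ltW k0) ?(ltW a0) //.
  have xx : l 0 (ts_edge (t, j)) `^ lam * l 0 (ts_edge (t, j)) `^ (- lam) = 1.
    by rewrite powRN mulfV // gt_eqF // powR_gt0.
  move: xx; move: (l 0 _ `^ lam) (l 0 _ `^ (- lam)) => X Y XY.
  transitivity (k `^ lam * 'D_v (fun x => angE x (t, j)) l * (X * Y)); first by ring.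
  by rewrite XY mulr1.
have sj j : sin (angE l (t, j)) = k * l 0 (ts_edge (t, j)).
  by have [->|->|->] := ord3_cases 0 j.
rewrite (eq_bigr _ (fun j _ => W j (sj j))) -mulr_sumr (ord3_sum _ 0).
have D c : is_derive l v (fun x => angE x c) ('D_v (fun x => angE x c) l).
  exact/derivableP/diff_derivable/(ang_differentiable Ecos (@Cs_euclid_cos R S)).
have DS := is_deriveD' (is_deriveD' (D (t, 0)) (D (t, ordS 0))) (D (t, ord_pred 0)).
have near_pi : \near l, angE l (t, 0) + angE l (t, ordS 0) + angE l (t, ord_pred 0) = cst (pi : R) l.
  by apply: (open_near (open_metric Ecos (@Cs_euclid_cos R S)) Pl) => x Px; rewrite euclid_ang_sum.
by rewrite (is_derive_near_unique near_pi DS (is_derive_cst _ _ _)) mulr0.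
Qed.

Lemma normalized_metric lam e0 l : PE l -> exists l1,
  [/\ PE l1, l1 0 e0 = 1 & PhiE lam l1 = PhiE lam l].
Proof.
move=> Pl; have l0 := metric_pos Ecos Pl e0.
have i0 : 0 < (l 0 e0)^-1 by rewrite invr_gt0.
exists ((l 0 e0)^-1 *: l); split; first exact: euclid_metric_scale.
  by rewrite mxE mulVf // gt_eqF.
exact: Phi_scale.
Qed.

Lemma closed_Phi_image lam : lam <= -1 -> closed (PhiE lam @` PE).
Proof.
move=> lam1 z; have [e0 _] := edge_exists S.
(* Without normalization the lengths could tend to 0 or to infinity while [Phi] converges. *)
pose D := [set l : E | PE l /\ l 0 e0 = 1].
have -> : PhiE lam @` PE = PhiE lam @` D.
  apply/seteqP; split=> y [l]; last by move=> [Pl _] <-; exists l.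
  move=> Pl <-; have [l1 [P1 l11 <-]] := normalized_metric lam e0 Pl.
  by exists l1.
move=> /closure_image_ultra[U UU [UD Uz]].
have UP : U PE by apply: filterS UD => l [].
have U1 : \forall l \near U, (l : E) 0 e0 = 1 by apply: filterS UD => l [].
have Uze e : (fun l => PhiE lam l 0 e) @ U --> z 0 e.
  apply: (@cvg_comp _ _ _ (PhiE lam) (fun v : E => v 0 e) U (nbhs z) (nbhs (z 0 e)) Uz).
  exact: coord_continuous.
have [l Pl [l1 _ lz]] := Phi_limit lam1 UU UP U1 Uze.
by exists l.
Qed.

Lemma cvgr_add_continuous (d : E) : continuous (fun y : E => y + d).
Proof.
move=> y; apply: continuous_eps => e e0.
have := near_dist_le y e0; apply: filterS => w Hw.
by rewrite opprD addrACA subrr addr0.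
Qed.

Lemma hypersurface_Phi_image lam : lam <= -1 -> smooth_hypersurface (PhiE lam @` PE).
Proof.
move=> lam1 p [l' Pl' <-]; have [e0 _] := edge_exists S.
have [l0 [Pl0 l01 <-]] := normalized_metric lam e0 Pl'.
have oP := open_metric Ecos (@Cs_euclid_cos R S).
(* [N] agrees with [Phi] on the slice l e0 = 1 and moves along (1, ..., 1) across it. *)
pose N (l : E) : E := \row_e (PhiE lam l 0 e + (l 0 e0 - 1)).
have sN k e : Cs k PE (fun l => N l 0 e).
  apply: (@Cs_eq _ _ k PE (fun l => PhiE lam l 0 e + (l 0 e0 - 1)) _ oP).
    by move=> x _; rewrite [RHS]mxE.
  apply: (CsD oP); first exact: (Cs_Phi Ecos (@Cs_euclid_cos R S)).
  by apply: (CsB oP); [exact: Cs_coord|exact: Cs_cst].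
have NE l : l 0 e0 = 1 -> N l = PhiE lam l.
  by move=> l1; apply/rowP => e; rewrite mxE l1 subrr addr0.
have inj v : 'D_v N l0 = 0 -> v = 0.
  move=> Dv.
  have dN e : 'D_v (fun x => PhiE lam x 0 e) l0 + v 0 e0 = 0.
    have dNl0 : differentiable N l0.
      by apply: differentiable_rV => i; exact: (sN 1%N i).1.
    have := derive_coordf v e dNl0; rewrite Dv mxE => <-.
    have -> : (fun y => N y 0 e) = (fun y => PhiE lam y 0 e + (y 0 e0 - 1)).
      by apply/funext => y; rewrite mxE.
    have D1 : is_derive l0 v (fun x => PhiE lam x 0 e) ('D_v (fun x => PhiE lam x 0 e) l0).
      by apply/derivableP/diff_derivable/(Cs_Phi Ecos (@Cs_euclid_cos R S) lam 1 e).1.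
    have D2 := is_deriveD' D1 (is_deriveB' (is_derive_coordv l0 v e0) (is_derive_cst (1 : R) l0 v)).
    by have [_ ->] := D2; rewrite subr0.
  have v0 : v 0 e0 = 0.
    (* Pairing with the normal vector, whose entries are positive, isolates v e0. Then the
       derivative of [Phi] along v vanishes, so v is a multiple of [l0], and v e0 = 0 makes it
       zero. *)
    have O := Phi_derivative_orthogonal lam v Pl0.
    have O2 : \sum_e - v 0 e0 * l0 0 e `^ (- lam) = 0.
      rewrite -[RHS]O; apply: eq_bigr => e _; congr (_ * _).
      by apply/esym/eqP; rewrite -addr_eq0 dN.
    move: O2; rewrite -mulr_sumr => /eqP; rewrite mulf_eq0 oppr_eq0 => /orP[/eqP//|].
    have l00 := metric_pos Ecos Pl0.
    rewrite psumr_eq0 => [/allP/(_ e0)|e _]; last exact: powR_ge0.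
    by rewrite mem_index_enum => /(_ isT) /=; rewrite gt_eqF // powR_gt0.
  have [_ H] := Phi_gradient_ge0 lam v Pl0.
  have [|c vc] := H.
    apply: big1 => e _; have := dN e; rewrite v0 addr0 => ->.
    by rewrite mul0r.
  by move: v0; rewrite vc mxE l01 mulr1 => ->; rewrite scale0r.
have [U1 [V1 [g [oU1 U1l0 U1P oV1 [sNU sgV UV VU]]]]] := inverse_function oP Pl0 sN inj.
(* The normalized metrics outside the chart. If their values accumulated at Phi l0, they would
   converge along an ultrafilter to a metric that rigidity identifies with [l0], and so enter [U1].
   Removing the closure of their image leaves one sheet. *)
pose D' := [set l : E | [/\ PE l, l 0 e0 = 1 & ~ U1 l]].
have nclos : ~ closure (PhiE lam @` D') (PhiE lam l0).
  move=> /closure_image_ultra[U UU [UD Uz]].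
  have UP : U PE by apply: filterS UD => l [].
  have U1' : \forall l \near U, (l : E) 0 e0 = 1 by apply: filterS UD => l [].
  have Uze e : (fun l => PhiE lam l 0 e) @ U --> PhiE lam l0 0 e.
    apply: (@cvg_comp _ _ _ (PhiE lam) (fun v : E => v 0 e) U (nbhs (PhiE lam l0)) (nbhs (PhiE lam l0 0 e)) Uz).
    exact: coord_continuous.
  have [l Pl [l1 lU lz]] := Phi_limit lam1 UU UP U1' Uze.
  have [c c0 lc] := Phi_rigid lam1 Pl Pl0 lz.
  have c1 : c = 1 by have := l01; rewrite lc mxE l1 mulr1.
  have ll0 : l = l0 by rewrite lc c1 scale1r.
  have UU1 : U U1 by apply: (cvg_coord _ lU); rewrite ll0; exact: open_nbhs_nbhs.
  by have [x [[_ _ nx] x1]] := filter_ex (filterI UD UU1).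
pose O := ~` closure (PhiE lam @` D').
have oO : open O by apply: closed_openC; exact: closed_closure.
(* Translation by [d] moves the slice l e0 = 1 to the coordinate hyperplane required of a slice
   chart. *)
pose d : E := delta_mx 0 e0.
have dE e : d 0 e = (e == e0)%:R by rewrite mxE eqxx.
pose Vc := [set y : E | U1 (y + d) /\ O (N (y + d))].
have sgc k e : Cs k V1 (fun x => g x 0 e) by exact: (Ck_coord oV1 (sgV k)).
have oNO : open [set x : E | U1 x /\ O (N x)].
  rewrite openE => x [Ux Ox]; apply: filterI; first exact: open_nbhs_nbhs.
  have cN : {for x, continuous N}.
    by apply: differentiable_continuous; apply: differentiable_rV => i; exact: (sN 1%N i).1 _ (U1P _ Ux).
  exact: cN (open_nbhs_nbhs (conj oO Ox)).
have oVc : open Vc.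
  have -> : Vc = (fun y => y + d) @^-1` [set x : E | U1 x /\ O (N x)] by [].
  by apply: open_comp => // y _; exact: cvgr_add_continuous.
have oUc : open (V1 `&` O) by exact: openI.
exists (V1 `&` O), Vc, (fun z => g z - d), (fun y => N (y + d)), e0; split.
- exact: oUc.
- by split; [rewrite -(NE l0 l01); exact: (UV _ U1l0).1|exact: nclos].
- exact: oVc.
- split.
  + move=> k; apply: Ck_rV => // e.
    apply: (@Cs_eq _ _ k (V1 `&` O) (fun z => g z 0 e - d 0 e) _ oUc).
      by move=> x _; rewrite rowB_coord.
    apply: (CsB oUc); last exact: Cs_cst.
    by apply: (Cs_sub _ (sgc k e)) => x [].
  + move=> k; apply: Ck_rV => // e.
    apply: (@Cs_comp R k n n Vc PE (fun x => N x 0 e) (fun y => y + d) oVc _ _ (sN k e)).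
      by move=> x [/U1P].
    move=> i; apply: (@Cs_eq _ _ k Vc (fun y => y 0 i + d 0 i) _ oVc).
      by move=> x _; rewrite [RHS]mxE.
    by apply: (CsD oVc); [exact: Cs_coord|exact: Cs_cst].
  + move=> x [Vx Ox]; have [Ug gx] := VU x Vx; rewrite /Vc /= !subrK gx.
    by split.
  + move=> y [Uy Oy]; have [VN gN] := UV _ Uy; split; first by [].
    by rewrite gN addrK.
- apply/seteqP; split=> [_ [z [[l Pl <-] [Vz Oz]] <-]|y [[Uy Oy] /= y0]].
    have [l1 [P1 l11 E1]] := normalized_metric lam e0 Pl.
    have Ul1 : U1 l1.
      apply: contrapT => nU; apply: Oz; apply: subset_closure.
      by exists l1; [split|exact: E1].
    have gl : g (PhiE lam l) = l1 by rewrite -E1 -(NE l1 l11); exact: (UV _ Ul1).2.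
    split; last by rewrite /= gl rowB_coord dE eqxx l11 subrr.
    rewrite /Vc /= gl subrK; split; first exact: Ul1.
    rewrite (NE l1 l11) E1; exact: Oz.
  have [VN gN] := UV _ Uy.
  have yd1 : (y + d) 0 e0 = 1 by rewrite mxE dE eqxx y0 add0r.
  exists (N (y + d)); last by rewrite gN addrK.
  split; last by [].
  by exists (y + d); [exact: U1P|rewrite (NE _ yd1)].
Qed.

End PhiImage.

(** * The image of Psi *)

Section Cycles.
Variable S : triangulated_surface.
Local Notation side := (ts_tri S * 'I_3)%type.

Lemma iter_repeats (T : finType) (f : T -> T) x : exists a p, iter (a + p.+1) f x = iter a f x.
Proof.
pose g (k : 'I_#|T|.+1) := iter k f x.
have /injectivePn[a [b ab gab]] : ~~ injectiveb g.
  by apply/injectiveP => /leq_card; rewrite card_ord ltnn.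
wlog lt : a b ab gab / (a < b)%N.
  move=> H; have [lt|lt|E] := ltngtP a b; first exact: (H a b).
    by apply: (H b a) => //; rewrite eq_sym.
  by move/eqP: ab; case; apply: val_inj.
exists a, (b - a.+1)%N; rewrite -[RHS]/(g a) gab /g; congr (iter _ f x).
by rewrite addnS -addSn subnKC.
Qed.

(** A deterministic walk on the finitely many sides becomes periodic, and one period is an edge
    cycle; a state is the side through which a triangle is entered. *)
Lemma cycle_of_walk (P : side -> Prop) (out : side -> 'I_3) (next : side -> side) s0 :
  P s0 ->
  (forall s, P s -> [/\ out s != s.2, ts_edge (s.1, out s) = ts_edge (next s),
     (s.1, out s) != next s & P (next s)]) ->
  exists c : edge_cycle S, forall i, P (ec_tri i, ec_in (e := c) i) /\
    ec_out (e := c) i = out (ec_tri i, ec_in (e := c) i).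
Proof.
move=> P0 H.
have [a [p E]] := iter_repeats next s0.
pose x k := iter k next s0.
have Px k : P (x k) by elim: k => [//|k /H[]].
pose y (i : 'I_p.+1) := x (a + i)%N.
have yS i : y (ordS i) = next (y i).
  rewrite /y /=; have [ip|ip] := ltnP i p.
    by rewrite modn_small ?addnS // ltnS.
  (* The last index, where the successor wraps around to 0 and periodicity is used. *)
  have -> : val i = p by apply/eqP; rewrite eqn_leq -ltnS ltn_ord.
  by rewrite modnn addn0 -[LHS]E addnS.
have h1 i : (y i).2 != out (y i) by have [+ _ _ _] := H _ (Px (a + i)%N); rewrite eq_sym.
have h2 i : ts_edge ((y i).1, out (y i)) = ts_edge ((y (ordS i)).1, (y (ordS i)).2).
  by have [_ + _ _] := H _ (Px (a + i)%N); rewrite -/(y i) -yS => ->; case: (y (ordS i)).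
have h3 i : ((y i).1, out (y i)) != ((y (ordS i)).1, (y (ordS i)).2).
  by have [_ _ + _] := H _ (Px (a + i)%N); rewrite -/(y i) -yS; case: (y (ordS i)).
exists (EdgeCycle h1 h2 h3) => i /=.
have -> : ((y i).1, (y i).2) = y i by case: (y i).
by split; [exact: Px|].
Qed.

End Cycles.

Section PositiveCycles.
Variable R : realType.
Variable S : triangulated_surface.
Local Notation PH := (polyhedral_metric (hyperbolic_plane R) S).
Local Notation Hcos := (@hyperbolic_cosine_law R).
Local Notation angH := (inner_angle (hyperbolic_plane R)).

(** Two radii of a triangle add up to the angle between the corresponding sides. Applied to limit
    angles and to the angles of a metric. *)
Lemma limit_radius_add (th : ts_tri S * 'I_3 -> R) t i :
  limit_radius th (t, i) + limit_radius th (t, ordS i) = th (t, ord_pred i) /\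
  limit_radius th (t, i) + limit_radius th (t, ord_pred i) = th (t, ordS i).
Proof. by rewrite /limit_radius /= !ord3E; split; lra. Qed.

Lemma angle_integral_add_gt0 (lam x y : R) : - (pi / 2) < x < pi / 2 ->
  - (pi / 2) < y < pi / 2 -> 0 < x + y ->
  0 < angle_integral lam (x + pi / 2) + angle_integral lam (y + pi / 2).
Proof.
move=> x0 y0 xy; rewrite addrC -[X in _ + X]opprK -angle_integral_odd // subr_gt0.
by apply: angle_integral_lt; lra.
Qed.

(** Grouped by triangles, each term involves two radii whose sum is a positive angle; without
    backtracking the entry and exit sides are distinct. *)
Lemma Psi_cycle_sum_gt0 lam l (c : edge_cycle S) : PH l ->
  0 < cycle_sum c (Psi (hyperbolic_plane R) lam l).
Proof.
move=> Pl.
have zX e : Psi (hyperbolic_plane R) lam l 0 e = \sum_(s | ts_edge s == e)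
    angle_integral lam (radius (hyperbolic_plane R) l s + pi / 2).
  exact: (PsiE Hcos (@hyp_ang_sum_le R S)).
rewrite (cycle_sum_sides c zX).
have H i : 0 < angle_integral lam (radius (hyperbolic_plane R) l (ec_tri i, ec_in (e := c) i) + pi / 2) +
   angle_integral lam (radius (hyperbolic_plane R) l (ec_tri i, ec_out (e := c) i) + pi / 2).
  apply: angle_integral_add_gt0; try exact: (radius_bound Hcos (@hyp_ang_sum_le R S)).
  have [h1 h2] := limit_radius_add (angH l) (ec_tri i) (ec_in (e := c) i).
  have := ec_no_backtrack (e := c) i.
  have [->|->|->] := ord3_cases (ec_in (e := c) i) (ec_out (e := c) i); first by rewrite eqxx.
    by move=> _; rewrite [X in 0 < X]h1; have /andP[] := ang_bound Hcos (ec_tri i, ord_pred (ec_in (e := c) i)) Pl.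
  by move=> _; rewrite [X in 0 < X]h2; have /andP[] := ang_bound Hcos (ec_tri i, ordS (ec_in (e := c) i)) Pl.
rewrite big_ord_recl ltr_pwDl ?H // sumr_ge0 // => i _.
by rewrite ltW.
Qed.

End PositiveCycles.

(** * Zero limit angles and edges of infinite length *)

Section HyperbolicBoundary.
Variable R : realType.
Variable S : triangulated_surface.
Local Notation E := ('rV[R]_(ts_nedge S)).
Local Notation PH := (polyhedral_metric (hyperbolic_plane R) S).
Local Notation Hcos := (@hyperbolic_cosine_law R).
Local Notation angH := (inner_angle (hyperbolic_plane R)).
Implicit Types (l : E) (t : ts_tri S) (e : 'I_(ts_nedge S)).

Lemma hyp_dual l t i : PH l ->
  cosh (l 0 (ts_edge (t, i))) * (sin (angH l (t, ordS i)) * sin (angH l (t, ord_pred i))) =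
  cos (angH l (t, i)) + cos (angH l (t, ordS i)) * cos (angH l (t, ord_pred i)).
Proof.
move=> Pl; have [cA cB cC] := corner_data Hcos t i Pl.
have l0 := metric_pos Hcos Pl; have ab s := ang_bound Hcos s Pl.
exact: (hyp_dual_cosine (l0 _) (l0 _) (l0 _) (ab _) (ab _) (ab _) cA cB cC).
Qed.

Lemma hyp_sine_ratio l t i j : PH l ->
  sinh (l 0 (ts_edge (t, j))) / sinh (l 0 (ts_edge (t, i))) = sin (angH l (t, j)) / sin (angH l (t, i)).
Proof.
move=> Pl; have l0 := metric_pos Hcos Pl; have ab s := ang_bound Hcos s Pl.
have si := lt0r_neq0 (sinh_gt0 (l0 (ts_edge (t, i)))).
have ai := lt0r_neq0 (sin_gt0_pi (ab (t, i))).
have H : sin (angH l (t, i)) * sinh (l 0 (ts_edge (t, j))) = sin (angH l (t, j)) * sinh (l 0 (ts_edge (t, i))).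
  have [cA cB cC] := corner_data Hcos t i Pl.
  have h1 := hyp_law_of_sines (l0 _) (l0 _) (l0 _) (ab _) (ab _) (ab _) cA cB cC.
  have h2 := hyp_law_of_sines (l0 _) (l0 _) (l0 _) (ab _) (ab _) (ab _) cC cA cB.
  by have [->|->|->] := ord3_cases i j; [|exact: h1|rewrite h2].
by apply/eqP; rewrite eqr_div // mulrC H mulrC.
Qed.

Lemma cosh_arcosh (C : R) : 1 < C -> 0 < arcosh C /\ cosh (arcosh C) = C.
Proof.
move=> C1; have C2 : 0 < C ^+ 2 - 1 by nra.
rewrite /arcosh; set s := Num.sqrt _.
have s0 : 0 < s by rewrite sqrtr_gt0.
have s2 : s ^+ 2 = C ^+ 2 - 1 by rewrite sqr_sqrtr // ltW.
split; first by apply: ln_gt0; lra.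
have Cs : 0 < C + s by rewrite addr_gt0 // (lt_trans ltr01).
rewrite /cosh expRN lnK ?posrE //.
have -> : (C + s)^-1 = C - s.
  apply: (mulfI (lt0r_neq0 Cs)); rewrite mulfV ?gt_eqF //.
  by transitivity (C ^+ 2 - s ^+ 2); [rewrite s2; ring|ring].
by field.
Qed.

Lemma sinh_sqrt (a : R) : 0 < a -> sinh a = Num.sqrt (cosh a ^+ 2 - 1).
Proof.
move=> a0; have -> : cosh a ^+ 2 - 1 = sinh a ^+ 2 by rewrite cosh2; ring.
by rewrite sqrtr_sqr gtr0_norm // sinh_gt0.
Qed.

Variables (lam : R) (lam1 : lam <= -1) (U : set_system E).
Hypothesis UU : UltraFilter U.
Hypothesis UP : U PH.
Variable th : ts_tri S * 'I_3 -> R.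
Hypothesis thU : forall s, (fun l => angH l s) @ U --> th s.
Hypothesis th0 : forall s, 0 <= th s <= pi.
Hypothesis thsum : forall t i, th (t, i) + th (t, ordS i) + th (t, ord_pred i) <= pi.
Hypothesis rlt : forall s, limit_radius th s < pi / 2.
Hypothesis rgt : forall s, - (pi / 2) < limit_radius th s.

Let sinU s : (fun l => sin (angH l s)) @ U --> sin (th s).
Proof. exact: cvg_comp_continuous (@thU s) (@continuous_sin R (th s)). Qed.

Let cosU s : (fun l => cos (angH l s)) @ U --> cos (th s).
Proof. exact: cvg_comp_continuous (@thU s) (@continuous_cos R (th s)). Qed.

Let numU t i : (fun l => cos (angH l (t, i)) + cos (angH l (t, ordS i)) * cos (angH l (t, ord_pred i))) @ U
  --> cos (th (t, i)) + cos (th (t, ordS i)) * cos (th (t, ord_pred i)).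
Proof. by apply: cvgD; [exact: cosU|apply: cvgM; exact: cosU]. Qed.

Let denU t i : (fun l => sin (angH l (t, ordS i)) * sin (angH l (t, ord_pred i))) @ U
  --> sin (th (t, ordS i)) * sin (th (t, ord_pred i)).
Proof. by apply: cvgM; exact: sinU. Qed.

Lemma limit_angle_lt_pi s : th s < pi.
Proof.
case: s => t i; have [h _] := limit_radius_add th t (ordS i).
by rewrite !ord3E in h; have := rlt (t, ordS i); have := rlt (t, ord_pred i); lra.
Qed.

Let limit_angle_ge0 s : 0 <= th s.
Proof. by have /andP[] := th0 s. Qed.

Lemma cos_add_gt0 (x y : R) : 0 <= x -> 0 <= y -> x + y < pi -> 0 < cos x + cos y.
Proof.
move=> x0 y0 xy; have p0 := @pi_gt0 R.
have : cos (pi - y) < cos x by rewrite ltr_cos ?in_itv /=; lra.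
by rewrite cosB cospi sinpi mul0r addr0 mulN1r; lra.
Qed.

Definition unbounded_edge e := forall M, \forall l \near U, M < cosh ((l : E) 0 e).

Lemma zero_angle_unbounded t i : th (t, ordS i) = 0 \/ th (t, ord_pred i) = 0 ->
  unbounded_edge (ts_edge (t, i)).
Proof.
move=> zero M.
pose N := cos (th (t, i)) + cos (th (t, ordS i)) * cos (th (t, ord_pred i)).
have tA := limit_angle_ge0 (t, i); have tB := limit_angle_ge0 (t, ordS i).
have tC := limit_angle_ge0 (t, ord_pred i).
have rB := rlt (t, ordS i); have rC := rlt (t, ord_pred i).
rewrite /limit_radius /= !ord3E in rB rC.
(* With one of the angles zero, the numerator of the dual cosine law tends to cos x + cos y, and the
   strict bound on a radius gives x + y < pi. The denominator tends to zero. *)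
have N0 : 0 < N.
  rewrite /N; case: zero => z0; rewrite z0 cos0 ?mul1r ?mulr1; apply: cos_add_gt0 => //; lra.
have D0 : sin (th (t, ordS i)) * sin (th (t, ord_pred i)) = 0.
  by case: zero => ->; rewrite sin0 ?mul0r ?mulr0.
pose M' := `|M| + 1.
have M0 : 0 < M' by rewrite ltr_wpDl.
have MM : M < M' by rewrite (le_lt_trans (ler_norm M)) // ltrDl.
have n1 : \forall l \near U, N / 2 <
    cos (angH l (t, i)) + cos (angH l (t, ordS i)) * cos (angH l (t, ord_pred i)).
  by apply: (cvg_near_gt (@numU t i)); rewrite -/N ltr_pdivrMr // ltr_pMr // ltr1n.
have n2 : \forall l \near U, sin (angH l (t, ordS i)) * sin (angH l (t, ord_pred i)) < N / 2 / M'.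
  by apply: (cvg_near_lt (@denU t i)); rewrite D0 !divr_gt0.
apply: filterS (filterI UP (filterI n1 n2)) => l [Pl [l1 l2]].
apply: (lt_trans MM).
have s0 : 0 < sin (angH l (t, ordS i)) * sin (angH l (t, ord_pred i)).
  by apply: mulr_gt0; apply: sin_gt0_pi; exact: (ang_bound Hcos).
rewrite -(ltr_pM2r s0) hyp_dual //; apply: lt_trans l1.
by move: l2; rewrite ltr_pdivlMr // mulrC.
Qed.

Lemma unbounded_zero_angle t i : unbounded_edge (ts_edge (t, i)) ->
  th (t, ordS i) = 0 \/ th (t, ord_pred i) = 0.
Proof.
move=> unb; have [/eqP ->|tB] := boolP (th (t, ordS i) == 0); first by left.
have [/eqP ->|tC] := boolP (th (t, ord_pred i) == 0); first by right.
exfalso.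
have pos s : th s != 0 -> 0 < sin (th s).
  by move=> ts; apply: sin_gt0_pi; rewrite lt_neqAle eq_sym ts limit_angle_ge0 limit_angle_lt_pi.
pose D := sin (th (t, ordS i)) * sin (th (t, ord_pred i)).
have D0 : 0 < D by apply: mulr_gt0; exact: pos.
have n1 : \forall l \near U, D / 2 < sin (angH l (t, ordS i)) * sin (angH l (t, ord_pred i)).
  by apply: (cvg_near_gt (@denU t i)); rewrite -/D ltr_pdivrMr // ltr_pMr // ltr1n.
(* The numerator of the dual cosine law is at most 2 and the denominator eventually exceeds D / 2,
   so cosh cannot exceed 4 / D. *)
have [l [Pl [l1 l2]]] := filter_ex (filterI UP (filterI n1 (unb (4 / D)))).
have := hyp_dual t i Pl.
have c1 := cos_le1 (angH l (t, i)).
have c2 : cos (angH l (t, ordS i)) * cos (angH l (t, ord_pred i)) <= 1.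
  by rewrite (le_trans (ler_norm _)) // normrM mulr_ile1 ?cos_max.
have D2 : 0 < D / 2 by rewrite divr_gt0.
have : 4 / D * (D / 2) < cosh (l 0 (ts_edge (t, i))) *
    (sin (angH l (t, ordS i)) * sin (angH l (t, ord_pred i))).
  by apply: ltr_pM => //; apply: ltW => //; rewrite divr_gt0.
have -> : 4 / D * (D / 2) = 2 by field; exact: lt0r_neq0.
by move: (cosh _) => c h E2; move: h; rewrite E2; lra.
Qed.

Variable z : E.
Hypothesis zE : forall e, z 0 e =
  \sum_(c | ts_edge c == e) angle_integral lam (limit_radius th c + pi / 2).

(** Entering a triangle through an unbounded edge, the walk leaves it by turning around an endpoint
    with zero limit angle. The exit side meets this vertex too, so it is unbounded, and the two
    limit radii add up to the zero angle. *)
Lemma zero_angle_cycle : (exists s, th s = 0) -> exists c : edge_cycle S, cycle_sum c z = 0.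
Proof.
move=> [[t0 m0] tm].
pose P s := unbounded_edge (@ts_edge S s).
have step s : exists js : 'I_3 * (ts_tri S * 'I_3), P s ->
   [/\ js.1 != s.2, ts_edge (s.1, js.1) = ts_edge js.2, (s.1, js.1) != js.2, P js.2 &
       limit_radius th s + limit_radius th (s.1, js.1) = 0].
  (* Choice needs a value at every side; off the unbounded edges it is arbitrary. *)
  case: s => t i; have [Ps|nPs] := pselect (P (t, i)); last by exists (i, (t, i)) => /nPs.
  suff [j [ji Pj rj]] : exists j, [/\ j != i, P (t, j) &
      limit_radius th (t, i) + limit_radius th (t, j) = 0].
    have [s' [ss' es' _]] := edge_partner (t, j).
    by exists (j, s') => _; split=> //=; [rewrite eq_sym|rewrite /P es'].
  have [h1 h2] := limit_radius_add th t i.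
  have nS : ordS i != i by case: (i) => -[|[|[|]]].
  have nP : ord_pred i != i by case: (i) => -[|[|[|]]].
  have [tz|tz] := unbounded_zero_angle Ps.
    exists (ord_pred i); split=> //; last by rewrite h2.
    by apply: zero_angle_unbounded; rewrite !ord3E; right.
  exists (ordS i); split=> //; last by rewrite h1.
  by apply: zero_angle_unbounded; rewrite !ord3E; left.
have [f Hf] := choice step.
have P0 : P (t0, ordS m0).
  by apply: zero_angle_unbounded; rewrite !ord3E; right.
have [|c Hc] := @cycle_of_walk S P (fun s => (f s).1) (fun s => (f s).2) _ P0.
  by move=> s /Hf[].
exists c; rewrite (cycle_sum_sides c zE); apply: big1 => i _.
have [Pi ->] := Hc i; have [_ _ _ _ /= r0] := Hf _ Pi.
set x := limit_radius th _ in r0 *; set y := limit_radius th _ in r0 *.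
have -> : y = - x by lra.
by rewrite angle_integral_odd ?subrr // rlt rgt.
Qed.

End HyperbolicBoundary.

(** * Limits with positive angles *)

Section PositiveAngles.
Variable R : realType.
Variable S : triangulated_surface.
Local Notation E := ('rV[R]_(ts_nedge S)).
Local Notation PE := (polyhedral_metric (euclidean_plane R) S).
Local Notation PH := (polyhedral_metric (hyperbolic_plane R) S).
Local Notation Hcos := (@hyperbolic_cosine_law R).
Local Notation angH := (inner_angle (hyperbolic_plane R)).
Implicit Types (l : E) (t : ts_tri S) (e : 'I_(ts_nedge S)).
Variables (U : set_system E).
Hypothesis UU : UltraFilter U.
Hypothesis UP : U PH.
Variable th : ts_tri S * 'I_3 -> R.
Hypothesis thU : forall s, (fun l => angH l s) @ U --> th s.
Hypothesis th0 : forall s, 0 < th s < pi.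
Hypothesis thsum : forall t i, th (t, i) + th (t, ordS i) + th (t, ord_pred i) <= pi.

Let sin_th s : 0 < sin (th s).
Proof. exact: sin_gt0_pi. Qed.

Let sinU s : (fun l => sin (angH l s)) @ U --> sin (th s).
Proof. exact: cvg_comp_continuous (@thU s) (@continuous_sin R (th s)). Qed.

Let cosU s : (fun l => cos (angH l s)) @ U --> cos (th s).
Proof. exact: cvg_comp_continuous (@thU s) (@continuous_cos R (th s)). Qed.

Let dual t i := (cos (th (t, i)) + cos (th (t, ordS i)) * cos (th (t, ord_pred i))) /
  (sin (th (t, ordS i)) * sin (th (t, ord_pred i))).

Let cosh_cvg t i : (fun l => cosh (l 0 (ts_edge (t, i)))) @ U --> dual t i.
Proof.
have N : (fun l => cos (angH l (t, i)) + cos (angH l (t, ordS i)) * cos (angH l (t, ord_pred i))) @ U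
  --> cos (th (t, i)) + cos (th (t, ordS i)) * cos (th (t, ord_pred i)).
  by apply: cvgD; [exact: cosU|apply: cvgM; exact: cosU].
have D : (fun l => sin (angH l (t, ordS i)) * sin (angH l (t, ord_pred i))) @ U
  --> sin (th (t, ordS i)) * sin (th (t, ord_pred i)).
  by apply: cvgM; exact: sinU.
have D0 : sin (th (t, ordS i)) * sin (th (t, ord_pred i)) != 0.
  by rewrite mulf_neq0 // lt0r_neq0.
have C : (fun l => (cos (angH l (t, i)) + cos (angH l (t, ordS i)) * cos (angH l (t, ord_pred i))) /
    (sin (angH l (t, ordS i)) * sin (angH l (t, ord_pred i)))) @ U --> dual t i.
  by apply: cvgM => //; exact: cvgV D0 D.
apply: cvg_near_eq C; apply: filterS UP => l Pl /=.
rewrite -hyp_dual // mulfK //.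
by apply: mulf_neq0; apply/lt0r_neq0/sin_gt0_pi; exact: (ang_bound Hcos).
Qed.

(** The dual cosine law gives (C - 1) sin B sin C' = cos A + cos (B + C') for the limit angles A, B,
    C'; this vanishes exactly when they add up to pi. *)
Lemma cosh_limit : exists C : 'I_(ts_nedge S) -> R,
  [/\ forall e, (fun l => cosh (l 0 e)) @ U --> C e,
      forall t i, th (t, i) + th (t, ordS i) + th (t, ord_pred i) = pi -> C (ts_edge (t, i)) = 1 &
      forall t i, th (t, i) + th (t, ordS i) + th (t, ord_pred i) != pi -> 1 < C (ts_edge (t, i))].
Proof.
have /choice[C HC] : forall e, exists c : R, (fun l => cosh (l 0 e)) @ U --> c.
  by move=> e; have [[t i] <-] := edge_side e; exists (dual t i); exact: cosh_cvg.
have key t i : (C (ts_edge (t, i)) - 1) * (sin (th (t, ordS i)) * sin (th (t, ord_pred i))) =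
    cos (th (t, i)) + cos (th (t, ordS i) + th (t, ord_pred i)).
  rewrite (cvg_uniq (@HC (ts_edge (t, i))) (@cosh_cvg t i)) mulrBl divfK.
    by rewrite cosD; ring.
  by rewrite mulf_neq0 // lt0r_neq0.
have ss0 t i : 0 < sin (th (t, ordS i)) * sin (th (t, ord_pred i)) by rewrite mulr_gt0.
exists C; split=> // t i sumE.
  have := key t i; have -> : th (t, ordS i) + th (t, ord_pred i) = pi - th (t, i) by lra.
  rewrite cosB cospi sinpi mul0r addr0 mulN1r subrr => /eqP.
  by rewrite mulf_eq0 (gt_eqF (ss0 t i)) orbF subr_eq0 => /eqP.
have sum_lt : th (t, i) + (th (t, ordS i) + th (t, ord_pred i)) < pi.
  by rewrite addrA lt_neqAle sumE thsum.
have /andP[a0 _] := th0 (t, i); have /andP[b0 _] := th0 (t, ordS i).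
have /andP[c0 _] := th0 (t, ord_pred i).
have : 0 < cos (th (t, i)) + cos (th (t, ordS i) + th (t, ord_pred i)).
  by apply: cos_add_gt0 => //; [exact: ltW|rewrite addr_ge0 // ltW].
by rewrite -key pmulr_lgt0 ?subr_gt0.
Qed.

(** One non-flat limit triangle suffices: a flat triangle has all its limit lengths zero, so it
    cannot share an edge with a non-flat one, and the surface is connected. *)
Lemma hyperbolic_limit_metric (t0 : ts_tri S) :
  th (t0, 0) + th (t0, ordS 0) + th (t0, ord_pred 0) != pi ->
  exists2 l, PH l & forall s, angH l s = th s.
Proof.
move=> st0; have [C [CU C1 Cgt]] := cosh_limit.
have Cgt1 e : 1 < C e.
  apply: (@edges_connected S (fun e => 1 < C e) (ts_edge (t0, 0))); first exact: Cgt.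
  move=> t i j Ci; apply: Cgt; apply/eqP => sumE.
  suff sumi : th (t, i) + th (t, ordS i) + th (t, ord_pred i) = pi.
    by move: Ci; rewrite C1 // ltxx.
  by rewrite -[LHS](ord3_sum (fun j => th (t, j))) (ord3_sum _ j).
pose l : E := \row_e arcosh (C e).
have lE e : 0 < l 0 e /\ cosh (l 0 e) = C e by rewrite mxE; exact: cosh_arcosh.
have l0 e : 0 < l 0 e by have [] := lE e.
have sinhU e : (fun l => sinh (l 0 e)) @ U --> sinh (l 0 e).
  rewrite sinh_sqrt // (lE e).2.
  have H : (fun l => Num.sqrt (cosh (l 0 e) ^+ 2 - 1)) @ U --> Num.sqrt (C e ^+ 2 - 1).
    apply: (@cvg_comp_continuous R E U (fun l => cosh (l 0 e))
      (fun c => Num.sqrt (c ^+ 2 - 1)) _ (@CU e)).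
    apply: (@continuous_comp _ _ _ (fun c : R => c ^+ 2 - 1) (@Num.sqrt R)).
      by apply: cvgB; [exact: exprn_continuous|exact: cvg_cst].
    exact: sqrt_continuous.
  by apply: cvg_near_eq H; apply: filterS UP => x /(metric_pos Hcos) x0; rewrite -sinh_sqrt.
have cc s : corner_cos (@hyp_cos R) l s = cos (th s).
  case: s => t i.
  have ns e : sinh (l 0 e) != 0 by apply/lt0r_neq0/sinh_gt0.
  have H : (fun x => corner_cos (@hyp_cos R) x (t, i)) @ U -->
      corner_cos (@hyp_cos R) l (t, i).
    rewrite /corner_cos /hyp_cos /= !(lE _).2.
    apply: cvgM; first by apply: cvgB; [apply: cvgM|]; exact: CU.
    apply: cvgV; first by apply: mulf_neq0; exact: ns.
    by apply: cvgM; exact: sinhU.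
  apply/esym/(cvg_uniq (@cosU (t, i))); apply: cvg_near_eq H.
  by apply: filterS UP => x Px; rewrite (cos_ang Hcos).
by have [] := metric_of_angles Hcos l0 th0 cc; exists l.
Qed.

Variables (lam : R) (z : E).
Hypothesis zE : forall e, z 0 e =
  \sum_(c | ts_edge c == e) angle_integral lam (limit_radius th c + pi / 2).

Lemma positive_angle_image :
  (Psi (hyperbolic_plane R) lam @` PH) z \/ (Phi (euclidean_plane R) lam @` PE) (- z).
Proof.
have [[t0 st0]|flat] := pselect (exists t, th (t, 0) + th (t, ordS 0) + th (t, ord_pred 0) != pi).
  left; have [l Pl lth] := hyperbolic_limit_metric st0; exists l => //.
  apply/rowP => e; rewrite (PsiE Hcos (@hyp_ang_sum_le R S)) // zE.
  by apply: eq_bigr => c _; rewrite /radius /limit_radius !lth.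
right; have sumE t i : th (t, i) + th (t, ordS i) + th (t, ord_pred i) = pi.
  rewrite -[LHS](ord3_sum (fun j => th (t, j))) (ord3_sum _ 0).
  by apply: contrapT => /eqP st; apply: flat; exists t.
have [e0 _] := edge_exists S.
(* All lengths tend to zero, so they are rescaled at [e0]. Replacing lengths by their sinh makes the
   ratios within a triangle exactly ratios of sines. *)
have [|||l Pl [_ _ lth]] := @euclid_limit_metric R S E U _ th
    (fun e l => sinh (l 0 e) / sinh (l 0 e0)) e0 th0 sumE.
- move=> t i j.
  have C : (fun l => sin (angH l (t, j)) / sin (angH l (t, i))) @ U -->
      sin (th (t, j)) / sin (th (t, i)).
    by apply: cvgM; [exact: sinU|apply: cvgV; [exact: lt0r_neq0|exact: sinU]].
  apply: cvg_near_eq C; apply: filterS UP => l Pl; rewrite -hyp_sine_ratio //.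
  have l0 e := lt0r_neq0 (sinh_gt0 (metric_pos Hcos Pl e)).
  by field; rewrite !l0.
- apply: filterS UP => l Pl e.
  by apply: divr_gt0; apply: sinh_gt0; exact: (metric_pos Hcos Pl).
- apply: filterS UP => l Pl; rewrite divff //.
  exact: lt0r_neq0 (sinh_gt0 (metric_pos Hcos Pl e0)).
have lr c : limit_radius th c = pi / 2 - th c.
  by case: c => t i; have := sumE t i; rewrite /limit_radius /=; lra.
exists l => //; apply/rowP => e; rewrite PhiE mxE zE -sumrN; apply: eq_bigr => c _.
rewrite lth lr -angle_integralN; last by have := th0 c; lra.
by congr angle_integral; lra.
Qed.

End PositiveAngles.

Unset Implicit Arguments.

Theorem theorem9p1 (R : realType) (S : triangulated_surface) (lam : R)
    (hlam : lam <= -1) :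
  let PhiE2 := Phi (euclidean_plane R) lam @`
                 polyhedral_metric (euclidean_plane R) S in
  let PsiH2 := Psi (hyperbolic_plane R) lam @`
                 polyhedral_metric (hyperbolic_plane R) S in
  (closed PhiE2 /\ smooth_hypersurface PhiE2) /\
  (open PsiH2 /\
   bounded_by PsiH2 [set z | PhiE2 (- z)] (range (@cycle_sum R S))).
Proof.
move=> PhiE2 PsiH2.
split; first by split; [exact: closed_Phi_image|exact: hypersurface_Phi_image].
have oPsi : open PsiH2 := @open_Psi_image R S lam.
split=> //; split=> [_ [l Pl <-] _ [c _ <-]|z]; first exact: Psi_cycle_sum_gt0.
(* As the image is open, a boundary point is a point of the closure outside the image; this excludes
   the first alternative of [positive_angle_image]. *)
move=> [cz]; rewrite ((interior_id PsiH2).1 oPsi) => nz.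
have [U UU [UP Uz]] := closure_image_ultra cz.
have Uze e : (fun l => Psi (hyperbolic_plane R) lam l 0 e) @ U --> z 0 e.
  apply: (@cvg_comp _ _ _ (Psi (hyperbolic_plane R) lam) (fun v : 'rV[R]_(ts_nedge S) => v 0 e)
    U (nbhs z) (nbhs (z 0 e)) Uz).
  exact: coord_continuous.
have Hcos := @hyperbolic_cosine_law R.
have Hsum := @hyp_ang_sum_le R S; have Hobt := @hyp_ang_obtuse R S.
have [th [thU th0 thS]] := angle_limits Hcos Hsum UU UP.
have r1 := limit_radius_lt Hcos Hsum Hobt hlam UU UP Uze thU th0 thS.
have r2 := limit_radius_gt Hcos Hsum Hobt hlam UU UP Uze thU th0 thS.
have zE := limit_value Hcos Hsum Hobt hlam UU UP Uze thU th0 thS.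
have [zero|pos] := pselect (exists s, th s = 0).
  right; have [c cz0] := zero_angle_cycle UU UP thU th0 r1 r2 zE zero.
  by exists (cycle_sum c) => //; exists c.
left; have thb s : 0 < th s < pi.
  rewrite (limit_angle_lt_pi r1) andbT lt_neqAle; have /andP[-> _] := th0 s.
  by rewrite andbT; apply/eqP => ths; apply: pos; exists s.
by have [/nz|] := positive_angle_image UU UP thU thb thS zE.
Qed.
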